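(* Let $\gamma\in(-2,0)$ and consider the Cauchy problem for the spatially homogeneous Landau equation on $\mathbb{R}^3$, $$\partial_t f=\sum_{i,j}\partial_{v_i}\Big\{\int_{\mathbb{R}^3}a_{ij}(v-v_* )\big(f(t,v_* )\,\partial_{v_j}f(t,v)-f(t,v)\,\partial_{v_{*j}}f(t,v_* )\big)\,dv_*\Big\},\qquad a_{ij}(z)=|z|^{\gamma+2}\Big(\delta_{ij}-\frac{z_iz_j}{|z|^2}\Big),$$ with nonnegative initial datum $f_0\in L^1_2(\mathbb{R}^3)\cap L\log L(\mathbb{R}^3)\cap L^2(\mathbb{R}^3)$ whose mass $m_0$, energy $e_0$ and entropy $H_0$ are finite. Let $$\mu=\frac{-4\gamma(3-\gamma)}{3(2+\gamma)},\qquad M_\mu(t)=\int_{\mathbb{R}^3}f(t,v)\langle v\rangle^\mu\,dv,$$ and assume that there is a constant $c_\mu$ with $M_\mu(t)\le c_\mu(1+t)$ for all $t\ge0$. Then the solution satisfies the a priori estimate $$\|f(t)\|_{L^2(\mathbb{R}^3)}^2\le C(1+t)^2\qquad\text{for all }t\ge0,$$ with a constant $C$ independent of $t$.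
   Context: Notation: $\langle v\rangle=(1+|v|^2)^{1/2}$; $\|f\|_{L^1_s}=\int_{\mathbb{R}^3}|f(v)|\langle v\rangle^s\,dv$; $L\log L(\mathbb{R}^3)=\{f\in L^1(\mathbb{R}^3):\int|f|\,|\log|f||\,dv<\infty\}$. The initial mass, energy and entropy are $m_0=\int f_0\,dv$, $e_0=\frac12\int f_0|v|^2\,dv$, $H_0=\int f_0\log f_0\,dv$. Meaning of ''a priori estimate'': the bound is asserted for every nonnegative solution $f$ of the Cauchy problem on $[0,\infty)$ that is regular and decaying enough for the usual formal computations to be valid (e.g. $f\in C^1([0,\infty);\mathcal{S}(\mathbb{R}^3))$), and that satisfies conservation of mass, momentum and energy, $\int f(t,v)\varphi(v)\,dv=\int f_0(v)\varphi(v)\,dv$ for $\varphi=1,v,|v|^2/2$, and entropy decay $\int f(t)\log f(t)\,dv\le\int f_0\log f_0\,dv$ for all $t>0$. The constant $C$ does not depend on the regularity of $f$, only on $\gamma,m_0,e_0,H_0,c_\mu$ and $\|f_0\|_{L^2}$. *)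

(* Defs.v *)
(* Functions on R^3 are functions on the binary product R * R * R, which carries
   both the normed-module structure (for derivatives) and the product
   sigma-algebra (for Lebesgue integration).  The library norm on it is the max
   norm; the Euclidean norm is [enorm]. *)
From HB Require Import structures.
From mathcomp Require Import all_boot all_order all_algebra.
From mathcomp Require Import all_classical all_reals all_analysis.
Set Implicit Arguments.
Unset Strict Implicit.
Unset Printing Implicit Defensive.
Import Order.TTheory GRing.Theory Num.Theory.
Import numFieldNormedType.Exports.
Local Open Scope classical_set_scope.
Local Open Scope ring_scope.

Notation R3 R := (R * R * R)%type.

Section lebesgue_R3.
Local Open Scope ereal_scope.

(* The library's sigma-finiteness instance for products is masked by the one for
   subprobabilities, hence is not inferred for lebesgue_measure. *)
Lemma product_measure1_sigma_finite (d1 d2 : measure_display)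
    (T1 : measurableType d1) (T2 : measurableType d2) (R : realType)
    (m1 : {sigma_finite_measure set T1 -> \bar R})
    (m2 : {sigma_finite_measure set T2 -> \bar R}) :
  sigma_finite [set: T1 * T2] (m1 \x m2).
Proof.
have /sigma_finiteP[F [TF ndF Foo]] := sigma_finiteT m1.
have /sigma_finiteP[G [TG ndG Goo]] := sigma_finiteT m2.
exists (fun n => F n `*` G n).
  rewrite -setXTT TF TG predeqE => -[x y]; split.
    move=> [/= [n _ Fnx] [k _ Gky]]; exists (maxn n k) => //; split.
    - by move: x Fnx; exact/subsetPset/ndF/leq_maxl.
    - by move: y Gky; exact/subsetPset/ndG/leq_maxr.
  by move=> [n _ []/= ? ?]; split; exists n.
move=> k; have [? ?] := Foo k; have [? ?] := Goo k.
split; first exact: measurableX.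
by rewrite product_measure1E// lte_mul_pinfty// ge0_fin_numE.
Qed.

Definition leb2 {R : realType} := @lebesgue_measure R \x @lebesgue_measure R.

HB.instance Definition _ (R : realType) := Measure.on (@leb2 R).
HB.instance Definition _ (R : realType) :=
  Measure_isSigmaFinite.Build _ _ _ (@leb2 R)
    (product_measure1_sigma_finite lebesgue_measure lebesgue_measure).

Definition leb3 {R : realType} := @leb2 R \x @lebesgue_measure R.

HB.instance Definition _ (R : realType) := Measure.on (@leb3 R).
HB.instance Definition _ (R : realType) :=
  Measure_isSigmaFinite.Build _ _ _ (@leb3 R)
    (product_measure1_sigma_finite leb2 lebesgue_measure).

End lebesgue_R3.

Section space.
Context {R : realType}.
Implicit Types (f : R3 R -> R) (v w z : R3 R) (i j : 'I_3) (s : R).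

Definition coord3 v i : R := tnth [tuple v.1.1; v.1.2; v.2] i.

Definition basis3 i : R3 R :=
  ((i == 0%N :> nat)%:R, (i == 1%N :> nat)%:R, (i == 2%N :> nat)%:R).

Definition enorm v : R := Num.sqrt (\sum_(i < 3) coord3 v i ^+ 2).

Definition japanese v : R := Num.sqrt (1 + enorm v ^+ 2).

Definition partial3 i f v : R := 'D_(basis3 i) f v.

Definition L1norm s f : \bar R :=
  (\int[leb3]_v (`|f v| * japanese v `^ s)%:E)%E.

Definition L1space s f : Prop :=
  measurable_fun [set: R3 R] f /\ (L1norm s f < +oo)%E.

(* [ln 0 = 0] in the library, so the integrands [f log f] vanish where [f] does. *)
Definition LlogL f : Prop :=
  f \in Lfun leb3 1%:E /\
  (\int[leb3]_v (`|f v| * `|ln `|f v| |)%:E < +oo)%E.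

Definition mass f : \bar R := (\int[leb3]_v (f v)%:E)%E.

Definition momentum i f : \bar R := (\int[leb3]_v (f v * coord3 v i)%:E)%E.

Definition energy f : \bar R := (\int[leb3]_v (f v * (enorm v ^+ 2 / 2))%:E)%E.

Definition entropy f : \bar R := (\int[leb3]_v (f v * ln (f v))%:E)%E.

Definition moment s f : \bar R := (\int[leb3]_v (f v * japanese v `^ s)%:E)%E.

End space.

Section schwartz.
Context {R : realType}.
Implicit Types (f : R3 R -> R) (u t : R) (k : nat) (a : seq 'I_3).

Definition iter_partial a f : R3 R -> R := foldr partial3 f a.

Definition seminorm k a f : \bar R :=
  ereal_sup [set (japanese v ^+ k * `|iter_partial a f v|)%:E | v in [set: R3 R]].

Definition schwartz f : Prop :=
  (forall a v, differentiable (iter_partial a f) v) /\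
  (forall k a, (seminorm k a f < +oo)%E).

(* f restricted to [0, +oo) is C^1 with values in the Frechet space S(R^3);
   limits in t are taken inside [0, +oo), hence one-sided at 0. *)
Definition C1_schwartz (f : R -> R3 R -> R) : Prop :=
  exists f' : R -> R3 R -> R,
  [/\ forall t, 0 <= t -> schwartz (f t),
      forall t, 0 <= t -> schwartz (f' t),
      forall t k a, 0 <= t ->
        seminorm k a (fun v => (f u v - f t v) / (u - t) - f' t v)
          @[u --> within [set u | 0 <= u /\ u != t] (nbhs t)] --> 0%E
    & forall t k a, 0 <= t ->
        seminorm k a (fun v => f' u v - f' t v)
          @[u --> within [set u | 0 <= u] (nbhs t)] --> 0%E].

End schwartz.

Section landau.
Context {R : realType}.
Variable gamma : R.
Implicit Types (f : R3 R -> R) (v w z : R3 R) (i j : 'I_3).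

(* At z = 0 the library conventions 0 / 0 = 0 and 0 `^ s = 0 (s != 0) give the
   value 0, which is the continuous extension as soon as gamma > -2. *)
Definition landau_kernel i j z : R :=
  enorm z `^ (gamma + 2) *
  ((i == j)%:R - coord3 z i * coord3 z j / enorm z ^+ 2).

Definition landau_flux f i j v : R :=
  \int[leb3]_w (landau_kernel i j (v - w) *
    (f w * partial3 j f v - f v * partial3 j f w)).

Definition landau_operator f v : R :=
  \sum_(i < 3) \sum_(j < 3) partial3 i (landau_flux f i j) v.

(* The conservation laws and the entropy decay are required of a solution rather
   than derived from the equation. *)
Record landau_solution (f0 : R3 R -> R) (f : R -> R3 R -> R) : Prop := {
  solution_regular : C1_schwartz f;
  solution_ge0 : forall (t : R) (v : R3 R), 0 <= t -> 0 <= f t v;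
  solution_initial : forall v, f 0 v = f0 v;
  solution_equation : forall (t : R) (v : R3 R), 0 < t ->
    'D_1 (fun u => f u v) t = landau_operator (f t) v;
  solution_mass : forall t : R, 0 <= t -> mass (f t) = mass f0;
  solution_momentum : forall (t : R) (i : 'I_3), 0 <= t ->
    momentum i (f t) = momentum i f0;
  solution_energy : forall t : R, 0 <= t -> energy (f t) = energy f0;
  solution_entropy : forall t : R, 0 < t -> (entropy (f t) <= entropy f0)%E
}.

End landau.

(* Main.v *)
(* Testing the equation with [f] and integrating by parts, the diffusion part is
   at least a multiple of the dissipation [D = int <v>^gamma |grad f|^2], because
   mass, energy and entropy prevent [f] from concentrating near a line.  What is
   left is at most a multiple of
   [int int (e + |v - w|^2)^(gamma / 2) f(w) f(v)^2]; regularising the kernel in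
   its singular factor only keeps its divergence elementary.  Hardy's inequality
   for the region [|v - w|] small, with a threshold depending on [w], bounds this
   by a small multiple of [D + y], where [y = int f^2], plus [y] times a moment
   of [f].  A Nash inequality with weights, obtained from Gagliardo's argument
   and the Loomis-Whitney inequality, absorbs [y] into [D] at the cost of another
   moment.  Interpolating these moments between the mass and [M_mu], the powers
   of [1 + t] add up to [3 / 4], so [y' <= C (1 + t)], and integrating in time
   gives the quadratic growth. *)
Require Import Defs.
From HB Require Import structures.
From mathcomp Require Import all_boot all_order all_algebra.
From mathcomp Require Import all_classical all_reals all_analysis.
From mathcomp Require Import measurable_realfun ring lra.
Import Order.TTheory GRing.Theory Num.Theory.
Import numFieldNormedType.Exports.
Set Implicit Arguments.
Unset Strict Implicit.
Unset Printing Implicit Defensive.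
Local Open Scope classical_set_scope.
Local Open Scope ring_scope.

(** * Euclidean structure and measurability *)

(** The obstacle is that the dissipation [D] carries the decaying weight [<v>^gamma], while every
    moment above the energy may grow in time, so no growing moment may multiply [D]. This dictates
    the threshold in the Hardy step: [D] receives the time-independent coefficient [delta] times the
    mass, and all growth goes into [y] times the moment of order [sg = p^2 / (p + 1)] in
    [1 + |v|^2], where [p = gamma / 2]. With [N = 1 + t], and [N^a], [N^b] the interpolated growth
    of the moments of order [sg] and [tau = - 3 p / 4], that term is of size [N^a y]. In additive
    form the Nash inequality reads [y <= eta D + eta^(-3/2) M_tau^2] up to constants; absorbing
    [N^a y] forces [eta] proportional to [N^(-a)] and leaves [N^(5a/2 + 2b)]. The prescribed [mu]
    makes this exponent [3/4] for every [gamma]. Rapid decay of [f] serves only for integrability,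
    vanishing boundary terms and the limit [e -> 0], so it leaves no trace in the constant. *)

Section euclidean.
Context {R : realType}.
Implicit Types (v w z : R3 R) (i j k : 'I_3).

Definition o0 : 'I_3 := Ordinal (isT : (0 < 3)%N).
Definition o1 : 'I_3 := Ordinal (isT : (1 < 3)%N).
Definition o2 : 'I_3 := Ordinal (isT : (2 < 3)%N).

Lemma ord3_ind (P : 'I_3 -> Prop) : P o0 -> P o1 -> P o2 -> forall i, P i.
Proof.
move=> P0 P1 P2 [[|[|[|//]]] h].
- by rewrite (_ : Ordinal h = o0)//; exact: val_inj.
- by rewrite (_ : Ordinal h = o1)//; exact: val_inj.
- by rewrite (_ : Ordinal h = o2)//; exact: val_inj.
Qed.

Lemma sum3E (V : nmodType) (F : 'I_3 -> V) :
  \sum_(i < 3) F i = F o0 + F o1 + F o2.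
Proof.
rewrite !big_ord_recr big_ord0/= add0r.
by congr (F _ + F _ + F _); exact: val_inj.
Qed.

Definition nsq v : R := v.1.1 ^+ 2 + v.1.2 ^+ 2 + v.2 ^+ 2.
(** The square of the Japanese bracket. All weights are powers of [bra], at half the exponent, which
    avoids square roots. *)
Definition bra v : R := 1 + nsq v.

Lemma nsqE v : \sum_(i < 3) coord3 v i ^+ 2 = nsq v.
Proof. by rewrite sum3E. Qed.

Lemma nsq_ge0 v : 0 <= nsq v.
Proof. by rewrite /nsq !addr_ge0// sqr_ge0. Qed.

Lemma bra_ge1 v : 1 <= bra v. Proof. by rewrite lerDl nsq_ge0. Qed.

Lemma bra_gt0 v : 0 < bra v. Proof. exact: lt_le_trans (bra_ge1 v). Qed.

Lemma bra_ge0 v : 0 <= bra v. Proof. exact: ltW (bra_gt0 v). Qed.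

Lemma nsq_bra v : nsq v <= bra v. Proof. by rewrite lerDr. Qed.

Lemma enorm_sq v : enorm v ^+ 2 = nsq v.
Proof. by rewrite /enorm nsqE sqr_sqrtr// nsq_ge0. Qed.

Lemma japaneseE v : japanese v = Num.sqrt (bra v).
Proof. by rewrite /japanese enorm_sq. Qed.

Lemma japanese_powR v (s : R) : japanese v `^ s = bra v `^ (s / 2).
Proof. by rewrite japaneseE -powR12_sqrt ?bra_ge0// -powRrM mulrC. Qed.

Lemma japanese_sqr v : japanese v ^+ 2 = bra v.
Proof. by rewrite japaneseE sqr_sqrtr ?bra_ge0. Qed.

Lemma enorm_powR v (s : R) : enorm v `^ s = nsq v `^ (s / 2).
Proof. by rewrite /enorm nsqE -powR12_sqrt ?nsq_ge0// -powRrM mulrC. Qed.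

Lemma coord_sqr_le v i : coord3 v i ^+ 2 <= nsq v.
Proof.
move: i; apply: ord3_ind; rewrite /coord3 /nsq/=.
- by rewrite -addrA lerDl addr_ge0 ?sqr_ge0.
- by rewrite [X in _ <= X + _]addrC -addrA lerDl addr_ge0 ?sqr_ge0.
- by rewrite lerDr addr_ge0 ?sqr_ge0.
Qed.

Lemma coord3B v w i : coord3 (v - w) i = coord3 v i - coord3 w i.
Proof. by move: i; apply: ord3_ind. Qed.

Lemma coord3D v w i : coord3 (v + w) i = coord3 v i + coord3 w i.
Proof. by move: i; apply: ord3_ind. Qed.

Lemma coord3Z a v i : coord3 (a *: v) i = a * coord3 v i.
Proof. by move: i; apply: ord3_ind. Qed.

Lemma coord3_basis i j : coord3 (basis3 i : R3 R) j = (i == j)%:R.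
Proof. by move: i j; apply: ord3_ind; apply: ord3_ind. Qed.

Lemma nsqB v w : nsq (v - w) = nsq (w - v).
Proof. by rewrite /nsq/=; ring. Qed.

Lemma nsqD_le v w : nsq (v + w) <= 2 * (nsq v + nsq w).
Proof.
rewrite -subr_ge0 (_ : _ - _ = nsq (v - w)) ?nsq_ge0//.
by rewrite /nsq/=; ring.
Qed.

Lemma nsqN v : nsq (- v) = nsq v.
Proof. by rewrite /nsq/= !sqrrN. Qed.

Lemma braN v : bra (- v) = bra v. Proof. by rewrite /bra nsqN. Qed.

(** Peetre's inequality: it makes polynomial weights submultiplicative, hence stable under
    translation and convolution. *)
Lemma braD_le v w : bra (v + w) <= 2 * (bra v * bra w).
Proof.
rewrite /bra.
have := nsqD_le v w; have := nsq_ge0 v; have := nsq_ge0 w.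
move: (nsq v) (nsq w) (nsq (v + w)) => a b c a0 b0 h.
have : 0 <= a * b by rewrite mulr_ge0.
by lra.
Qed.

Lemma braB_le v w : bra (v - w) <= 2 * (bra v * bra w).
Proof. by rewrite -[in leRHS](braN w) braD_le. Qed.

Lemma basis_bra (h : R) i : `|h| <= 1 -> bra (h *: basis3 i) <= 2.
Proof.
move=> h1; rewrite /bra (_ : nsq _ = h ^+ 2); last first.
  rewrite -nsqE (bigD1 i)//= big1 ?addr0.
    by rewrite coord3Z coord3_basis eqxx mulr1.
  by move=> j ji; rewrite coord3Z coord3_basis eq_sym (negbTE ji) mulr0 expr0n.
rewrite -(normr_id h) in h1.
have : h ^+ 2 <= 1 by rewrite -real_normK ?num_real// -(normr_id h) expr_le1 // normr_id.
lra.
Qed.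

Lemma bra_shift_le v (h : R) i : `|h| <= 1 ->
  bra v <= 4 * bra (v + h *: basis3 i).
Proof.
move=> h1; rewrite -[X in bra X <= _](addrK (h *: basis3 i) v).
apply: le_trans (braB_le _ _) _.
have := basis_bra i h1; have := bra_gt0 (v + h *: basis3 i).
move: (bra _) (bra _) => a b; nra.
Qed.

End euclidean.

Section measurability.
Context {R : realType}.
Implicit Types (v w : R3 R) (i j : 'I_3).

(* The product sigma-algebra of R^3 contains the open sets, each being a
   countable union of boxes with rational centre and side. *)
Lemma open_measurable3 (U : set (R3 R)) : open U -> measurable U.
Proof.
move=> oU.
pose B (c : rat * rat * rat * rat) : set (R3 R) :=
  (ball (ratr c.1.1.1 : R) (ratr c.2 : R) `*` ball (ratr c.1.1.2 : R) (ratr c.2 : R))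
  `*` ball (ratr c.1.2 : R) (ratr c.2 : R).
have -> : U = \bigcup_c (if `[< B c `<=` U >] then B c else set0).
  apply/seteqP; split=> [v Uv|v [c _]]; last by case: asboolP => // h /h.
  have /nbhs_ballP[e /= e0 be] := oU v Uv.
  (* Any rational radius [r] below [e / 2] will do: a box of radius [r] that contains [v] stays
     within [2 r < e] of it. *)
  have e40 : 0 < e / 4 by rewrite divr_gt0.
  have /rat_in_itvoo[r /itvP re] : e / 4 < e / 2 by lra.
  have r0 : 0 < ratr r :> R by rewrite (lt_trans e40)// re.
  have ratnear (x : R) : exists c : rat, `|ratr c - x| < ratr r.
    have /rat_in_itvoo[c /itvP xc] : x - ratr r < x + ratr r by lra.
    by exists c; rewrite ltr_distl !xc.
  have [c1 h1] := ratnear v.1.1; have [c2 h2] := ratnear v.1.2.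
  have [c3 h3] := ratnear v.2.
  have re2 : ratr r + ratr r < e.
    by rewrite [ltRHS](splitr e) ltrD// re.
  exists (c1, c2, c3, r) => //=.
  case: asboolP; first by move=> _; split => //; split.
  case; move=> w [[/= w1 w2] w3]; apply: be; do 2?split => /=.
  - by rewrite /ball/= (le_lt_trans _ re2)// ltW// (le_lt_trans (ler_distD (ratr c1) _ _))// ltrD// distrC.
  - by rewrite /ball/= (le_lt_trans _ re2)// ltW// (le_lt_trans (ler_distD (ratr c2) _ _))// ltrD// distrC.
  - by rewrite /ball/= (le_lt_trans _ re2)// ltW// (le_lt_trans (ler_distD (ratr c3) _ _))// ltrD// distrC.
apply: countable_bigcupT_measurable => // c; case: asboolP => // _.
by apply: measurableX; [apply: measurableX|]; exact: measurable_ball.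
Qed.

Lemma continuous_measurable3 (f : R3 R -> R) : continuous f ->
  measurable_fun [set: R3 R] f.
Proof.
move=> cf; apply: (measurability _ (RGenOpens.measurableE R)).
move=> _ [_ [a [b ->] <-]]; rewrite setTI; apply: open_measurable3.
by move/continuousP : cf; apply; exact: interval_open.
Qed.

Lemma measurable_coord3 i : measurable_fun [set: R3 R] (coord3 ^~ i).
Proof.
move: i; apply: ord3_ind; rewrite /coord3/=.
- by apply: (measurableT_comp measurable_fst); exact: measurable_fst.
- by apply: (measurableT_comp measurable_snd); exact: measurable_fst.
- exact: measurable_snd.
Qed.

Lemma measurable_nsq : measurable_fun [set: R3 R] nsq.
Proof.
apply: measurable_funD; first apply: measurable_funD;
  apply: measurable_funX.
- exact: (measurable_coord3 o0).
- exact: (measurable_coord3 o1).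
- exact: (measurable_coord3 o2).
Qed.

Lemma measurable_bra : measurable_fun [set: R3 R] bra.
Proof. by apply: measurable_funD => //; exact: measurable_nsq. Qed.

Lemma measurable_sub3 :
  measurable_fun [set: R3 R * R3 R] (fun x => x.1 - x.2).
Proof.
pose f i (x : R3 R * R3 R) := coord3 x.1 i - coord3 x.2 i.
have mf i : measurable_fun [set: R3 R * R3 R] (f i).
  by apply: measurable_funB; apply: (measurableT_comp (measurable_coord3 i)).
rewrite (_ : (fun x => _) = fun x => (f o0 x, f o1 x, f o2 x)); last by [].
by apply: measurable_fun_pair => //; exact: measurable_fun_pair.
Qed.

End measurability.

(** * Functions of rapid decay *)

Section integrability.
Local Open Scope ereal_scope.

Lemma integrable_prodM d1 d2 (T1 : measurableType d1) (T2 : measurableType d2)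
    (R : realType) (m1 : {sigma_finite_measure set T1 -> \bar R})
    (m2 : {sigma_finite_measure set T2 -> \bar R}) (f : T1 -> R) (g : T2 -> R) :
  m1.-integrable [set: T1] (EFin \o f) -> m2.-integrable [set: T2] (EFin \o g) ->
  (m1 \x m2).-integrable [set: T1 * T2] (fun x => (f x.1 * g x.2)%:E).
Proof.
move=> /integrableP[mf fi] /integrableP[mg gi].
have {}mf : measurable_fun setT f by apply/measurable_EFinP.
have {}mg : measurable_fun setT g by apply/measurable_EFinP.
have mfg : measurable_fun [set: T1 * T2] (fun x => (f x.1 * g x.2)%:E).
  apply/measurable_EFinP/measurable_funM.
  - exact: measurableT_comp.
  - exact: measurableT_comp.
apply/(integrable12ltyP _ _ mfg).
under eq_integral => x _.
  under eq_integral => y _ do rewrite /= normrM EFinM.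
  rewrite ge0_integralZl//; first over.
  by apply/measurable_EFinP; exact: measurableT_comp.
rewrite ge0_integralZr//.
- by rewrite lte_mul_pinfty// ?ge0_fin_numE// integral_ge0.
- by apply/measurable_EFinP; exact: measurableT_comp.
- by apply: integral_ge0 => y _; rewrite lee_fin.
Qed.

End integrability.

Section decay.
Context {R : realType}.
Implicit Types (v w : R3 R) (f g h : R3 R -> R).

Definition cauchy (x : R) : R := (1 + x ^+ 2)^-1.

Lemma cauchy_gt0 x : 0 < cauchy x.
Proof. by rewrite invr_gt0 ltr_pwDl// sqr_ge0. Qed.

Lemma cauchy_ge0 x : 0 <= cauchy x. Proof. exact/ltW/cauchy_gt0. Qed.

Lemma integrable_cauchy :
  lebesgue_measure.-integrable [set: R] (EFin \o cauchy).
Proof.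
have ce : cauchy = (fun x => (oneDsqr x)^-1) by [].
apply/integrableP; split.
  rewrite ce; apply: measurableT_comp => //; apply: continuous_measurable_fun.
  exact: continuous_oneDsqrV.
under eq_integral do rewrite /= ger0_norm ?cauchy_ge0//.
rewrite ge0_symfun_integralT.
- have -> : [set x | 0 <= x] = `[0%R, +oo[%classic :> set R.
    by apply/seteqP; split => x/=; rewrite in_itv/= andbT.
  have /= := integral0y_oneDsqr R; rewrite /cauchy /oneDsqr => ->; rewrite -EFinM ltry//.
- exact: cauchy_ge0.
- by rewrite ce; exact: continuous_oneDsqrV.
- by move=> x/=; rewrite /cauchy sqrrN.
Qed.

(** An integrable majorant in product form, so that it also restricts well to coordinate lines and
    planes. It dominates all rapidly decaying functions and is the reference density in the entropy
    bound. *)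
Definition env v : R := cauchy v.1.1 * cauchy v.1.2 * cauchy v.2.

Lemma env_gt0 v : 0 < env v.
Proof. by rewrite !mulr_gt0// cauchy_gt0. Qed.

Lemma env_ge0 v : 0 <= env v. Proof. exact/ltW/env_gt0. Qed.

Lemma integrable_env : leb3.-integrable [set: R3 R] (EFin \o env).
Proof.
have := @integrable_prodM _ _ _ _ R leb2 lebesgue_measure (fun x => cauchy x.1 * cauchy x.2) cauchy.
by apply; [exact: (integrable_prodM integrable_cauchy integrable_cauchy)|
           exact: integrable_cauchy].
Qed.

(** Each factor [1 + x^2] is at most [bra v], so three powers of [bra] buy integrability; this is
    the [3] in all later dominations. *)
Lemma bra_env v : 1 <= env v * bra v ^+ 3.
Proof.
rewrite /env /cauchy -!invfM mulrC ler_pdivlMr ?mul1r; last first.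
  by rewrite !mulr_gt0// ltr_pwDl// sqr_ge0.
rewrite (_ : bra v ^+ 3 = bra v * bra v * bra v); last by rewrite !exprS expr0 mulr1 mulrA.
have h (x y : R) (y0 : 0 <= y) : 1 + x ^+ 2 <= 1 + (x ^+ 2 + y) by rewrite lerD2l lerDl.
have p (x : R) : 0 <= 1 + x ^+ 2 by rewrite addr_ge0// sqr_ge0.
rewrite ler_pM ?mulr_ge0 ?p// ?ler_pM ?p// /bra /nsq lerD2l.
- by rewrite -addrA lerDl addr_ge0 ?sqr_ge0.
- by rewrite addrAC lerDr addr_ge0 ?sqr_ge0.
- by rewrite lerDr addr_ge0 ?sqr_ge0.
Qed.

(* Polynomial growth, and decay faster than every polynomial. *)
Definition slow g := measurable_fun [set: R3 R] g /\
  exists n (C : R), forall v, `|g v| <= C * bra v ^+ n.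

Definition rapid g := measurable_fun [set: R3 R] g /\
  forall n, exists C : R, forall v, `|g v| * bra v ^+ n <= C.

Lemma slow_bounded g (C : R) : measurable_fun [set: R3 R] g ->
  (forall v, `|g v| <= C) -> slow g.
Proof. by move=> mg gC; split => //; exists 0%N, C => v; rewrite expr0 mulr1. Qed.

Lemma slow_cst (c : R) : slow (fun=> c).
Proof. exact: (slow_bounded (C := `|c|)). Qed.

Lemma bra_expr_ge1 v n : 1 <= bra v ^+ n.
Proof. by rewrite exprn_ege1// bra_ge1. Qed.

Lemma bra_expr_gt0 v n : 0 < bra v ^+ n.
Proof. exact: lt_le_trans (bra_expr_ge1 v n). Qed.

Lemma slow_pos g : slow g ->
  exists n (C : R), 0 <= C /\ forall v, `|g v| <= C * bra v ^+ n.
Proof.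
move=> [mg [n [C gC]]]; exists n, `|C|; split => // v.
apply: le_trans (gC v) _; rewrite ler_wpM2r ?ler_norm//.
exact/ltW/bra_expr_gt0.
Qed.

Lemma slowD f g : slow f -> slow g -> slow (fun v => f v + g v).
Proof.
move=> sf sg; have [m [C [C0 fC]]] := slow_pos sf.
have [n [D [D0 gD]]] := slow_pos sg.
split; first by apply: measurable_funD; [exact: sf.1|exact: sg.1].
exists (m + n)%N, (C + D) => v; rewrite mulrDl (le_trans (ler_normD _ _))//.
rewrite lerD ?(le_trans (fC v)) ?(le_trans (gD v))// ler_wpM2l// ler_weXn2l ?bra_ge1//.
- exact: leq_addr.
- exact: leq_addl.
Qed.

Lemma slowM f g : slow f -> slow g -> slow (fun v => f v * g v).
Proof.
move=> sf sg; have [m [C [C0 fC]]] := slow_pos sf.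
have [n [D [D0 gD]]] := slow_pos sg.
split; first by apply: measurable_funM; [exact: sf.1|exact: sg.1].
by exists (m + n)%N, (C * D) => v; rewrite normrM exprD mulrACA ler_pM.
Qed.

Lemma slowN f : slow f -> slow (fun v => - f v).
Proof.
move=> [mf [n [C fC]]]; split; first exact: measurable_funN.
by exists n, C => v; rewrite normrN.
Qed.

Lemma slowB f g : slow f -> slow g -> slow (fun v => f v - g v).
Proof. by move=> sf sg; apply: slowD => //; exact: slowN. Qed.

Lemma slow_coord i : slow (coord3 ^~ i).
Proof.
split; first exact: measurable_coord3.
exists 1%N, 1 => v; rewrite mul1r expr1.
have := coord_sqr_le v i; rewrite -real_normK ?num_real// /bra.
have := normr_ge0 (coord3 v i); nra.
Qed.

Lemma slow_nsq : slow nsq.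
Proof.
split; first exact: measurable_nsq.
by exists 1%N, 1 => v; rewrite mul1r expr1 ger0_norm ?nsq_ge0// nsq_bra.
Qed.

Lemma slow_bra_powR (s : R) : slow (fun v => bra v `^ s).
Proof.
split; first by apply: (measurableT_comp (measurable_powR s)); exact: measurable_bra.
have [n ns] : exists n : nat, s <= n%:R.
  exists (Num.bound `|s|); apply: le_trans (ler_norm s) _.
  exact/ltW/archi_boundP.
exists n, 1 => v; rewrite mul1r ger0_norm ?powR_ge0// -powR_mulrn ?bra_ge0//.
by rewrite ler_powR// bra_ge1.
Qed.

Lemma rapid_slow g : rapid g -> slow g.
Proof.
move=> [mg /(_ 0%N)[C gC]]; apply: (slow_bounded (C := C)) => // v.
by have := gC v; rewrite expr0 mulr1.
Qed.

Lemma rapid_bound g n : rapid g ->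
  exists2 C : R, 0 <= C & forall v, `|g v| * bra v ^+ n <= C.
Proof.
move=> [mg /(_ n)[C gC]]; exists C => //; apply: le_trans (gC 0).
by rewrite mulr_ge0// ltW// bra_expr_gt0.
Qed.

Lemma rapid_le f g : measurable_fun [set: R3 R] f -> rapid g ->
  (forall v, `|f v| <= `|g v|) -> rapid f.
Proof.
move=> mf [mg gC] fg; split => // n; have [C {}gC] := gC n; exists C => v.
by apply: le_trans (gC v); rewrite ler_wpM2r// ltW// bra_expr_gt0.
Qed.

Lemma rapidD f g : rapid f -> rapid g -> rapid (fun v => f v + g v).
Proof.
move=> [mf fC] [mg gD]; split; first exact: measurable_funD.
move=> n; have [C {}fC] := fC n; have [D {}gD] := gD n.
exists (C + D) => v; rewrite (le_trans _ (lerD (fC v) (gD v)))// -mulrDl.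
by rewrite ler_wpM2r ?ler_normD// ltW// bra_expr_gt0.
Qed.

Lemma rapidMl f g : slow f -> rapid g -> rapid (fun v => f v * g v).
Proof.
move=> sf [mg gD]; have [m [C [C0 fC]]] := slow_pos sf.
split; first by apply: measurable_funM => //; exact: sf.1.
move=> n; have [D {}gD] := gD (m + n)%N; exists (C * D) => v.
apply: le_trans (ler_wpM2l C0 (gD v)); rewrite exprD normrM.
rewrite [leRHS](_ : _ = C * bra v ^+ m * `|g v| * bra v ^+ n); last by ring.
by rewrite !ler_wpM2r// ltW// bra_expr_gt0.
Qed.

Lemma rapidMr f g : rapid f -> slow g -> rapid (fun v => f v * g v).
Proof.
move=> rf sg; rewrite (_ : (fun _ => _) = fun v => g v * f v); first exact: rapidMl.
by apply/funext => v; rewrite mulrC.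
Qed.

Lemma rapidN f : rapid f -> rapid (fun v => - f v).
Proof.
move=> [mf fC]; split; first exact: measurable_funN.
by move=> n; have [C {}fC] := fC n; exists C => v; rewrite normrN.
Qed.

Lemma rapidB f g : rapid f -> rapid g -> rapid (fun v => f v - g v).
Proof. by move=> rf rg; apply: rapidD => //; exact: rapidN. Qed.

Lemma rapidZ (c : R) f : rapid f -> rapid (fun v => c * f v).
Proof. by apply: rapidMl; exact: slow_cst. Qed.

Lemma rapid0 : rapid (fun=> 0).
Proof.
split; first exact: measurable_cst.
by move=> n; exists 0 => v; rewrite normr0 mul0r.
Qed.

Lemma rapid_norm f : rapid f -> rapid (fun v => `|f v|).
Proof.
move=> rf; apply: (rapid_le _ rf); first by apply: measurableT_comp => //; exact: rf.1.
by move=> v; rewrite normr_id.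
Qed.

Lemma rapid_sqr f : rapid f -> rapid (fun v => f v ^+ 2).
Proof.
move=> rf; rewrite (_ : (fun _ => _) = fun v => f v * f v).
  by apply: rapidMl => //; exact: rapid_slow.
by apply/funext => v; rewrite expr2.
Qed.

Lemma rapid_sum n (F : 'I_n -> R3 R -> R) : (forall i, rapid (F i)) ->
  rapid (fun v => \sum_(i < n) F i v).
Proof.
elim: n F => [|n IH] F rF.
  by rewrite (_ : (fun _ => _) = fun=> 0); [exact: rapid0|apply/funext => v; rewrite big_ord0].
rewrite (_ : (fun _ => _) = fun v => F ord0 v + \sum_(i < n) F (lift ord0 i) v).
  by apply: rapidD => //; exact: IH.
by apply/funext => v; rewrite big_ord_recl.
Qed.

Lemma integrable_envZ (C : R) : leb3.-integrable [set: R3 R] (fun v => (C * env v)%:E).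
Proof.
have := integrableZl measurableT C integrable_env.
by apply: eq_integrable => // v _; rewrite EFinM.
Qed.

Lemma integrable_le_env g (C : R) : measurable_fun [set: R3 R] g ->
  (forall v, `|g v| <= C * env v) -> leb3.-integrable [set: R3 R] (EFin \o g).
Proof.
move=> mg gC; apply: (le_integrable measurableT _ _ (integrable_envZ C)).
  exact/measurable_EFinP.
move=> v _ /=; rewrite lee_fin (le_trans (gC v))// ler_norm//.
Qed.

Lemma rapid_env g : rapid g -> exists2 C : R, 0 <= C & forall v, `|g v| <= C * env v.
Proof.
move=> /(rapid_bound 3)[C C0 gC]; exists C => // v.
apply: le_trans (ler_wpM2r (env_ge0 v) (gC v)).
rewrite -mulrA -[leLHS]mulr1 ler_wpM2l// mulrC; exact: bra_env.
Qed.

Lemma integrable_rapid g : rapid g -> leb3.-integrable [set: R3 R] (EFin \o g).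
Proof.
by move=> rg; have [C C0 gC] := rapid_env rg; exact: (integrable_le_env rg.1 gC).
Qed.

Lemma intD f g : rapid f -> rapid g ->
  \int[leb3]_v (f v + g v) = \int[leb3]_v f v + \int[leb3]_v g v.
Proof. by move=> rf rg; rewrite RintegralD//; exact: integrable_rapid. Qed.

Lemma intB f g : rapid f -> rapid g ->
  \int[leb3]_v (f v - g v) = \int[leb3]_v f v - \int[leb3]_v g v.
Proof. by move=> rf rg; rewrite RintegralB//; exact: integrable_rapid. Qed.

Lemma intZ (c : R) f : rapid f ->
  \int[leb3]_v (c * f v) = c * \int[leb3]_v f v.
Proof. by move=> rf; rewrite RintegralZl//; exact: integrable_rapid. Qed.

Lemma intN f : rapid f -> \int[leb3]_v (- f v) = - \int[leb3]_v f v.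
Proof.
by move=> rf; rewrite -mulN1r -intZ//; apply: eq_Rintegral => v _; rewrite mulN1r.
Qed.

Lemma le_int f g : rapid f -> rapid g -> (forall v, f v <= g v) ->
  \int[leb3]_v f v <= \int[leb3]_v g v.
Proof. by move=> rf rg fg; apply: le_Rintegral => //; exact: integrable_rapid. Qed.

Lemma int_ge0 f : (forall v, 0 <= f v) -> 0 <= \int[leb3]_v f v.
Proof. by move=> f0; exact: Rintegral_ge0. Qed.

Lemma eint_rapid f : rapid f ->
  (\int[leb3]_v (f v)%:E)%E = (\int[leb3]_v f v)%:E.
Proof.
move=> rf; rewrite /Rintegral fineK//; apply: integrable_fin_num => //.
exact: integrable_rapid.
Qed.

Lemma int_sum n (F : 'I_n -> R3 R -> R) : (forall i, rapid (F i)) ->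
  \int[leb3]_v (\sum_(i < n) F i v) = \sum_(i < n) \int[leb3]_v F i v.
Proof.
elim: n F => [|n IH] F rF.
  rewrite big_ord0; under eq_Rintegral do rewrite big_ord0.
  by rewrite /Rintegral integral0.
rewrite big_ord_recl -IH// -intD//; last exact: rapid_sum.
by apply: eq_Rintegral => v _; rewrite big_ord_recl.
Qed.

End decay.

(** * Translation invariance and convolutions *)

Section translation.
Context {R : realType}.
Implicit Types (v w a : R3 R).
Local Open Scope ereal_scope.

Local Notation mR := (measurableTypeR R).

Lemma measurable_fun_addr (a : R) : measurable_fun [set: R] (fun x => (x + a)%R).
Proof. exact: measurable_funD. Qed.

(** The image measure under a translation has the right values on half-open intervals, which
    determine it. The product measures below are treated in the same way through rectangles. *)
Lemma lebesgue_measure_shift (a : R) (A : set (measurableTypeR R)) : measurable A ->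
  lebesgue_measure ((fun x => (x + a)%R : measurableTypeR R) @^-1` A) = lebesgue_measure A.
Proof.
move=> mA.
have := @lebesgue_measure_unique R (pushforward lebesgue_measure (fun x : measurableTypeR R => (x + a)%R : measurableTypeR R)).
rewrite /pushforward => h; apply/esym; apply: h => //.
  exact: measurable_fun_addr.
move=> mf _ [[x y] _ <-].
have e : (fun z : R => z + a)%R @^-1` `]x, y]%classic = `](x - a)%R, (y - a)%R]%classic.
  by apply/seteqP; split=> z /=; rewrite !in_itv/= ltrBlDr lerBrDr.
transitivity (lebesgue_measure (`](x - a)%R, (y - a)%R]%classic : set (measurableTypeR R))).
  rewrite !lebesgue_measure_itv/= !lte_fin ltrD2r.
  by case: ifPn => // _; rewrite -!EFinB opprB addrA addrNK.
by rewrite -e.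
Qed.

Lemma leb2_shift (a : R * R) (A : set (R * R)) : measurable A ->
  leb2 ((fun x => (x + a)%R) @^-1` A) = leb2 A.
Proof.
move=> mA.
have mf : measurable_fun [set: R * R] (fun x : R * R => (x + a)%R).
  apply: measurable_fun_pair.
    exact: (measurableT_comp (measurable_fun_addr a.1) measurable_fst).
  exact: (measurableT_comp (measurable_fun_addr a.2) measurable_snd).
have := @product_measure_unique _ _ _ _ R lebesgue_measure lebesgue_measure
  (pushforward leb2 (fun x : mR * mR => (x + a)%R : mR * mR)).
rewrite /pushforward => h; apply/esym; apply: h => // X Y mX mY.
rewrite -[RHS](_ : leb2 (((fun x => (x + a.1)%R : measurableTypeR R) @^-1` X) `*` ((fun x => (x + a.2)%R : measurableTypeR R) @^-1` Y)) = _)//.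
rewrite /leb2 product_measure1E//=.
- congr (_ * _); exact: lebesgue_measure_shift.
- by rewrite -[X in measurable X]setTI; exact: measurable_fun_addr.
- by rewrite -[X in measurable X]setTI; exact: measurable_fun_addr.
Qed.

Lemma measurable_shift3 a : measurable_fun [set: R3 R] (fun x => (x + a)%R).
Proof.
apply: measurable_fun_pair; first apply: measurable_fun_pair.
- by apply: (measurableT_comp (measurable_fun_addr a.1.1)); exact: measurable_coord3 o0.
- by apply: (measurableT_comp (measurable_fun_addr a.1.2)); exact: measurable_coord3 o1.
- by apply: (measurableT_comp (measurable_fun_addr a.2)); exact: measurable_coord3 o2.
Qed.

Lemma leb3_shift a (A : set (R3 R)) : measurable A ->
  leb3 ((fun x => (x + a)%R) @^-1` A) = leb3 A.
Proof.
move=> mA; have mf := measurable_shift3 a.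
have := @product_measure_unique _ _ _ _ R leb2 lebesgue_measure
  (pushforward leb3 (fun x : mR * mR * mR => (x + a)%R : mR * mR * mR)).
rewrite /pushforward => h; apply/esym; apply: h => // X Y mX mY.
rewrite -[RHS](_ : leb3 (((fun x => (x + a.1)%R) @^-1` X) `*` ((fun x => (x + a.2)%R : measurableTypeR R) @^-1` Y)) = _)//.
have m2 : measurable_fun [set: R * R] (fun x : R * R => (x + a.1)%R).
  apply: measurable_fun_pair.
    exact: (measurableT_comp (measurable_fun_addr a.1.1) measurable_fst).
  exact: (measurableT_comp (measurable_fun_addr a.1.2) measurable_snd).
rewrite /leb3 product_measure1E//=.
- congr (_ * _); [exact: leb2_shift|exact: lebesgue_measure_shift].
- by rewrite -[X in measurable X]setTI; exact: m2.
- by rewrite -[X in measurable X]setTI; exact: measurable_fun_addr.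
Qed.

End translation.

Section translation_rapid.
Context {R : realType}.
Implicit Types (v w a : R3 R).
Local Notation mR := (measurableTypeR R).

Local Notation T3 := (mR * mR * mR)%type.

Lemma rapid_shift a (f : R3 R -> R) : rapid f -> rapid (fun v => f (v + a)).
Proof.
move=> [mf fC]; split; first exact: (measurableT_comp mf (measurable_shift3 a)).
move=> n; have [C Cf] := rapid_bound n (conj mf fC); move=> {}fC.
exists (C * (2 * bra a) ^+ n) => v.
have h : bra v <= bra (v + a) * (2 * bra a).
  by rewrite -[X in bra X <= _](addrK a v) (le_trans (braB_le _ _))// mulrCA.
have h2 : bra v ^+ n <= bra (v + a) ^+ n * (2 * bra a) ^+ n.
  rewrite -exprMn lerXn2r ?nnegrE ?mulr_ge0 ?bra_ge0//.
apply: (le_trans (ler_wpM2l _ h2)) => //; rewrite mulrA ler_wpM2r//.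
by rewrite exprn_ge0// mulr_ge0// bra_ge0.
Qed.

Lemma int_shift a (f : R3 R -> R) : rapid f ->
  \int[leb3]_v f (v + a) = \int[leb3]_v f v.
Proof.
move=> rf; congr fine.
pose phi (v : T3) : T3 := v + a.
have mf : measurable_fun [set: T3] phi := measurable_shift3 a.
have mf' : measurable_fun [set: T3] (EFin \o f).
  by apply/measurable_EFinP; exact: rf.1.
have fi : (leb3 : set T3 -> \bar R).-integrable [set: T3] ((EFin \o f) \o phi).
  exact: (integrable_rapid (rapid_shift a rf)).
have := @integral_pushforward _ _ T3 T3 R phi mf leb3 setT (EFin \o f) mf'.
rewrite preimage_setT => /(_ fi measurableT) <-.
apply: eq_measure_integral => A mA _.
exact: leb3_shift.
Qed.

End translation_rapid.

Section convolution.
Context {R : realType}.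
Implicit Types (v w : R3 R) (K : R3 R -> R3 R -> R) (f g : R3 R -> R).

Definition slow2 K :=
  measurable_fun [set: R3 R * R3 R] (fun x => K x.1 x.2) /\
  exists n (C : R), 0 <= C /\ forall v w, `|K v w| <= C * (bra v ^+ n * bra w ^+ n).

Lemma slow2_sub (k : R3 R -> R) : slow k -> slow2 (fun v w => k (v - w)).
Proof.
move=> sk; split; first exact: (measurableT_comp sk.1 measurable_sub3).
have [n [C [C0 kC]]] := slow_pos sk; exists n, (C * 2 ^+ n); split.
  by rewrite mulr_ge0.
move=> v w; apply: le_trans (kC _) _; rewrite -mulrA ler_wpM2l//.
rewrite -!exprMn lerXn2r ?nnegrE ?mulr_ge0 ?bra_ge0//.
exact: braB_le.
Qed.

Lemma slow2_swap K : slow2 K -> slow2 (fun w v => K v w).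
Proof.
move=> [mK [n [C [C0 KC]]]]; split; first exact: (measurableT_comp mK (@measurable_swap _ _ (R3 R) (R3 R))).
by exists n, C; split => // v w; rewrite (mulrC (bra v ^+ n)).
Qed.

Lemma slow2_slow K v : slow2 K -> slow (K v).
Proof.
move=> [mK [n [C [C0 KC]]]]; split; first exact: (measurable_fun_pair2 v mK).
by exists n, (C * bra v ^+ n) => w; rewrite -mulrA.
Qed.

Lemma integrable_double (H : R3 R * R3 R -> R) (C : R) :
  measurable_fun [set: R3 R * R3 R] H ->
  (forall v w, `|H (v, w)| <= C * (env v * env w)) ->
  (leb3 \x leb3)%E.-integrable [set: R3 R * R3 R] (EFin \o H).
Proof.
move=> mH HC.
have := integrable_prodM (@integrable_env R) (@integrable_env R).
move=> /(integrableZl measurableT C) h.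
apply: (le_integrable measurableT _ _ h) => [|[v w] _].
  exact/measurable_EFinP.
by rewrite /= lee_fin (le_trans (HC v w))// ler_norm.
Qed.

Lemma slow2_rapid_int K v g : slow2 K -> rapid g -> rapid (fun w => K v w * g w).
Proof. by move=> sK rg; apply: rapidMl => //; exact: slow2_slow. Qed.

Lemma slow_int K g : slow2 K -> rapid g -> slow (fun v => \int[leb3]_w (K v w * g w)).
Proof.
move=> sK rg; have [mK [n [C [C0 KC]]]] := sK.
have [D D0 gD] := rapid_env (rapidMl (slow_bra_powR n%:R) rg).
have {}gD w : bra w ^+ n * `|g w| <= D * env w.
  have := gD w; rewrite powR_mulrn ?bra_ge0// normrM ger0_norm//.
  exact/ltW/bra_expr_gt0.
(* The parameter integral may grow in [v]. Measurability therefore comes from Fubini applied to the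
   integrand times the positive weight [c], which is divided out at the end. *)
pose c v : R := env v * (bra v ^+ n)^-1.
have c0 v : 0 < c v by rewrite mulr_gt0 ?env_gt0// invr_gt0 bra_expr_gt0.
have mc : measurable_fun [set: R3 R] c.
  apply: measurable_funM.
    by have /integrableP[/measurable_EFinP] := @integrable_env R.
  rewrite (_ : (fun _ => _) = fun v => (bra v) `^ (- n%:R)).
    exact: (measurableT_comp (measurable_powR _) measurable_bra).
  by apply/funext => v; rewrite powR_invn ?bra_ge0.
split; last first.
  exists n, (C * \int[leb3]_w (bra w ^+ n * `|g w|)) => v.
  have rg' : rapid (fun w => bra w ^+ n * `|g w|).
    apply: rapidMl (rapid_norm rg); split; last first.
      by exists n, 1 => w; rewrite mul1r ger0_norm// ltW// bra_expr_gt0.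
    by apply: measurable_funX; exact: measurable_bra.
  apply: (le_trans (le_normr_Rintegral _ _)) => //.
    exact/integrable_rapid/slow2_rapid_int.
  rewrite mulrAC -intZ//; apply: le_int.
  - exact/rapid_norm/slow2_rapid_int.
  - exact: rapidZ.
  - move=> w; rewrite normrM mulrA ler_wpM2r//.
    by rewrite -mulrA; exact: KC.
pose H (x : R3 R * R3 R) := c x.1 * (K x.1 x.2 * g x.2).
have Hi : (leb3 \x leb3)%E.-integrable [set: R3 R * R3 R] (EFin \o H).
  apply: (integrable_double (C := C * D)).
    apply: measurable_funM; first exact: measurableT_comp.
    by apply: measurable_funM => //; apply: measurableT_comp => //; exact: rg.1.
  move=> v w; rewrite /H [(v, w).1]/= [(v, w).2]/= normrM (gtr0_norm (c0 v)) normrM.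
  have h := ler_wpM2r (normr_ge0 (g w)) (KC v w).
  apply: (le_trans (ler_wpM2l (ltW (c0 v)) h)).
  rewrite [leLHS](_ : _ = C * (env v * (bra w ^+ n * `|g w|))); last first.
    by rewrite /c; field; rewrite gt_eqF// bra_expr_gt0.
  rewrite -[leRHS]mulrA ler_wpM2l// [leRHS]mulrCA ler_wpM2l ?env_ge0//.
have mF := measurable_fubini_F Hi.
rewrite (_ : (fun _ => _) = fun v => c v `^ (-1) * fine (fubini_F leb3 (EFin \o H) v)).
  apply: measurable_funM.
    exact: (measurableT_comp (measurable_powR _) mc).
  exact: (measurableT_comp _ mF).
apply/funext => v; rewrite /fubini_F/= -/(Rintegral _ _ _).
rewrite -[X in _ * X]/(\int[leb3]_w (c v * (K v w * g w))) intZ; last exact: slow2_rapid_int.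
by rewrite powR_inv1 ?ltW// mulKf// gt_eqF.
Qed.

Lemma int_swap K f g : slow2 K -> rapid f -> rapid g ->
  \int[leb3]_v (f v * \int[leb3]_w (K v w * g w)) =
  \int[leb3]_w (g w * \int[leb3]_v (K v w * f v)).
Proof.
move=> sK rf rg; have [mK [n [C [C0 KC]]]] := sK.
have h (u : R3 R -> R) : rapid u -> exists2 D : R, 0 <= D & forall w, bra w ^+ n * `|u w| <= D * env w.
  move=> ru; have [D D0 gD] := rapid_env (rapidMl (slow_bra_powR n%:R) ru).
  exists D => // w.
  have := gD w; rewrite powR_mulrn ?bra_ge0// normrM ger0_norm//.
  exact/ltW/bra_expr_gt0.
have [A A0 fA] := h _ rf; have [B B0 gB] := h _ rg.
pose H (x : R3 R * R3 R) := f x.1 * (K x.1 x.2 * g x.2).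
have Hi : (leb3 \x leb3)%E.-integrable [set: R3 R * R3 R] (EFin \o H).
  apply: (integrable_double (C := C * (A * B))).
    apply: measurable_funM; first by apply: measurableT_comp => //; exact: rf.1.
    by apply: measurable_funM => //; apply: measurableT_comp => //; exact: rg.1.
  move=> v w; rewrite /H/= !normrM.
  have e := ler_wpM2r (normr_ge0 (g w)) (KC v w).
  apply: (le_trans (ler_wpM2l (normr_ge0 (f v)) e)).
  rewrite [leLHS](_ : _ = C * ((bra v ^+ n * `|f v|) * (bra w ^+ n * `|g w|))); last by ring.
  rewrite -[leRHS]mulrA ler_wpM2l// [leRHS]mulrACA.
  by apply: ler_pM => //; rewrite mulr_ge0// ltW// bra_expr_gt0.
have := Fubini Hi; rewrite /H/=.
under eq_integral => v _.
  rewrite (_ : (\int[leb3]_y _)%E = (f v * \int[leb3]_w (K v w * g w))%:E); first over.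
  rewrite -intZ; last exact: slow2_rapid_int.
  by rewrite -eint_rapid//; apply: rapidZ; exact: slow2_rapid_int.
under [in X in _ = X]eq_integral => w _.
  rewrite (_ : (\int[leb3]_y _)%E = (g w * \int[leb3]_v (K v w * f v))%:E); first over.
  have sK' := slow2_swap sK.
  rewrite -intZ; last exact: (slow2_rapid_int w sK').
  rewrite -eint_rapid; last by apply: rapidZ; exact: (slow2_rapid_int w sK').
  by apply: eq_integral => v _; congr EFin; ring.
by move=> /(congr1 fine).
Qed.

End convolution.

(** * Partial derivatives along coordinate directions *)

Section directional.
Context {R : realType}.
Implicit Types (v w : R3 R) (i j : 'I_3) (F G K f g : R3 R -> R).

Lemma is_derive_cvgP (V W : normedModType R) (f : V -> W) (v e : V) (d : W) :
  is_derive v e f d <-> h^-1 *: (f (h *: e + v) - f v) @[h --> 0^'] --> d.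
Proof.
split=> [[cf <-]|cf]; first by exact: cf.
split; first by apply/cvg_ex; exists d.
exact: cvg_lim cf.
Qed.

(** Directional differentiability along one axis, with the derivative carried as an explicit
    function so that the rules below compute it. *)
Definition isd i F F' := forall v, is_derive v (basis3 i : R3 R) F (F' v).

Lemma isd_line i F F' : isd i F F' -> forall v (x : R),
  is_derive x 1 (fun h : R => F (v + h *: basis3 i)) (F' (v + x *: basis3 i)).
Proof.
move=> FF' v x; apply/is_derive_cvgP.
have /is_derive_cvgP := FF' (v + x *: basis3 i).
apply: cvg_trans; apply: near_eq_cvg; near=> h.
by rewrite [h *: 1]mulr1 scalerDl [v + (_ + _)]addrCA.
Unshelve. all: by end_near. Qed.

Lemma isd_MVT i F F' v (h : R) : isd i F F' ->
  exists2 s, `|s| <= `|h| & F (v + h *: basis3 i) - F v = h * F' (v + s *: basis3 i).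
Proof.
move=> FF'; have dF := isd_line FF' v.
have cF (A : set R) : {within A, continuous (fun h : R => F (v + h *: basis3 i))}.
  apply: continuous_subspaceT => x.
  by apply/differentiable_continuous/derivable1_diffP; apply: ex_derive.
have [h0|h0|->] := ltgtP h 0; last first.
- by exists 0; rewrite // scale0r addr0 subrr mul0r.
- have [s /itvP s0h] := MVT h0 (fun x _ => dF x) (cF _).
  rewrite scale0r addr0 subr0 => ->; exists s; last by rewrite mulrC.
  by rewrite !ger0_norm ?s0h// ltW.
- have [s /itvP s0h] := MVT h0 (fun x _ => dF x) (cF _).
  rewrite scale0r addr0 sub0r => e; exists s.
    by rewrite !ler0_norm ?lerN2 ?s0h// ltW.
  by rewrite -opprB e mulrN opprK mulrC.
Qed.

(** By the mean value theorem the quotient is a value of [F'] at distance at most 1, where the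
    weights are comparable. *)
Lemma quotient_bound i F F' n : isd i F F' -> rapid F' ->
  exists2 C : R, 0 <= C & forall (h : R) v, h != 0 -> `|h| <= 1 ->
    `|h^-1 * (F (v + h *: basis3 i) - F v)| * bra v ^+ n <= C.
Proof.
move=> FF' rF'; have [C C0 FC] := rapid_bound n rF'.
exists (C * 4 ^+ n) => [|h v h0 h1]; first by rewrite mulr_ge0.
have [s sh ->] := isd_MVT v h FF'; rewrite mulKf//.
have s1 : `|s| <= 1 := le_trans sh h1.
have b : bra v ^+ n <= bra (v + s *: basis3 i) ^+ n * 4 ^+ n.
  by rewrite mulrC -exprMn lerXn2r ?nnegrE ?mulr_ge0 ?bra_ge0// bra_shift_le.
by apply: (le_trans (ler_wpM2l _ b)) => //; rewrite mulrA ler_wpM2r.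
Qed.

(** Differentiation under the integral sign by dominated convergence along a sequence of
    increments. *)
Lemma quotient_cvg i F F' K (t : R^nat) : isd i F F' -> rapid F -> rapid F' ->
  slow K -> (forall n, t n != 0) -> (forall n, `|t n| <= 1) ->
  t n @[n --> \oo] --> 0 ->
  \int[leb3]_w (K w * ((t n)^-1 * (F (w + t n *: basis3 i) - F w))) @[n --> \oo]
  --> \int[leb3]_w (K w * F' w).
Proof.
move=> FF' rF rF' sK t0 t1 tcvg.
have [m [A [A0 KA]]] := slow_pos sK.
(* [m] powers of [bra] absorb the growth of [K], three more produce the integrable majorant
   [env]. *)
have [C C0 qC] := quotient_bound (m + 3) FF' rF'.
pose f_ n w := K w * ((t n)^-1 * (F (w + t n *: basis3 i) - F w)).
have rf n : rapid (f_ n).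
  by apply: rapidMl => //; apply: rapidZ; apply: rapidB => //; exact: rapid_shift.
have := @dominated_convergence _ _ R leb3 [set: R3 R] measurableT
  (fun n => EFin \o f_ n) (EFin \o (fun w => K w * F' w)) (fun w => (A * C * env w)%:E).
case.
- by move=> n; apply/measurable_EFinP; exact: (rf n).1.
- by apply/measurable_EFinP; exact: (rapidMl sK rF').1.
- apply: aeW => w _; apply: cvg_EFin; first exact: nearW.
  rewrite /f_; apply: cvgMr.
  have /is_derive_cvgP/cvgr_dnbhsP/(_ t) := FF' w.
  move=> /(_ (conj t0 tcvg)); apply: cvg_trans; apply: near_eq_cvg; near=> n.
  by rewrite [X in F X]addrC.
- exact: integrable_envZ.
- apply: aeW => w n _; rewrite /= lee_fin /f_ normrM.
  have h := qC (t n) w (t0 n) (t1 n).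
  apply: (le_trans (ler_wpM2r _ (KA w))) => //.
  rewrite -mulrA -mulrA ler_wpM2l//.
  apply: le_trans (ler_wpM2r (env_ge0 w) h).
  rewrite exprD; set Q := `| _ |.
  rewrite [leRHS](_ : _ = (bra w ^+ m * Q) * (env w * bra w ^+ 3)); last by ring.
  by rewrite ler_peMr ?bra_env// mulr_ge0 ?normr_ge0// ltW// bra_expr_gt0.
move=> _ _ h.
have {}h : (\int[leb3]_w f_ n w)%:E @[n --> \oo] --> (\int[leb3]_w (K w * F' w))%:E.
  rewrite -eint_rapid; last exact: rapidMl.
  move: h; apply: cvg_trans; apply: near_eq_cvg; near=> n.
  by rewrite /= eint_rapid//.
exact: (fine_cvg h).
Unshelve. all: by end_near. Qed.

(** By translation invariance every difference quotient has integral zero, and so has its limit.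
    This is the only form of integration by parts used on R^3. *)
Lemma int_isd0 i F F' : isd i F F' -> rapid F -> rapid F' ->
  \int[leb3]_v F' v = 0.
Proof.
move=> FF' rF rF'.
pose t (n : nat) : R := n.+1%:R^-1.
have t0 n : t n != 0 by rewrite invr_neq0.
have t1 n : `|t n| <= 1 by rewrite /t ger0_norm// invf_le1// ler1n.
have := quotient_cvg FF' rF rF' (slow_cst 1) t0 t1 cvg_harmonic.
under eq_Rintegral do rewrite mul1r.
rewrite (_ : (fun _ => _) = cst 0).
  by move/cvg_lim => <- //; rewrite lim_cst.
apply/funext => n /=; under eq_Rintegral do rewrite mul1r.
rewrite intZ ?intB ?int_shift ?subrr ?mulr0//; first exact: rapid_shift.
by apply: rapidB => //; exact: rapid_shift.
Qed.

(** Substituting [w + h e_i] for [w] puts the increment on [g], so kernels that are singular at the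
    origin are allowed. *)
Lemma isd_conv i K g g1 : slow K -> isd i g g1 -> rapid g -> rapid g1 ->
  isd i (fun v => \int[leb3]_w (K (v - w) * g w))
        (fun v => \int[leb3]_w (K (v - w) * g1 w)).
Proof.
move=> sK gg1 rg rg1 v; apply/is_derive_cvgP.
have sK2 := slow2_sub sK.
have sKv := slow2_slow v sK2.
have shiftE h : \int[leb3]_w (K (h *: basis3 i + v - w) * g w) =
    \int[leb3]_w (K (v - w) * g (w + h *: basis3 i)).
  rewrite -(int_shift (h *: basis3 i) (slow2_rapid_int (h *: basis3 i + v) sK2 rg)).
  by apply: eq_Rintegral => w _; rewrite (addrC w) opprD addrACA subrr add0r.
apply/cvgr_dnbhsP => t [t0 tcvg].
have [N _ tN] : \forall n \near \oo, `|t n| <= 1.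
  move/cvgrPdist_le : tcvg => /(_ 1 ltr01); apply: filterS => n.
  by rewrite sub0r normrN.
(* Dropping finitely many terms makes every increment at most 1 in modulus, as [quotient_cvg]
   demands. *)
rewrite -(cvg_shiftn N).
pose s n := t (n + N)%N.
have s1 n : `|s n| <= 1 by apply: tN => /=; exact: leq_addl.
have scvg : s n @[n --> \oo] --> 0 by rewrite /s cvg_shiftn.
have := quotient_cvg gg1 rg rg1 sKv (fun n => t0 (n + N)%N) s1 scvg.
apply: cvg_trans; apply: near_eq_cvg; near=> n.
rewrite -/(s n) /= shiftE.
rewrite -intB; last 2 first.
- by apply: rapidMl => //; exact: rapid_shift.
- exact: rapidMl.
rewrite -[RHS]/((s n)^-1 * _) -intZ; last first.
  by apply: rapidB; apply: rapidMl => //; exact: rapid_shift.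
by apply: eq_Rintegral => w _; rewrite /s; ring.
Unshelve. all: by end_near. Qed.

Lemma isd_of_line i F F' :
  (forall v, is_derive (0 : R) 1 (fun h : R => F (v + h *: basis3 i)) (F' v)) ->
  isd i F F'.
Proof.
move=> H v; have /is_derive_cvgP := H v; move=> h; apply/is_derive_cvgP.
apply: cvg_trans h; apply: near_eq_cvg; near=> h.
by rewrite [h *: 1]mulr1 scale0r !addr0 [v + _]addrC.
Unshelve. all: by end_near. Qed.

Lemma isd_eq i F F1 G G1 : isd i F F1 -> F =1 G -> F1 =1 G1 -> isd i G G1.
Proof. by move=> FF /funext <- /funext <-. Qed.

Lemma isdD i F F' G G' : isd i F F' -> isd i G G' ->
  isd i (fun v => F v + G v) (fun v => F' v + G' v).
Proof. by move=> dF dG v; apply: is_deriveD. Qed.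

Lemma isdB i F F' G G' : isd i F F' -> isd i G G' ->
  isd i (fun v => F v - G v) (fun v => F' v - G' v).
Proof. by move=> dF dG v; apply: is_deriveB. Qed.

Lemma isdM i F F' G G' : isd i F F' -> isd i G G' ->
  isd i (fun v => F v * G v) (fun v => F' v * G v + F v * G' v).
Proof.
move=> dF dG v; have := is_deriveM (dF v) (dG v).
by move/is_derive_eq; apply; rewrite addrC [X in X + _]mulrC.
Qed.

Lemma isd_cst i (c : R) : isd i (fun=> c) (fun=> 0).
Proof. by move=> v; exact: is_derive_cst. Qed.

Lemma isdZ i F F' (c : R) : isd i F F' -> isd i (fun v => c * F v) (fun v => c * F' v).
Proof.
move=> dF; apply: isd_eq (isdM (isd_cst i c) dF) _ _ => // v.
by rewrite mul0r add0r.
Qed.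

Lemma isd_coord i j : isd i (coord3 ^~ j) (fun=> (i == j)%:R).
Proof.
move=> v; apply/is_derive_cvgP.
apply: (@cvg_trans _ ((i == j)%:R @[h --> (0 : R)^'])); last exact: cvg_cst.
apply: near_eq_cvg; near=> h.
rewrite coord3D coord3Z coord3_basis addrK [RHS](_ : _ = h^-1 * (h * (i == j)%:R))//.
rewrite mulKf//; near: h; exact: nbhs_dnbhs_neq.
Unshelve. all: by end_near. Qed.

Lemma isd_coordB i j v : isd i (fun w => coord3 (v - w) j) (fun=> - (i == j)%:R).
Proof.
apply: isd_eq (isdB (isd_cst i (coord3 v j)) (isd_coord i j)) _ _ => w.
  by rewrite coord3B.
by rewrite sub0r.
Qed.

Lemma isd_pow i v (c s : R) : 0 < c ->
  isd i (fun w => (c + nsq (v - w)) `^ s)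
    (fun w => - (2 * s * coord3 (v - w) i * (c + nsq (v - w)) `^ (s - 1))).
Proof.
move=> c0; apply: isd_of_line => w.
have nsq_line (h : R) : c + nsq (v - (w + h *: basis3 i)) =
    (c + nsq (v - w)) - 2 * coord3 (v - w) i * h + h ^+ 2.
  rewrite (_ : v - (w + _) = v - w - h *: basis3 i); last by rewrite opprD addrA.
  move: (v - w) => z.
  rewrite -!nsqE !sum3E !coord3B !coord3Z !coord3_basis.
  by move: i; apply: ord3_ind; rewrite /=; ring.
under eq_fun do rewrite nsq_line.
(* Along the line the base of the power is a quadratic polynomial in [h], and positivity of [c]
   keeps it positive at [h = 0]; the one-variable chain rule applies. *)
have p0 : 0 < c + nsq (v - w) by rewrite ltr_pwDl// nsq_ge0.
set A := c + nsq (v - w) in p0 *; set B := coord3 (v - w) i.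
pose P (h : R) : R := A - 2 * B * h + h ^+ 2.
have dP : is_derive (0 : R) 1 P (- (2 * B)).
  apply: is_derive_eq.
  by rewrite /GRing.scale/=; ring.
have P0 : P 0 = A by rewrite /P mulr0 subr0 expr0n addr0.
have dpow : is_derive (P 0) 1 (fun x : R => x `^ s) (s * A `^ (s - 1)).
  by rewrite P0; exact: is_derive1_powR.
have := is_derive1_comp dpow dP.
by move/is_derive_eq; apply; ring.
Qed.

End directional.

Section schwartz.
Context {R : realType}.
Implicit Types (f : R3 R -> R).

Lemma schwartz_rapid f a : schwartz f -> rapid (iter_partial a f).
Proof.
move=> [df sf]; split.
  by apply: continuous_measurable3 => v; exact/differentiable_continuous.
move=> n; have := sf (2 * n)%N a; rewrite /seminorm; set S := ereal_sup _ => Soo.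
have S0 : (0 <= S)%E.
  apply: (@le_trans _ _ (japanese (0 : R3 R) ^+ (2 * n) * `|iter_partial a f 0|)%:E).
    by rewrite lee_fin mulr_ge0// exprn_ge0// sqrtr_ge0.
  by apply: ereal_sup_ubound; exists 0.
exists (fine S) => v; rewrite -lee_fin fineK ?ge0_fin_numE//.
apply: ereal_sup_ubound; exists v => //.
by rewrite exprM japanese_sqr mulrC.
Qed.

Lemma schwartz_isd f a i : schwartz f ->
  isd i (iter_partial a f) (iter_partial (i :: a) f).
Proof. by move=> [df _] v; apply/derivableP/diff_derivable/df. Qed.

End schwartz.

(** * The collision operator *)

Section kernel.
Context {R : realType}.
Implicit Types (v w z : R3 R) (i j : 'I_3) (p e s : R).

(* The kernel |z|^gamma (|z|^2 delta_ij - z_i z_j), gamma = 2 p, with |z|^2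
   replaced by e + |z|^2 in the singular factor only; for every e the vector
   z is still in its null space, which keeps its divergence simple. *)
Definition Aker p e i j z : R :=
  (e + nsq z) `^ p * (nsq z * (i == j)%:R - coord3 z i * coord3 z j).

Lemma nsq_eq0_coord z i : nsq z = 0 -> coord3 z i = 0.
Proof.
by move=> z0; have := coord_sqr_le z i; rewrite z0 real_exprn_even_le0//= => /eqP.
Qed.

Lemma landau_kernelE gamma i j z : -2 < gamma -> gamma < 0 ->
  landau_kernel gamma i j z = Aker (gamma / 2) 0 i j z.
Proof.
move=> g2 g0; rewrite /landau_kernel /Aker enorm_powR enorm_sq add0r.
(* At [z = 0] both sides vanish: on the left, zero is raised to the nonzero power [(gamma + 2) / 2];
   on the right, the quadratic factor is zero. *)
have [n0|n0] := eqVneq (nsq z) 0.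
  rewrite n0 !(nsq_eq0_coord _ n0) !mul0r subrr mulr0 powR0 ?mul0r//.
  by apply/eqP; lra.
rewrite (_ : (gamma + 2) / 2 = gamma / 2 + 1); last by field.
rewrite powRD ?n0 ?implybT// powRr1 ?nsq_ge0// -mulrA mulrBr.
by congr (_ * (_ - _)); field.
Qed.

Lemma quad_bound z i j :
  `|nsq z * (i == j)%:R - coord3 z i * coord3 z j| <= nsq z.
Proof.
have [<-|ij] := eqVneq i j.
  have h := coord_sqr_le z i; rewrite mulr1 -expr2 ger0_norm ?subr_ge0//.
  by rewrite gerBl sqr_ge0.
rewrite mulr0 sub0r normrN normrM.
have h : coord3 z i ^+ 2 + coord3 z j ^+ 2 <= nsq z.
  rewrite -nsqE (bigD1 i)//= (bigD1 j) 1?eq_sym//= lerD2l lerDl.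
  by apply: sumr_ge0 => k _; exact: sqr_ge0.
have := sqr_ge0 (`|coord3 z i| - `|coord3 z j|).
rewrite sqrrB !real_normK ?num_real//.
have := sqr_ge0 (coord3 z i); have := sqr_ge0 (coord3 z j).
move: (`|coord3 z i| * _) h => ab h; lra.
Qed.

Lemma powR_nondecr s (a b : R) : 0 <= s -> 0 <= a -> a <= b -> a `^ s <= b `^ s.
Proof.
by move=> s0 a0 ab; apply: ge0_ler_powR; rewrite ?nnegrE// (le_trans a0).
Qed.

Lemma powR_nonincr s (a b : R) : s <= 0 -> 0 < a -> a <= b -> b `^ s <= a `^ s.
Proof.
move=> s0 a0 ab; have b0 : 0 < b := lt_le_trans a0 ab.
rewrite -oppr_ge0 in s0; rewrite -[s]opprK; move: (- s) s0 => t t0.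
by rewrite !powRN lef_pV2 ?posrE ?powR_gt0// powR_nondecr// ltW.
Qed.

Lemma measurable_pow_nsq e s : measurable_fun [set: R3 R] (fun z => (e + nsq z) `^ s).
Proof.
apply: (measurableT_comp (measurable_powR s)).
by apply: measurable_funD => //; exact: measurable_nsq.
Qed.

Lemma slow_pow_nsq e s : 0 < e -> s <= 0 -> slow (fun z => (e + nsq z) `^ s).
Proof.
move=> e0 s0; apply: (slow_bounded (C := e `^ s)); first exact: measurable_pow_nsq.
by move=> z; rewrite ger0_norm ?powR_ge0// powR_nonincr// lerDl nsq_ge0.
Qed.

Lemma slow_quad i j : slow (fun z => nsq z * (i == j)%:R - coord3 z i * coord3 z j).
Proof.
apply: slowB; first by apply: slowM; [exact: slow_nsq|exact: slow_cst].
by apply: slowM; exact: slow_coord.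
Qed.

(** Here [gamma > -2] enters: as [p + 1 > 0], the factor [n] tames the singular power near zero,
    uniformly in [e]. *)
Lemma pow_mul_le p (e n : R) : -1 < p -> p < 0 -> 0 <= e -> 0 <= n ->
  (e + n) `^ p * n <= 1 + n.
Proof.
move=> p1 p0 e0 n0; have [->|nneq0] := eqVneq n 0.
  by rewrite mulr0 addr0 ler01.
have {nneq0}n0 : 0 < n by rewrite lt_def nneq0.
have h : (e + n) `^ p <= n `^ p by apply: powR_nonincr; rewrite ?lerDr// ltW.
apply: (le_trans (ler_wpM2r (ltW n0) h)).
have [n1|n1] := leP 1 n.
  rewrite ler_wpDl// ler_piMl//; first exact: ltW.
  by rewrite -(powRr0 n); apply: ler_powR => //; exact: ltW.
have -> : n `^ p * n = n `^ (p + 1).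
  by rewrite powRD ?(gt_eqF n0) ?implybT// powRr1// ltW.
apply: ler_wpDr; first exact: ltW.
have := @powR_nondecr (p + 1) n 1; rewrite powR1; apply; [lra|exact: ltW|exact: ltW].
Qed.

Lemma Aker_slow p e i j : -1 < p -> p < 0 -> 0 <= e -> slow (Aker p e i j).
Proof.
move=> p1 p0 e0; split.
  by apply: measurable_funM; [exact: measurable_pow_nsq|exact: (slow_quad i j).1].
exists 1%N, 1 => z; rewrite mul1r expr1 normrM ger0_norm ?powR_ge0//.
apply: (le_trans (ler_wpM2l (powR_ge0 _ _) (quad_bound z i j))).
exact: pow_mul_le (nsq_ge0 z).
Qed.

(** With [n = |z|^2], monotonicity of [x^(p+1)] and of [x^p] gives [n^p n - (e + n)^p n <= (e + n)^p
    e <= e^(p+1)]. Uniformity in [z] means that a convolution with [g] changes by at most [e^(p+1)]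
    times the L1 norm of [g]. *)
Lemma Aker_diff p e i j z : -1 < p -> p < 0 -> 0 < e ->
  `|Aker p 0 i j z - Aker p e i j z| <= e `^ (p + 1).
Proof.
move=> p1 p0 e0; rewrite /Aker add0r -mulrBl normrM.
have [n0|nneq0] := eqVneq (nsq z) 0.
  by rewrite n0 mul0r !(nsq_eq0_coord _ n0) mul0r subrr normr0 mulr0 powR_ge0.
have n0 : 0 < nsq z by rewrite lt_def nneq0 nsq_ge0.
have h : (e + nsq z) `^ p <= nsq z `^ p.
  by apply: powR_nonincr; rewrite ?lerDr// ltW.
rewrite (ger0_norm (x := _ - _)) ?subr_ge0//.
have h0 : 0 <= nsq z `^ p - (e + nsq z) `^ p by rewrite subr_ge0.
apply: (le_trans (ler_wpM2l h0 (quad_bound z i j))).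
move: {h h0}(nsq z) n0 => n n0.
have en0 : 0 < e + n by rewrite addr_gt0.
have E (x : R) : 0 < x -> x `^ p * x = x `^ (p + 1).
  by move=> x0; rewrite powRD ?(gt_eqF x0) ?implybT// powRr1// ltW.
have h1 : n `^ p * n <= (e + n) `^ p * (e + n).
  by rewrite !E//; apply: powR_nondecr; [lra|exact: ltW|rewrite lerDr ltW].
have h2 : (e + n) `^ p * e <= e `^ (p + 1).
  rewrite -E//; apply: ler_wpM2r; first exact: ltW.
  by apply: powR_nonincr => //; [exact: ltW|rewrite lerDl ltW].
by move: h1 h2; lra.
Qed.

End kernel.

(** * Weak form of the collision operator tested with [f] *)

Section collision.
Context {R : realType}.
Variables (p : R) (f : R3 R -> R) (d1 : 'I_3 -> R3 R -> R)
  (d2 : 'I_3 -> 'I_3 -> R3 R -> R).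
Hypotheses (p1 : -1 < p) (p0 : p < 0).
Hypotheses (rf : rapid f) (rd1 : forall i, rapid (d1 i))
  (rd2 : forall i j, rapid (d2 i j)).
Hypotheses (df : forall i, isd i f (d1 i)) (dd1 : forall i j, isd i (d1 j) (d2 i j)).
Implicit Types (v w z : R3 R) (i j : 'I_3).

Definition conv (K g : R3 R -> R) v := \int[leb3]_w (K (v - w) * g w).

Lemma conv_slow K g : slow K -> rapid g -> slow (conv K g).
Proof. by move=> sK rg; exact: (slow_int (slow2_sub sK) rg). Qed.

Lemma conv_rapid K g v : slow K -> rapid g -> rapid (fun w => K (v - w) * g w).
Proof. by move=> sK rg; exact: (slow2_rapid_int v (slow2_sub sK) rg). Qed.

Let K i j := Aker p 0 i j.
Let sK i j : slow (K i j). Proof. exact: Aker_slow. Qed.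

Definition flux i j v := conv (K i j) f v * d1 j v - f v * conv (K i j) (d1 j) v.

(** The derivatives of the convolutions fall on [f], because the unregularised kernel may fail to be
    differentiable at the origin. *)
Definition dflux i j v :=
  conv (K i j) (d1 i) v * d1 j v + conv (K i j) f v * d2 i j v
  - (d1 i v * conv (K i j) (d1 j) v + f v * conv (K i j) (d2 i j) v).

Lemma rapid_flux i j : rapid (flux i j).
Proof.
by apply: rapidB; [apply: rapidMl|apply: rapidMr] => //; exact: conv_slow.
Qed.

Lemma rapid_dflux i j : rapid (dflux i j).
Proof.
by apply: rapidB; apply: rapidD; [apply: rapidMl|apply: rapidMl|apply: rapidMr|
  apply: rapidMr] => //; exact: conv_slow.
Qed.

Lemma isd_flux i j : isd i (flux i j) (dflux i j).
Proof.
by apply: isdB; apply: isdM => //; exact: isd_conv.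
Qed.

(** The first integration by parts moves the derivative from the flux to [f]. It leaves the cross
    term [f (d_i f) (K * d_j f)], half of a derivative of [f^2] times a convolution, which a second
    integration by parts turns into the last term; hence the factor [1/2]. *)
Lemma int_dflux i j :
  \int[leb3]_v (f v * dflux i j v) =
  - (\int[leb3]_v (conv (K i j) f v * (d1 i v * d1 j v)))
  - 2^-1 * \int[leb3]_v (f v ^+ 2 * conv (K i j) (d2 i j) v).
Proof.
have sf := rapid_slow rf.
have sc g : rapid g -> slow (conv (K i j) g) by move=> rg; exact: conv_slow.
have r1 : rapid (fun v => conv (K i j) f v * (d1 i v * d1 j v)).
  by apply: rapidMl; [exact: sc|apply: rapidMl => //; exact: rapid_slow].
have r2 : rapid (fun v => f v ^+ 2 * conv (K i j) (d2 i j) v).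
  by apply: rapidMr; [exact: rapid_sqr|exact: sc].
have r3 : rapid (fun v => f v * d1 i v * conv (K i j) (d1 j) v).
  by apply: rapidMr; [apply: rapidMl|exact: sc].
have r4 : rapid (fun v => f v * dflux i j v) by apply: rapidMl => //; exact: rapid_dflux.
have := int_isd0 (isdM (df i) (isd_flux i j)).
move=> /(_ (rapidMl sf (rapid_flux i j))).
have r5 : rapid (fun v => d1 i v * flux i j v + f v * dflux i j v).
  by apply: rapidD => //; apply: rapidMl (rapid_flux i j); exact: rapid_slow.
move=> /(_ r5).
rewrite [X in Rintegral _ _ X](_ : _ = (fun v => f v * dflux i j v +
   (conv (K i j) f v * (d1 i v * d1 j v) - f v * d1 i v * conv (K i j) (d1 j) v))); last first.
  by apply/funext => v; rewrite /flux; ring.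
rewrite intD//; last exact: rapidB.
rewrite intB// => E1.
have := int_isd0 (isdM (isdM (df i) (df i)) (isd_conv (sK i j) (dd1 i j) (rd1 j) (rd2 i j))).
move=> /(_ (rapidMr (rapidMl sf rf) (sc _ (rd1 j)))).
rewrite -/(conv (K i j) (d1 j)) -/(conv (K i j) (d2 i j)).
rewrite (_ : (fun _ => _) = fun v => 2 * (f v * d1 i v * conv (K i j) (d1 j) v) +
  f v ^+ 2 * conv (K i j) (d2 i j) v); last by apply/funext => v; rewrite /conv; ring.
move=> /(_ (rapidD (rapidZ 2 r3) r2)).
rewrite intD ?intZ//; last exact: rapidZ.
by move: E1; lra.
Qed.

Let Q v := \sum_(i < 3) \sum_(j < 3) dflux i j v.

Lemma rapid_sum2 (F : 'I_3 -> 'I_3 -> R3 R -> R) : (forall i j, rapid (F i j)) ->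
  rapid (fun v => \sum_(i < 3) \sum_(j < 3) F i j v).
Proof. by move=> rF; apply: rapid_sum => i; exact: rapid_sum. Qed.

Lemma int_sum2 (F : 'I_3 -> 'I_3 -> R3 R -> R) : (forall i j, rapid (F i j)) ->
  \int[leb3]_v (\sum_(i < 3) \sum_(j < 3) F i j v) =
  \sum_(i < 3) \sum_(j < 3) \int[leb3]_v F i j v.
Proof.
move=> rF; rewrite int_sum; last by move=> i; exact: rapid_sum.
by apply: eq_bigr => i _; rewrite int_sum.
Qed.

Lemma int_collision :
  \int[leb3]_v (f v * Q v) =
  - (\int[leb3]_v (\sum_(i < 3) \sum_(j < 3) conv (K i j) f v * (d1 i v * d1 j v)))
  - 2^-1 * \int[leb3]_v (f v ^+ 2 * \sum_(i < 3) \sum_(j < 3) conv (K i j) (d2 i j) v).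
Proof.
have sc i j g : rapid g -> slow (conv (K i j) g) by move=> rg; exact: conv_slow.
rewrite [X in Rintegral _ _ X = _](_ : _ = (fun v => \sum_(i < 3) \sum_(j < 3) f v * dflux i j v)); last first.
  by apply/funext => v; rewrite /Q mulr_sumr; apply: eq_bigr => i _; rewrite mulr_sumr.
rewrite [X in _ - _ * Rintegral _ _ X](_ : _ = (fun v => \sum_(i < 3) \sum_(j < 3) f v ^+ 2 * conv (K i j) (d2 i j) v)); last first.
  by apply/funext => v; rewrite mulr_sumr; apply: eq_bigr => i _; rewrite mulr_sumr.
have r1 i j : rapid (fun v => conv (K i j) f v * (d1 i v * d1 j v)).
  by apply: rapidMl; [exact: sc|apply: rapidMl => //; exact: rapid_slow].
have r2 i j : rapid (fun v => f v ^+ 2 * conv (K i j) (d2 i j) v).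
  by apply: rapidMr; [exact: rapid_sqr|exact: sc].
have r3 i j : rapid (fun v => f v * dflux i j v).
  by apply: rapidMl; [exact: rapid_slow|exact: rapid_dflux].
rewrite (int_sum2 r1) (int_sum2 r2) (int_sum2 r3).
rewrite mulr_sumr -sumrN -sumrB; apply: eq_bigr => i _.
rewrite mulr_sumr -sumrN -sumrB; apply: eq_bigr => j _.
exact: int_dflux.
Qed.

(** * Divergences of the regularised kernel *)

Section regularized.
Variable e : R.
Hypothesis e0 : 0 < e.

Let P z := (e + nsq z) `^ p.
Let P' z := (e + nsq z) `^ (p - 1).

(** [dA i j] is the i-th derivative of [Aker p e i j], [bvec] the divergence of that matrix, and
    [dbvec j] the j-th derivative of [bvec j]. *)
Definition dA i j z := 2 * p * coord3 z i * P' z *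
    (nsq z * (i == j)%:R - coord3 z i * coord3 z j) +
  P z * (2 * coord3 z i * (i == j)%:R - (coord3 z j + coord3 z i * (i == j)%:R)).

Definition bvec j z := - 2 * coord3 z j * P z.

Definition dbvec j z := - 2 * P z - 4 * p * coord3 z j ^+ 2 * P' z.

Lemma slow_P : slow P. Proof. by apply: slow_pow_nsq => //; exact: ltW. Qed.

Lemma slow_P' : slow P'. Proof. by apply: slow_pow_nsq => //; rewrite subr_le0 ltW// (lt_trans p0). Qed.

Lemma slow_dA i j : slow (dA i j).
Proof.
apply: slowD; apply: slowM; [|exact: slow_quad|exact: slow_P|].
  by apply: slowM slow_P'; apply: slowM (slow_coord _); exact: slow_cst.
apply: slowB; first by apply: slowM (slow_cst _); apply: slowM (slow_coord _); exact: slow_cst.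
by apply: slowD; [exact: slow_coord|apply: slowM; [exact: slow_coord|exact: slow_cst]].
Qed.

Lemma slow_bvec j : slow (bvec j).
Proof. by apply: slowM slow_P; apply: slowM (slow_coord _); exact: slow_cst. Qed.

Lemma slow_dbvec j : slow (dbvec j).
Proof.
apply: slowB; first by apply: slowM slow_P; exact: slow_cst.
apply: slowM slow_P'; apply: slowM; first exact: slow_cst.
rewrite (_ : (fun _ => _) = fun z => coord3 z j * coord3 z j).
  by apply: slowM; exact: slow_coord.
by apply/funext => z; rewrite expr2.
Qed.

Lemma isd_nsqB i v : isd i (fun w => nsq (v - w)) (fun w => - (2 * coord3 (v - w) i)).
Proof.
have h j := isdM (isd_coordB i j v) (isd_coordB i j v).
apply: isd_eq (isdD (isdD (h o0) (h o1)) (h o2)) _ _ => w.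
  by rewrite -nsqE sum3E !expr2.
by move: i {h}; apply: ord3_ind; rewrite /=; ring.
Qed.

Lemma isd_PB i v : isd i (fun w => P (v - w)) (fun w => - (2 * p * coord3 (v - w) i * P' (v - w))).
Proof. exact: isd_pow. Qed.

Lemma isd_AB i j v : isd i (fun w => Aker p e i j (v - w)) (fun w => - dA i j (v - w)).
Proof.
apply: isd_eq (isdM (isd_PB i v) (isdB (isdM (isd_nsqB i v) (isd_cst i (i == j)%:R))
  (isdM (isd_coordB i i v) (isd_coordB i j v)))) _ _ => // w.
by rewrite /dA eqxx mulr1n; ring.
Qed.

Lemma isd_bB j v : isd j (fun w => bvec j (v - w)) (fun w => - dbvec j (v - w)).
Proof.
apply: isd_eq (isdM (isdZ (- 2) (isd_coordB j j v)) (isd_PB j v)) _ _ => // w.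
by rewrite /dbvec eqxx mulr1n; ring.
Qed.

(* [B'] is the i-th partial derivative of [B], hence the sign in the hypothesis. *)
Lemma conv_ibp i (B B' : R3 R -> R) (g g' : R3 R -> R) v :
  slow B -> slow B' -> rapid g -> rapid g' -> isd i g g' ->
  isd i (fun w => B (v - w)) (fun w => - B' (v - w)) ->
  conv B g' v = conv B' g v.
Proof.
move=> sB sB' rg rg' dg dB.
have r1 : rapid (fun w => B (v - w) * g' w) := conv_rapid v sB rg'.
have r2 : rapid (fun w => B' (v - w) * g w) := conv_rapid v sB' rg.
have := int_isd0 (isdM dB dg) (conv_rapid v sB rg).
rewrite (_ : (fun _ => _) = fun w => B (v - w) * g' w - B' (v - w) * g w); last first.
  by apply/funext => w; ring.
by move=> /(_ (rapidB r1 r2)); rewrite intB// => /eqP; rewrite subr_eq0 => /eqP.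
Qed.

(** The derivative of the singular factor is proportional to [z], which the matrix [|z|^2 I - z z^T]
    annihilates; only the derivative of the quadratic part survives. The vanishing first summand in
    the proof displays this cancellation. *)
Lemma sum_dA j z : \sum_(i < 3) dA i j z = bvec j z.
Proof.
have -> : bvec j z = 2 * p * P' z * (nsq z * coord3 z j - nsq z * coord3 z j)
  + P z * (2 * coord3 z j - (3 * coord3 z j + coord3 z j)) by rewrite /bvec; ring.
rewrite sum3E /dA -!nsqE !sum3E.
by move: j; apply: ord3_ind; rewrite /=; ring.
Qed.

(* The dropped term - 4 p |z|^2 (e + |z|^2)^(p - 1) is nonnegative as p < 0. *)
Lemma sum_dbvec z : - 6 * P z <= \sum_(j < 3) dbvec j z.
Proof.
rewrite sum3E /dbvec.
have P'0 : 0 <= P' z := powR_ge0 _ _.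
have h : 0 <= - p * (nsq z * P' z) by rewrite mulr_ge0 ?mulr_ge0 ?nsq_ge0// oppr_ge0 ltW.
rewrite -nsqE sum3E in h.
by lra.
Qed.

(** Two integrations by parts move both derivatives onto the regularised kernel; summing over [i]
    first yields its divergence, summing over [j] then the double divergence, bounded below by
    [sum_dbvec]. *)
Lemma conv_A_bound v : (forall w, 0 <= f w) ->
  - \sum_(i < 3) \sum_(j < 3) conv (Aker p e i j) (d2 i j) v <= 6 * conv P f v.
Proof.
move=> f0.
have -> : \sum_(i < 3) \sum_(j < 3) conv (Aker p e i j) (d2 i j) v =
  \int[leb3]_w ((\sum_(j < 3) dbvec j (v - w)) * f w).
  rewrite exchange_big/=.
  rewrite (_ : (fun w => _) = fun w => \sum_(j < 3) (dbvec j (v - w) * f w)); last first.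
    by apply/funext => w; rewrite mulr_suml.
  rewrite int_sum; last by move=> j; exact/conv_rapid/rf/slow_dbvec.
  apply: eq_bigr => j _.
  rewrite -/(conv (dbvec j) f v).
  rewrite -(conv_ibp (slow_bvec j) (slow_dbvec j) rf (rd1 j) (df j) (isd_bB j v)).
  rewrite /conv (_ : (fun w => _) = fun w => \sum_(i < 3) (dA i j (v - w) * d1 j w)); last first.
    by apply/funext => w; rewrite -sum_dA mulr_suml.
  rewrite int_sum; last by move=> i; exact/conv_rapid/rd1/slow_dA.
  apply: eq_bigr => i _.
  apply: (conv_ibp _ (slow_dA i j) (rd1 j) (rd2 i j) (dd1 i j) (isd_AB i j v)).
  by apply: Aker_slow => //; exact: ltW.
rewrite -intZ; last exact/conv_rapid/rf/slow_P.
rewrite -intN; last first.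
  rewrite (_ : (fun w => _) = fun w => \sum_(j < 3) (dbvec j (v - w) * f w)); last first.
    by apply/funext => w; rewrite mulr_suml.
  by apply: rapid_sum => j; exact/conv_rapid/rf/slow_dbvec.
apply: le_int.
- apply: rapidN.
  rewrite (_ : (fun w => _) = fun w => \sum_(j < 3) (dbvec j (v - w) * f w)); last first.
    by apply/funext => w; rewrite mulr_suml.
  by apply: rapid_sum => j; exact/conv_rapid/rf/slow_dbvec.
- by apply: rapidZ; exact/conv_rapid/rf/slow_P.
- move=> w; rewrite -mulNr mulrA ler_wpM2r//.
  by have := sum_dbvec (v - w); lra.
Qed.

End regularized.

End collision.

(** * Ellipticity of the diffusion matrix *)

Section ellipticity.
Context {R : realType}.
Implicit Types (v w z : R3 R) (i j k : 'I_3) (f : R3 R -> R) (xi : 'I_3 -> R).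

(** Lagrange's identity: the form is [|z|^(2p)] times the squared length of the cross product of [z]
    and [xi]. *)
Lemma quad_formE p z xi :
  \sum_(i < 3) \sum_(j < 3) Aker p 0 i j z * (xi i * xi j) =
  nsq z `^ p * ((coord3 z o0 * xi o1 - coord3 z o1 * xi o0) ^+ 2
    + (coord3 z o0 * xi o2 - coord3 z o2 * xi o0) ^+ 2
    + (coord3 z o1 * xi o2 - coord3 z o2 * xi o1) ^+ 2).
Proof.
rewrite /Aker add0r; set P := nsq z `^ p; rewrite -nsqE !sum3E /=; ring.
Qed.

Lemma quad_form_ge p z xi i k : i != k ->
  nsq z `^ p * (coord3 z i * xi k - coord3 z k * xi i) ^+ 2 <=
  \sum_(i < 3) \sum_(j < 3) Aker p 0 i j z * (xi i * xi j).
Proof.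
move=> ik; rewrite quad_formE ler_wpM2l ?powR_ge0//.
have h01 := sqr_ge0 (coord3 z o0 * xi o1 - coord3 z o1 * xi o0).
have h02 := sqr_ge0 (coord3 z o0 * xi o2 - coord3 z o2 * xi o0).
have h12 := sqr_ge0 (coord3 z o1 * xi o2 - coord3 z o2 * xi o1).
by move: i k ik; apply: ord3_ind; apply: ord3_ind => // _; lra.
Qed.

(** Stands in for rotating [xi] onto an axis: relative to a dominant coordinate [k], a single
    component of the cross product suffices. *)
Lemma max_coord xi : exists k, \sum_(i < 3) xi i ^+ 2 <= 3 * xi k ^+ 2.
Proof.
rewrite sum3E.
have [h01|h01] := leP (xi o0 ^+ 2) (xi o1 ^+ 2).
  have [h12|h12] := leP (xi o1 ^+ 2) (xi o2 ^+ 2); [exists o2|exists o1]; lra.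
have [h02|h02] := leP (xi o0 ^+ 2) (xi o2 ^+ 2); [exists o2|exists o0]; lra.
Qed.

Lemma ln_env v : - ln (env v) <= nsq v.
Proof.
have h (x : R) : - ln (cauchy x) <= x ^+ 2.
  have x1 : 0 < 1 + x ^+ 2 by rewrite ltr_pwDl// sqr_ge0.
  by rewrite /cauchy lnV ?posrE// opprK le_ln1Dx// (lt_le_trans _ (sqr_ge0 x))// ltrN10.
rewrite /env !lnM ?posrE ?mulr_gt0 ?cauchy_gt0// /nsq.
have := h v.1.1; have := h v.1.2; have := h v.2; lra.
Qed.

(* Young's inequality x a <= x ln x + exp (a - 1) at a = ln (env v), since
   - ln (env v) <= nsq v. *)
Lemma entropy_ge (x : R) v : 0 <= x -> 0 <= x * ln x + x * nsq v + env v.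
Proof.
rewrite le_eqVlt => /predU1P[<-|x0].
  by rewrite !mul0r !add0r env_ge0.
have e0 := env_gt0 v.
have h : ln (env v / x) <= env v / x - 1.
  have u0 : 0 < env v / x by rewrite divr_gt0.
  have -> : ln (env v / x) = ln (1 + (env v / x - 1)) by rewrite addrCA subrr addr0.
  by apply: le_ln1Dx; rewrite ltrBrDr addNr.
have := ln_env v.
rewrite ln_div ?posrE// in h.
have {h} : x * (ln (env v) - ln x) <= env v - x.
  apply: (le_trans (ler_wpM2l (ltW x0) h)).
  by rewrite mulrBr mulr1 mulrCA divff ?gt_eqF// mulr1.
have := ler_wpM2l (ltW x0) (ln_env v).
by lra.
Qed.

Lemma xlnx_bound (x : R) v : 0 <= x -> `|x * ln x| <= x ^+ 2 + x * nsq v + env v.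
Proof.
move=> x0; rewrite ler_norml; apply/andP; split.
  by have := entropy_ge v x0; have := sqr_ge0 x; lra.
have : x * ln x <= x ^+ 2.
  move: x0; rewrite le_eqVlt => /predU1P[<-|x0]; first by rewrite mul0r sqr_ge0.
  rewrite expr2 ler_wpM2l ?ltW//; apply: (lt_le_trans (ln_sublinear x0)) => //.
have := env_ge0 v; have := mulr_ge0 x0 (nsq_ge0 v); lra.
Qed.

Lemma integrable_entropy f : rapid f -> (forall v, 0 <= f v) ->
  leb3.-integrable [set: R3 R] (EFin \o (fun v => f v * ln (f v))).
Proof.
move=> rf f0.
have r1 : rapid (fun v => f v ^+ 2 + f v * nsq v).
  by apply: rapidD; [exact: rapid_sqr|apply: rapidMr => //; exact: slow_nsq].
have [C C0 fC] := rapid_env r1.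
apply: (@integrable_le_env _ _ (C + 1)).
  apply: measurable_funM; first exact: rf.1.
  by apply: (measurableT_comp (@measurable_ln R)); exact: rf.1.
move=> v; apply: (le_trans (xlnx_bound v (f0 v))).
have := fC v; rewrite ger0_norm; first by have := env_ge0 v; lra.
by rewrite addr_ge0 ?sqr_ge0// mulr_ge0 ?nsq_ge0.
Qed.

Lemma exists_neq k : exists i : 'I_3, i != k.
Proof. by move: k; apply: ord3_ind; [exists o1|exists o0|exists o0]. Qed.

(** The parameter is the square of the radius. *)
Definition nball (rho : R) : set (R3 R) := [set w | nsq w <= rho].

Lemma measurable_nball rho : measurable (nball rho).
Proof.
rewrite (_ : nball rho = nsq @^-1` `]-oo, rho]%classic).
  by rewrite -[X in measurable X]setTI; exact: measurable_nsq.
by apply/seteqP; split => w /=; rewrite in_itv.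
Qed.

Lemma rapid_indic (A : set (R3 R)) rho : measurable A -> A `<=` nball rho ->
  rapid (\1_A : R3 R -> R).
Proof.
move=> mA Ar; split; first exact: measurable_indic.
move=> n; exists ((1 + `|rho|) ^+ n) => v; rewrite indicE.
have [vA|_] := boolP (v \in A); last by rewrite normr0 mul0r exprn_ge0.
rewrite normr1 mul1r lerXn2r ?nnegrE ?bra_ge0//.
by rewrite lerD2l (le_trans (Ar v _)) ?ler_norm//; exact: set_mem.
Qed.

(** A slab around the plane [z_i = kap z_k] in [z = v - w]. For [kap = xi i / xi k] this plane
    contains the direction [xi], and outside the slab the [(i, k)] component of the cross product is
    at least [d |xi k|] in modulus. *)
Definition strip v i k (kap rho d : R) : set (R3 R) :=
  nball rho `&` [set w | `|coord3 (v - w) i - kap * coord3 (v - w) k| < d].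

Lemma measurable_strip v i k kap rho d : measurable (strip v i k kap rho d).
Proof.
apply: measurableI; first exact: measurable_nball.
pose g w := coord3 (v - w) i - kap * coord3 (v - w) k.
have mg : measurable_fun [set: R3 R] g.
  have mv j : measurable_fun [set: R3 R] (fun w => coord3 (v - w) j).
    apply: (measurableT_comp (measurable_coord3 j)).
    exact: (measurable_fun_pair2 v measurable_sub3).
  by apply: measurable_funB => //; exact: measurable_funM.
rewrite (_ : [set _ | _] = g @^-1` `]-d, d[%classic).
  by rewrite -[X in measurable X]setTI; exact: mg.
by apply/seteqP; split => w /=; rewrite in_itv/= ltr_norml.
Qed.

(* The M translates of the strip by multiples of its width are disjoint and stay
   in a fixed ball. *)
Lemma strip_packing v i k kap rho (M : nat) : i != k -> (0 < M)%N ->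
  M%:R * \int[leb3]_w (\1_(strip v i k kap rho (2 * M%:R)^-1) w : R) <=
  \int[leb3]_w (\1_(nball (2 * (rho + 1))) w : R).
Proof.
move=> ik M0; set d := (2 * M%:R)^-1; set S := strip _ _ _ _ _ _.
have d0 : 0 < d by rewrite invr_gt0 mulr_gt0// ltr0n.
have rS : rapid (\1_S : R3 R -> R).
  by apply: (@rapid_indic _ rho); [exact: measurable_strip|exact: subIsetl].
have rB : rapid (\1_(nball (2 * (rho + 1))) : R3 R -> R).
  exact: (rapid_indic (measurable_nball _) (@subset_refl _ _)).
have rSh (m : 'I_M) : rapid (fun w => \1_S (w + (2 * d * m%:R) *: basis3 i) : R).
  exact: rapid_shift.
have -> : M%:R * \int[leb3]_w (\1_S w : R) =
    \int[leb3]_w (\sum_(m < M) (\1_S (w + (2 * d * m%:R) *: basis3 i) : R)).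
  rewrite int_sum//; under eq_bigr do rewrite int_shift//.
  by rewrite sumr_const card_ord mulr_natl.
apply: le_int => //; first exact: rapid_sum.
move=> w.
have [[m mS]|noS] := pselect (exists m : 'I_M, S (w + (2 * d * m%:R) *: basis3 i)).
- rewrite (bigD1 m)//= big1 ?addr0; last first.
    move=> m' mm'; rewrite indicE; case: (boolP (_ \in _)) => // /set_mem m'S.
    exfalso; move: mS m'S => [_ /= h] [_ /= h'].
    move: h h'; rewrite !opprD !addrA !coord3B !coord3Z !coord3_basis eqxx (negbTE ik).
    rewrite !mulr0 !subr0 !mulr1.
    rewrite !ltr_norml => /andP[h1 h2] /andP[h3 h4].
    (* A point in both translates would have two offsets in an interval of length [2 d] that differ
       by [2 d |m - m'|]. *)
    have : `|(m%:R : R) - m'%:R| < 1.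
      rewrite ltr_norml; apply/andP; split; rewrite -(ltr_pM2l d0); lra.
    have [mm|mm|/val_inj mm] := ltngtP m m'.
    + by rewrite distrC -natrB ?(ltnW mm)// normr_nat ltrn1 ltnS leqn0 subn_eq0 leqNgt mm.
    + by rewrite -natrB ?(ltnW mm)// normr_nat ltrn1 ltnS leqn0 subn_eq0 leqNgt mm.
    + by rewrite mm eqxx in mm'.
  rewrite !indicE mem_set// mem_set//.
  (* A translate moves by at most [2 d M = 1], so the squared radius [rho] grows to at most
     [2 (rho + 1)]. *)
  case: mS => mS _; rewrite /nball/=.
  set h := (2 * d * m%:R) *: _ in mS *.
  rewrite -[w](addrK h); apply: (le_trans (nsqD_le _ _)); rewrite nsqN.
  rewrite ler_pM2l// lerD//.
  rewrite -nsqE (bigD1 i)//= big1 ?addr0; last first.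
    by move=> j ji; rewrite coord3Z coord3_basis eq_sym (negbTE ji) mulr0 expr0n.
  rewrite coord3Z coord3_basis eqxx mulr1.
  have mM : (m%:R : R) <= M%:R by rewrite ler_nat ltnW.
  have : 2 * d * m%:R <= 1.
    rewrite /d invfM mulrA divff ?pnatr_eq0// mul1r mulrC ler_pdivrMr ?mul1r//.
    by rewrite ltr0n.
  by move=> h1; rewrite expr_le1// !mulr_ge0// ltW.
- rewrite big1 ?indicE// => m _; rewrite indicE; case: (boolP (_ \in _)) => // /set_mem h.
  by case: noS; exists m.
Qed.

(** Each subtracted term dominates [f] on one bad set: large [|w|], values of [f] above [exp lam],
    and the strip, where otherwise [f <= kk]. There the bracket is nonpositive. On the remaining
    good set it is at most [f], and the kernel is bounded below. *)
Lemma ellipticity_pointwise p (f : R) v w xi i k (rho d lam kk : R) :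
  p < 0 -> 0 <= f -> i != k -> xi k != 0 -> 0 < rho -> 0 < d -> 0 < lam ->
  kk = expR lam ->
  d ^+ 2 * (2 * (1 + rho)) `^ p * bra v `^ p * xi k ^+ 2 *
  (f - f * nsq w / rho - (f * ln f + f * nsq w + env w) / lam -
    kk * \1_(strip v i k (xi i / xi k) rho d) w) <=
  nsq (v - w) `^ p * (coord3 (v - w) i * xi k - coord3 (v - w) k * xi i) ^+ 2 * f.
Proof.
move=> p0 f0 ik xik rho0 d0 lam0 kkE.
have rhs0 : 0 <= nsq (v - w) `^ p * (coord3 (v - w) i * xi k - coord3 (v - w) k * xi i) ^+ 2 * f.
  by apply: mulr_ge0 => //; apply: mulr_ge0; [exact: powR_ge0|exact: sqr_ge0].
set C := _ * _ * _ * xi k ^+ 2.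
have C0 : 0 <= C.
  apply: mulr_ge0; last exact: sqr_ge0.
  apply: mulr_ge0; last exact: powR_ge0.
  by apply: mulr_ge0; [exact: sqr_ge0|exact: powR_ge0].
have neg x : x <= 0 -> C * x <= nsq (v - w) `^ p *
    (coord3 (v - w) i * xi k - coord3 (v - w) k * xi i) ^+ 2 * f.
  by move=> x0; apply: le_trans rhs0; rewrite mulr_ge0_le0.
have E0 : 0 <= (f * ln f + f * nsq w + env w) / lam.
  by rewrite divr_ge0 ?entropy_ge// ltW.
have N0 : 0 <= f * nsq w / rho by rewrite divr_ge0 ?mulr_ge0 ?nsq_ge0// ltW.
have I0 : 0 <= kk * \1_(strip v i k (xi i / xi k) rho d) w :> R.
  by rewrite kkE mulr_ge0 ?expR_ge0.
have [wrho|wrho] := ltP rho (nsq w).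
  apply: neg; have : f <= f * nsq w / rho.
    by rewrite ler_pdivlMr// ler_wpM2l// ltW.
  lra.
have [fk|fk] := ltP kk f.
  apply: neg; have : f <= (f * ln f + f * nsq w + env w) / lam.
    rewrite ler_pdivlMr//.
    have : lam <= ln f.
      rewrite -[lam]expRK -kkE ler_ln ?posrE ?ltW//; first by rewrite kkE expR_gt0.
      by apply: lt_trans fk; rewrite kkE expR_gt0.
    move=> /(ler_wpM2l f0) h.
    have := mulr_ge0 f0 (nsq_ge0 w); have := env_ge0 w; lra.
  lra.
rewrite indicE in I0 *; case: (boolP (w \in _)) I0 => [_|wS] I0.
  by apply: neg; rewrite mulr1; lra.
rewrite mulr0 subr0; apply: (@le_trans _ _ (C * f)).
  by rewrite ler_wpM2l//; lra.
rewrite ler_wpM2r//.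
have dS : d <= `|coord3 (v - w) i - xi i / xi k * coord3 (v - w) k|.
  by rewrite leNgt; apply/negP => h; move/negP : wS; apply; apply/mem_set; split.
have n0 : 0 < nsq (v - w).
  rewrite lt_def nsq_ge0 andbT; apply/negP => /eqP n0.
  by move: dS; rewrite !(nsq_eq0_coord _ n0) mulr0 subr0 normr0 leNgt d0.
have nle : nsq (v - w) <= 2 * (1 + rho) * bra v.
  have := nsqD_le v (- w); rewrite nsqN => h; apply: (le_trans h).
  rewrite /bra; have := nsq_ge0 v => nv; have : 0 <= rho * nsq v by rewrite mulr_ge0// ltW.
  by lra.
have ple : (2 * (1 + rho)) `^ p * bra v `^ p <= nsq (v - w) `^ p.
  rewrite -powRM ?bra_ge0//; first by apply: powR_nonincr => //; exact: ltW.
  by rewrite mulr_ge0// addr_ge0// ltW.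
have sq : d ^+ 2 * xi k ^+ 2 <= (coord3 (v - w) i * xi k - coord3 (v - w) k * xi i) ^+ 2.
  rewrite [leRHS](_ : _ = (coord3 (v - w) i - xi i / xi k * coord3 (v - w) k) ^+ 2 * xi k ^+ 2); last by field.
  rewrite ler_wpM2r ?sqr_ge0// -[leRHS]real_normK ?num_real// lerXn2r ?nnegrE//.
  exact: ltW.
rewrite [leLHS](_ : _ = ((2 * (1 + rho)) `^ p * bra v `^ p) * (d ^+ 2 * xi k ^+ 2)); last by rewrite /C; ring.
apply: ler_pM => //; first by apply: mulr_ge0; exact: powR_ge0.
by apply: mulr_ge0; exact: sqr_ge0.
Qed.

(** [env] decays only polynomially, and of the entropy integrand only integrability has been shown,
    so linearity for [rapid] functions does not cover them. *)
Lemma int_lin3 (F G H : R3 R -> R) (a b : R) :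
  leb3.-integrable [set: R3 R] (EFin \o F) ->
  leb3.-integrable [set: R3 R] (EFin \o G) ->
  leb3.-integrable [set: R3 R] (EFin \o H) ->
  leb3.-integrable [set: R3 R] (EFin \o (fun w => F w + a * G w + b * H w)) /\
  \int[leb3]_w (F w + a * G w + b * H w) =
  \int[leb3]_w F w + a * \int[leb3]_w G w + b * \int[leb3]_w H w.
Proof.
move=> iF iG iH.
have iZ (c : R) (u : R3 R -> R) : leb3.-integrable [set: R3 R] (EFin \o u) ->
    leb3.-integrable [set: R3 R] (EFin \o (fun w => c * u w)).
  move=> iu; have := integrableZl measurableT c iu.
  by apply: eq_integrable => // w _; rewrite /= EFinM.
have iD (u u' : R3 R -> R) : leb3.-integrable [set: R3 R] (EFin \o u) ->
    leb3.-integrable [set: R3 R] (EFin \o u') ->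
    leb3.-integrable [set: R3 R] (EFin \o (fun w => u w + u' w)).
  move=> iu iu'; have := integrableD measurableT iu iu'.
  by apply: eq_integrable => // w _; rewrite /= EFinD.
split; first by apply: (iD); [apply: (iD) => //; exact: iZ|exact: iZ].
rewrite RintegralD//; [|by apply: iD => //; exact: iZ|exact: iZ].
rewrite RintegralD//; last exact: iZ.
by rewrite !RintegralZl.
Qed.

(** The form degenerates only where [v - w] is parallel to [xi]. Whatever [v] and [xi] are, a fixed
    share of the mass lies in a fixed ball, at moderate height and off a thin slab around that
    direction. [K] is fixed before [f]. *)
Lemma ellipticity (p m0 e0 H0 : R) : -1 < p -> p < 0 -> 0 < m0 ->
  exists2 K : R, 0 < K & forall f, rapid f -> (forall v, 0 <= f v) ->
  \int[leb3]_v f v = m0 -> \int[leb3]_v (f v * nsq v) = 2 * e0 ->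
  \int[leb3]_v (f v * ln (f v)) <= H0 ->
  forall v xi, K * bra v `^ p * \sum_(i < 3) xi i ^+ 2 <=
  \sum_(i < 3) \sum_(j < 3) conv (Aker p 0 i j) f v * (xi i * xi j).
Proof.
move=> p1 p0 m00.
pose cE := \int[leb3]_w (env w : R).
have cE0 : 0 <= cE by apply: int_ge0 => w; exact: env_ge0.
(* [rho], [lam] and [M] are chosen so that each of the three losses (energy far out, entropy at
   large values, measure of the strip) is at most [m0 / 4]. *)
pose rho := 8 * `|e0| / m0 + 1.
have rho0 : 0 < rho by rewrite ltr_wpDl// divr_ge0// ?mulr_ge0// ltW.
pose lam := 4 * (`|H0| + 2 * `|e0| + cE) / m0 + 1.
have lam0 : 0 < lam by rewrite ltr_wpDl// divr_ge0// ?mulr_ge0 ?addr_ge0 ?mulr_ge0// ltW.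
pose kk := expR lam.
pose B := \int[leb3]_w (\1_(nball (2 * (rho + 1))) w : R).
have B0 : 0 <= B by apply: int_ge0.
pose X := 4 * kk * B / m0.
have X0 : 0 <= X by rewrite /X divr_ge0 ?mulr_ge0 ?expR_ge0// ltW.
pose M := (Num.bound X).+1.
have XM : X <= M%:R.
  by apply: ltW; apply: lt_trans (archi_boundP X0) _; rewrite ltr_nat.
have M0 : 0 < M%:R :> R by rewrite ltr0n.
pose d : R := (2 * M%:R)^-1.
have d0 : 0 < d by rewrite invr_gt0 mulr_gt0.
pose c := d ^+ 2 * (2 * (1 + rho)) `^ p.
have c0 : 0 < c.
  by rewrite mulr_gt0 ?exprn_gt0// powR_gt0// mulr_gt0// addr_gt0.
(* The three losses leave [m0 / 4], and [max_coord] costs another factor 3. *)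
exists (c * m0 / 12); first by rewrite divr_gt0// mulr_gt0.
move=> f rf f0 mf ef Hf v xi.
have rA i j : rapid (fun w => Aker p 0 i j (v - w) * f w).
  by apply: conv_rapid => //; exact: Aker_slow.
have rAx i j : rapid (fun w => Aker p 0 i j (v - w) * f w * (xi i * xi j)).
  by apply: rapidMr => //; exact: slow_cst.
have RHS : \sum_(i < 3) \sum_(j < 3) conv (Aker p 0 i j) f v * (xi i * xi j) =
    \int[leb3]_w ((\sum_(i < 3) \sum_(j < 3) Aker p 0 i j (v - w) * (xi i * xi j)) * f w).
  rewrite [X in _ = Rintegral _ _ X](_ : _ = fun w => \sum_(i < 3) \sum_(j < 3)
    Aker p 0 i j (v - w) * f w * (xi i * xi j)); last first.
    apply/funext => w; rewrite mulr_suml; apply: eq_bigr => i _.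
    by rewrite mulr_suml; apply: eq_bigr => j _; rewrite mulrAC.
  rewrite (int_sum2 rAx); apply: eq_bigr => i _; apply: eq_bigr => j _.
  by rewrite RintegralZr//; exact: integrable_rapid.
have rR : rapid (fun w => (\sum_(i < 3) \sum_(j < 3) Aker p 0 i j (v - w) * (xi i * xi j)) * f w).
  rewrite (_ : (fun w => _) = fun w => \sum_(i < 3) \sum_(j < 3)
    Aker p 0 i j (v - w) * f w * (xi i * xi j)); first exact: rapid_sum2.
  apply/funext => w; rewrite mulr_suml; apply: eq_bigr => i _.
  by rewrite mulr_suml; apply: eq_bigr => j _; rewrite mulrAC.
have [k xik] := max_coord xi.
rewrite RHS.
have bp0 : 0 <= bra v `^ p := powR_ge0 _ _.
have [xk0|xk0] := eqVneq (xi k) 0.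
  apply: (@le_trans _ _ 0).
    apply: mulr_ge0_le0.
      by apply: mulr_ge0 => //; apply: divr_ge0 => //; exact/ltW/mulr_gt0.
    by apply: (le_trans xik); rewrite xk0 expr0n mulr0.
  by apply: int_ge0 => w; rewrite mulr_ge0// quad_formE mulr_ge0 ?powR_ge0 ?addr_ge0 ?sqr_ge0.
have [i ik] := exists_neq k.
pose S := strip v i k (xi i / xi k) rho d.
have rS : rapid (\1_S : R3 R -> R).
  by apply: (@rapid_indic _ rho); [exact: measurable_strip|exact: subIsetl].
have rfn : rapid (fun w => f w * nsq w) by apply: rapidMr => //; exact: slow_nsq.
pose C := d ^+ 2 * (2 * (1 + rho)) `^ p * bra v `^ p * xi k ^+ 2.
have C0 : 0 <= C.
  by apply: mulr_ge0; [apply: mulr_ge0 => //; exact: ltW|exact: sqr_ge0].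
pose F w := C * (f w - (rho^-1 + lam^-1) * (f w * nsq w) - kk * \1_S w).
have rF : rapid F.
  by apply: rapidZ; apply: rapidB; [apply: rapidB => //|]; exact: rapidZ.
have [iL eL] := int_lin3 (- (C / lam)) (- (C / lam)) (integrable_rapid rF) (integrable_entropy rf f0)
  (@integrable_env R).
have intF : \int[leb3]_w F w = C * (m0 - (rho^-1 + lam^-1) * (2 * e0) - kk * \int[leb3]_w (\1_S w : R)).
  rewrite /F intZ ?intB ?intZ ?mf ?ef//; [exact: rapidZ|apply: rapidB => //; exact: rapidZ|exact: rapidZ|].
  by apply: rapidB; [apply: rapidB => //|]; exact: rapidZ.
apply: (@le_trans _ _ (\int[leb3]_w (F w + - (C / lam) * (f w * ln (f w)) + - (C / lam) * env w))); last first.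
  apply: le_Rintegral => //; first exact: integrable_rapid.
  move=> w _.
  apply: (@le_trans _ _ (nsq (v - w) `^ p * (coord3 (v - w) i * xi k - coord3 (v - w) k * xi i) ^+ 2 * f w)); last first.
    by apply: ler_wpM2r => //; exact: quad_form_ge.
  apply: le_trans (ellipticity_pointwise v w p0 (f0 w) ik xk0 rho0 d0 lam0 (erefl kk)).
  rewrite -/S -/C /F le_eqVlt; apply/orP; left; apply/eqP.
  by field; rewrite !gt_eqF.
rewrite eL intF -/cE.
set I := \int[leb3]_w (\1_S w : R).
have Ib : kk * I <= m0 / 4.
  have := strip_packing v (xi i / xi k) rho ik (ltn0Sn (Num.bound X)).
  rewrite -/M -/d -/S -/I -/B => MI.
  have : X * I <= B.
    by apply: le_trans MI; rewrite ler_wpM2r//; apply: int_ge0.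
  have [B00|B00] := eqVneq B 0.
    have I0 : I <= 0 by rewrite -(ler_pM2l M0) mulr0 (le_trans MI)// B00.
    by move=> _; apply: (@le_trans _ _ 0); rewrite ?mulr_ge0_le0 ?expR_ge0// divr_ge0// ltW.
  have {B00}B00 : 0 < B by rewrite lt_def B00.
  rewrite /X mulrAC ler_pdivrMr// => h.
  rewrite ler_pdivlMr// -(ler_pM2l B00).
  by move: h; clear; lra.
have e1 : 2 * e0 / rho <= m0 / 4.
  rewrite ler_pdivrMr// /rho mulrDr mulr1.
  rewrite [X in _ <= X + _](_ : _ = 2 * `|e0|); last by field; rewrite gt_eqF.
  by move: m00 (ler_norm e0); clear; lra.
have e2 : (\int[leb3]_w (f w * ln (f w)) + 2 * e0 + cE) / lam <= m0 / 4.
  rewrite ler_pdivrMr// /lam mulrDr mulr1.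
  rewrite [X in _ <= X + _](_ : _ = `|H0| + 2 * `|e0| + cE); last by field; rewrite gt_eqF.
  by move: m00 Hf (ler_norm e0) (ler_norm H0); clear; lra.
rewrite [leRHS](_ : _ = C * (m0 - 2 * e0 / rho -
   (\int[leb3]_w (f w * ln (f w)) + 2 * e0 + cE) / lam - kk * I)); last first.
  by field; rewrite !gt_eqF.
apply: (@le_trans _ _ (C * (m0 / 4))); last by rewrite ler_wpM2l//; move: Ib e1 e2; clear; lra.
rewrite /C -/c.
have := ler_wpM2l (mulr_ge0 (ltW (mulr_gt0 c0 m00)) bp0) xik.
by clear; lra.
Qed.

End ellipticity.

(** * Hardy's inequality and the reaction term *)

Section weights.
Context {R : realType}.
Implicit Types (v w z : R3 R) (i : 'I_3).

Lemma isd_bra_powR i (s : R) :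
  isd i (fun v => bra v `^ s) (fun v => 2 * s * coord3 v i * bra v `^ (s - 1)).
Proof.
have N v : coord3 (- v) i = - coord3 v i by move: i; exact: ord3_ind.
apply: isd_eq (isd_pow i 0 s ltr01) _ _ => v; rewrite sub0r nsqN//.
by rewrite N -/(bra v); ring.
Qed.

Lemma bra_powR_le1 v (s : R) : s <= 0 -> bra v `^ s <= 1.
Proof.
move=> s0; have := @powR_nonincr _ s 1 (bra v) s0 ltr01 (bra_ge1 v).
by rewrite powR1.
Qed.

Lemma powR_pred (x s : R) : 0 < x -> x `^ (s - 1) = x `^ s * x^-1.
Proof.
by move=> x0; rewrite powRD ?(gt_eqF x0) ?implybT// powR_inv1// ltW.
Qed.

End weights.

(* Completing the squares 4 g_k + a S z_k and S z_k - 4 p B v_k. *)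
Lemma hardy_algebra (R : realFieldType) (p W B S a g0 g1 g2 z0 z1 z2 v0 v1 v2 : R) :
  -1 < p -> p < 0 -> 0 <= W -> W <= 1 ->
  (z0 ^+ 2 + z1 ^+ 2 + z2 ^+ 2) * (S * S) <= S ->
  (v0 ^+ 2 + v1 ^+ 2 + v2 ^+ 2) * (B * B) <= 1 ->
  W * a ^+ 2 * S <=
  8 * (W * (g0 ^+ 2 + g1 ^+ 2 + g2 ^+ 2)) + 8 * a ^+ 2 -
  2 *
  ((g0 * a + a * g0) * (W * (z0 * S)) +
   a * a *
   (2 * p * v0 * (W * B) * (z0 * S) +
    W * (-1 * S + z0 * - (2 * -1 * z0 * (S * S)))) +
   ((g1 * a + a * g1) * (W * (z1 * S)) +
    a * a *
    (2 * p * v1 * (W * B) * (z1 * S) +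
     W * (-1 * S + z1 * - (2 * -1 * z1 * (S * S))))) +
   ((g2 * a + a * g2) * (W * (z2 * S)) +
    a * a *
    (2 * p * v2 * (W * B) * (z2 * S) +
     W * (-1 * S + z2 * - (2 * -1 * z2 * (S * S)))))).
Proof.
move=> p1 p0 W0 W1 nQi nbi.
have p2 : p ^+ 2 <= 1 by rewrite expr2; nra.
have Wp : W * p ^+ 2 <= 1.
  by apply: (le_trans (ler_wpM2l W0 p2)); rewrite mulr1.
have Wa0 : 0 <= W * a ^+ 2 by rewrite mulr_ge0// sqr_ge0.
have hz (g z : R) := mulr_ge0 W0 (sqr_ge0 (4 * g - a * S * z)).
have hv (z x : R) := mulr_ge0 Wa0 (sqr_ge0 (S * z - 4 * p * B * x)).
have h1 := ler_wpM2l Wa0 nQi.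
have h2 := ler_wpM2l (mulr_ge0 Wa0 (sqr_ge0 p)) nbi.
have h3 := ler_wpM2l (sqr_ge0 a) Wp.
move: (hz g0 z0) (hz g1 z1) (hz g2 z2) (hv z0 v0) (hv z1 v1) (hv z2 v2) h1 h2 h3.
clear; lra.
Qed.

Section hardy.
Context {R : realType}.
Variables (p : R) (f : R3 R -> R) (d1 : 'I_3 -> R3 R -> R).
Hypotheses (p1 : -1 < p) (p0 : p < 0).
Hypotheses (rf : rapid f) (rd1 : forall i, rapid (d1 i)).
Hypotheses (df : forall i, isd i f (d1 i)).
Implicit Types (v w z : R3 R) (i : 'I_3).

Definition diss : R := \int[leb3]_v (bra v `^ p * \sum_(i < 3) d1 i v ^+ 2).
Definition L2sq : R := \int[leb3]_v (f v ^+ 2).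

Lemma rapid_diss : rapid (fun v => bra v `^ p * \sum_(i < 3) d1 i v ^+ 2).
Proof.
by apply: rapidMl; [exact: slow_bra_powR|apply: rapid_sum => i; exact: rapid_sqr].
Qed.

Lemma diss_ge0 : 0 <= diss.
Proof.
apply: int_ge0 => v; rewrite mulr_ge0 ?powR_ge0// sumr_ge0// => i _.
exact: sqr_ge0.
Qed.

Lemma L2sq_ge0 : 0 <= L2sq.
Proof. by apply: int_ge0 => v; exact: sqr_ge0. Qed.

Section fixed_center.
Variables (e : R) (w : R3 R).
Hypothesis e0 : 0 < e.

Let q v := e + nsq (w - v).
Let q0 v : 0 < q v. Proof. by rewrite ltr_pwDl// nsq_ge0. Qed.

Let slowq s : s <= 0 -> slow (fun v => q v `^ s).
Proof.
move=> s0.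
apply: (@slow_bounded _ _ (e `^ s)).
  apply: (measurableT_comp (measurable_powR s)); apply: measurable_funD => //.
  apply: (measurableT_comp measurable_nsq); exact: (measurable_fun_pair2 w measurable_sub3).
by move=> z; rewrite ger0_norm ?powR_ge0// powR_nonincr// lerDl nsq_ge0.
Qed.

Let slowz i : slow (fun v => coord3 (w - v) i).
Proof. exact: (slow2_slow w (slow2_sub (slow_coord i))). Qed.

(* The field f^2 (1 + |v|^2)^p (w - v) / (e + |w - v|^2), whose divergence is F'. *)
Let F i v := f v * f v * (bra v `^ p * (coord3 (w - v) i * q v `^ (- 1))).
Let F' i v := (d1 i v * f v + f v * d1 i v) * (bra v `^ p * (coord3 (w - v) i * q v `^ (- 1)))
  + f v * f v * (2 * p * coord3 v i * bra v `^ (p - 1) * (coord3 (w - v) i * q v `^ (- 1))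
    + bra v `^ p * (-1 * q v `^ (- 1) + coord3 (w - v) i * - (2 * -1 * coord3 (w - v) i * q v `^ (-1 - 1)))).

Let dF i : isd i (F i) (F' i).
Proof.
apply: isdM; first exact: isdM.
apply: isdM; first exact: isd_bra_powR.
apply: isdM; last exact: isd_pow.
by apply: isd_eq (isd_coordB i i w) _ _ => // v; rewrite eqxx.
Qed.

Let slowW s : slow (fun v : R3 R => bra v `^ s) := @slow_bra_powR R s.

Let N1 : -1 <= 0 :> R. Proof. by rewrite oppr_le0. Qed.
Let N2 : -1 - 1 <= 0 :> R. Proof. by rewrite subr_le0 (le_trans N1). Qed.

Let rff : rapid (fun v => f v * f v). Proof. by apply: rapidMl rf; exact: rapid_slow. Qed.

Let rF i : rapid (F i).
Proof.
by apply: rapidMr => //; apply: slowM => //; apply: slowM => //; exact: slowq.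
Qed.

Let rF' i : rapid (F' i).
Proof.
have szq : slow (fun v => coord3 (w - v) i * q v `^ (- 1)).
  by apply: slowM => //; exact: slowq.
apply: rapidD.
  apply: rapidMr; last exact: slowM.
  by apply: rapidD; apply: rapidMl => //; exact: rapid_slow.
apply: rapidMr => //; apply: slowD; apply: slowM => //.
  by apply: slowM => //; apply: slowM (slow_coord i); exact: slow_cst.
apply: slowD; apply: slowM => //; [exact: slow_cst|exact: slowq|apply: slowN].
by apply: slowM; [apply: slowM => //; exact: slow_cst|exact: slowq].
Qed.

(** The divergence of [(w - v) / q] is at most [- 1 / q], so [- 2] times the divergence of the field
    offers twice the left-hand side; one of the two copies pays for the cross terms with the
    gradients of [f] and of the weight. *)
Lemma hardy_pointwise v :
  bra v `^ p * f v ^+ 2 * q v `^ (- 1) <=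
  8 * (bra v `^ p * \sum_(i < 3) d1 i v ^+ 2) + 8 * f v ^+ 2 - 2 * \sum_(i < 3) F' i v.
Proof.
have Q0 := q0 v; set Q := q v in Q0 *.
have b0 := bra_gt0 v; have W0 : 0 <= bra v `^ p := powR_ge0 _ _.
have W1 : bra v `^ p <= 1 by apply: bra_powR_le1; exact: ltW.
have nQ : nsq (w - v) <= Q by rewrite /Q /q lerDr ltW.
have nb : nsq v <= bra v by exact: nsq_bra.
rewrite /F' -/Q !powR_pred// (powR_inv1 (ltW Q0)).
have Qi0 : 0 < Q^-1 by rewrite invr_gt0.
have bi0 : 0 < (bra v)^-1 by rewrite invr_gt0.
have bi1 : (bra v)^-1 <= 1 by rewrite invf_le1// bra_ge1.
have nQi : nsq (w - v) * (Q^-1 * Q^-1) <= Q^-1.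
  by rewrite mulrA ler_piMl ?(ltW Qi0)// ler_pdivrMr// mul1r.
have nbi : nsq v * ((bra v)^-1 * (bra v)^-1) <= 1.
  rewrite mulrA; apply: mulr_ile1 => //; first by rewrite mulr_ge0 ?nsq_ge0// ltW.
    exact: ltW.
  by rewrite ler_pdivrMr// mul1r.
rewrite !sum3E; rewrite -!nsqE !sum3E in nQi nbi.
set W := bra v `^ p in W0 W1 *; set B := (bra v)^-1 in bi0 bi1 nbi *.
set S := Q^-1 in Qi0 nQi *.
move: (f v) (d1 o0 v) (d1 o1 v) (d1 o2 v) => a g0 g1 g2.
set z0 := coord3 (w - v) o0 in nQi *; set z1 := coord3 (w - v) o1 in nQi *.
set z2 := coord3 (w - v) o2 in nQi *.
set v0 := coord3 v o0 in nbi *; set v1 := coord3 v o1 in nbi *.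
set v2 := coord3 v o2 in nbi *.
exact: hardy_algebra.
Qed.

Lemma hardy : \int[leb3]_v (bra v `^ p * f v ^+ 2 * q v `^ (- 1)) <= 8 * (diss + L2sq).
Proof.
have r1 : rapid (fun v => f v ^+ 2) by exact: rapid_sqr.
have r2 : rapid (fun v => \sum_(i < 3) F' i v) by exact: rapid_sum.
have r3 := rapid_diss.
have E : \int[leb3]_v (8 * (bra v `^ p * \sum_(i < 3) d1 i v ^+ 2) + 8 * f v ^+ 2 - 2 * \sum_(i < 3) F' i v) = 8 * (diss + L2sq).
  rewrite intB; [|by apply: rapidD; exact: rapidZ|exact: rapidZ].
  rewrite intD; [|exact: rapidZ|exact: rapidZ].
  rewrite !intZ//.
  rewrite int_sum// big1 ?mulr0 ?subr0 ?mulrDr// => i _.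
  exact: int_isd0 (dF i) (rF i) (rF' i).
rewrite -E; apply: le_int => [||v]; last exact: hardy_pointwise.
  apply: rapidMr; last exact: slowq.
  by apply: rapidMl.
by apply: rapidB; [apply: rapidD|]; exact: rapidZ.
Qed.

End fixed_center.

Definition Pker (e : R) z : R := (e + nsq z) `^ p.

Definition trilinear (e : R) : R := \int[leb3]_v (f v ^+ 2 * conv (Pker e) f v).

Lemma slow_Pker e : 0 < e -> slow (Pker e).
Proof. by move=> e0; apply: slow_pow_nsq => //; exact: ltW. Qed.

End hardy.

(* Split at e + |v - w|^2 = rho with rho^(p + 1) = delta (1 + |w|^2)^p: below rho
   the weights at v and w are comparable, above it the kernel is at most rho^p. *)
Lemma kernel_split (R : realType) (p e delta : R) (v w : R3 R) : -1 < p -> p < 0 ->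
  0 < e -> 0 < delta -> delta <= 1 ->
  (e + nsq (v - w)) `^ p <=
  4 * delta * (bra v `^ p * (e + nsq (v - w)) `^ (- 1)) +
  delta `^ (p / (p + 1)) * bra w `^ (p ^+ 2 / (p + 1)).
Proof.
move=> p1 p0 e0 d0 d1.
have pp : 0 < p + 1 by rewrite -ltrBlDr sub0r.
set n := e + nsq (v - w).
have n0 : 0 < n by rewrite ltr_pwDl// nsq_ge0.
pose Y := delta * bra w `^ p.
have Y0 : 0 < Y by rewrite mulr_gt0// powR_gt0// bra_gt0.
have Y1 : Y <= 1 by rewrite mulr_ile1 ?powR_ge0// ?(ltW d0)// bra_powR_le1// ltW.
pose rho := Y `^ (p + 1)^-1.
have rho0 : 0 < rho by exact: powR_gt0.
have E2 : rho `^ p = delta `^ (p / (p + 1)) * bra w `^ (p ^+ 2 / (p + 1)).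
  rewrite /rho -powRrM powRM ?powR_ge0// ?(ltW d0)// -powRrM.
  by congr (_ `^ _ * _ `^ _); field; rewrite gt_eqF.
have A0 : 0 <= 4 * delta * (bra v `^ p * n `^ (- 1)).
  by rewrite mulr_ge0 ?mulr_ge0 ?powR_ge0// ltW.
have B0 : 0 <= rho `^ p := powR_ge0 _ _.
rewrite -E2; have [nr|nr] := leP rho n.
  by rewrite ler_wpDl// powR_nonincr// ltW.
rewrite ler_wpDr// powR_inv1 ?(ltW n0)// mulrA ler_pdivlMr//.
have -> : n `^ p * n = n `^ (p + 1) by rewrite powRD ?(gt_eqF n0) ?implybT// powRr1// ltW.
have h1 : n `^ (p + 1) <= Y.
  have -> : Y = rho `^ (p + 1) by rewrite /rho -powRrM mulVf ?gt_eqF// powRr1// ltW.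
  by apply: powR_nondecr; exact: ltW.
apply: (le_trans h1); rewrite /Y -mulrA mulrCA ler_pM2l//.
have rho1 : rho <= 1.
  have := @powR_nondecr _ (p + 1)^-1 Y 1; rewrite powR1; apply => //; last exact: ltW.
  by rewrite invr_ge0 ltW.
(* Below the threshold [|v - w| < 1], so [bra (v - w) <= 2] and Peetre's inequality gives the factor
   4; raised to a power between [-1] and [0] it costs at most 4, the constant of the statement. *)
have bvw : bra v <= 4 * bra w.
  rewrite -[v](subrK w); apply: (le_trans (braD_le _ _)).
  have : bra (v - w) <= 2.
    by rewrite /bra; move: nr; rewrite /n => nr; lra.
  by have := bra_gt0 w; nra.
have h2 : (4 * bra w) `^ p <= bra v `^ p.
  by apply: powR_nonincr; rewrite ?bra_gt0// ltW.
rewrite powRM ?bra_ge0// in h2.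
have h4 : 4^-1 <= 4 `^ p :> R.
  rewrite -powR_inv1//; apply: ler_powR; rewrite ?ler1n// ltW//.
have bw := powR_ge0 (bra w) p.
have := ler_wpM2r bw h4.
move: h2; move: (bra v `^ p) => a; lra.
Qed.

(** * The collision term bounded by dissipation, [L2] norm and a moment *)

Section collision_bound.
Context {R : realType}.
Variables (p : R) (f : R3 R -> R) (d1 : 'I_3 -> R3 R -> R)
  (d2 : 'I_3 -> 'I_3 -> R3 R -> R).
Hypotheses (p1 : -1 < p) (p0 : p < 0).
Hypotheses (rf : rapid f) (rd1 : forall i, rapid (d1 i))
  (rd2 : forall i j, rapid (d2 i j)).
Hypotheses (df : forall i, isd i f (d1 i)) (dd1 : forall i j, isd i (d1 j) (d2 i j)).
Hypothesis f0 : forall v, 0 <= f v.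
Implicit Types (v w z : R3 R) (i j : 'I_3).

Let D := diss p d1.
Let y := L2sq f.
Let m := \int[leb3]_v f v.

Definition bra_moment (s : R) (g : R3 R -> R) : R := \int[leb3]_v (bra v `^ s * g v).

(** Fubini puts [f w] outside, so Hardy's inequality applies with [w] as centre, and [32 = 4 * 8]
    combines [kernel_split] and [hardy]. The weight in [w] has been shifted into the second term,
    which leaves the bare mass in front of [D]. *)
Lemma trilinear_bound e delta : 0 < e -> 0 < delta -> delta <= 1 ->
  trilinear p f e <= 32 * delta * (D + y) * m +
    delta `^ (p / (p + 1)) * y * bra_moment (p ^+ 2 / (p + 1)) f.
Proof.
move=> e0 d0 dle1; set sg := p ^+ 2 / (p + 1); set C := delta `^ _.
have C0 : 0 <= C := powR_ge0 _ _.
have rff := rapid_sqr rf.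
have sP := slow_Pker p0 e0.
have sP2 := slow2_sub sP.
rewrite /trilinear (int_swap sP2 rff rf).
have rM : rapid (fun w => bra w `^ sg * f w) by apply: rapidMl => //; exact: slow_bra_powR.
have sQ (w : R3 R) : rapid (fun v => bra v `^ p * f v ^+ 2 * (e + nsq (w - v)) `^ (-1)).
  apply: rapidMr; first by apply: rapidMl => //; exact: slow_bra_powR.
  have sq : slow (fun z => (e + nsq z) `^ (-1) : R) by apply: slow_pow_nsq => //; rewrite oppr_le0.
  exact: (slow2_slow w (slow2_sub sq)).
have inner (w : R3 R) : \int[leb3]_v (Pker p e (v - w) * f v ^+ 2) <=
    32 * delta * (D + y) + C * y * bra w `^ sg.
  have sPw : slow (fun v => Pker p e (v - w)) := slow2_slow w (slow2_swap sP2).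
  apply: (@le_trans _ _ (\int[leb3]_v (4 * delta * (bra v `^ p * f v ^+ 2 * (e + nsq (w - v)) `^ (-1))
      + C * bra w `^ sg * f v ^+ 2))).
    apply: le_int; [exact: rapidMl|by apply: rapidD; exact: rapidZ|move=> v].
    have := ler_wpM2r (sqr_ge0 (f v)) (kernel_split v w p1 p0 e0 d0 dle1).
    rewrite -/sg -/C -/(Pker p e (v - w)) nsqB => h; apply: (le_trans h).
    by rewrite le_eqVlt; apply/orP; left; apply/eqP; ring.
  rewrite intD; [|exact: rapidZ|exact: rapidZ]; rewrite !intZ//.
  have := hardy p1 p0 rf rd1 df w e0; rewrite -/D -/y => /(ler_wpM2l (mulr_ge0 (ler0n _ 4) (ltW d0))) h.
  rewrite [X in _ <= _ + X](_ : _ = C * bra w `^ sg * y); last by ring.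
  rewrite lerD2r; apply: (le_trans h); rewrite le_eqVlt; apply/orP; left; apply/eqP; ring.
apply: (@le_trans _ _ (\int[leb3]_w (32 * delta * (D + y) * f w + C * y * (bra w `^ sg * f w)))).
  apply: le_int.
  - apply: rapidMr => //; exact: (slow_int (slow2_swap sP2) rff).
  - by apply: rapidD; exact: rapidZ.
  - move=> w; apply: (le_trans (ler_wpM2l (f0 w) (inner w))).
    by rewrite le_eqVlt; apply/orP; left; apply/eqP; ring.
by rewrite intD; [rewrite !intZ|exact: rapidZ|exact: rapidZ].
Qed.

(** The diffusion part keeps the original kernel, to which ellipticity refers; only the reaction
    part is compared with the regularised one. The [3] is half of the [6] in [conv_A_bound]. *)
Lemma collision_bound K delta : 0 < delta -> delta <= 1 ->
  (forall v xi, K * bra v `^ p * \sum_(i < 3) xi i ^+ 2 <=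
    \sum_(i < 3) \sum_(j < 3) conv (Aker p 0 i j) f v * (xi i * xi j)) ->
  \int[leb3]_v (f v * \sum_(i < 3) \sum_(j < 3) dflux p f d1 d2 i j v) <=
  - (K * D) + 3 * (32 * delta * (D + y) * m +
    delta `^ (p / (p + 1)) * y * bra_moment (p ^+ 2 / (p + 1)) f).
Proof.
move=> d0 dle1 ell; set B := 32 * delta * _ * _ + _.
have pp : 0 < p + 1 by rewrite -ltrBlDr sub0r.
have sA0 i j : slow (Aker p 0 i j) by exact: Aker_slow.
have rff := rapid_sqr rf.
pose Z := \sum_(i < 3) \sum_(j < 3) \int[leb3]_w `|d2 i j w|.
have Z0 : 0 <= Z.
  by apply: sumr_ge0 => i _; apply: sumr_ge0 => j _; exact: int_ge0.
have y0 : 0 <= y := L2sq_ge0 f.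
have rS : rapid (fun v => \sum_(i < 3) \sum_(j < 3) conv (Aker p 0 i j) f v * (d1 i v * d1 j v)).
  apply: rapid_sum2 => i j; apply: rapidMl; first exact: conv_slow.
  by apply: rapidMl => //; exact: rapid_slow.
have rT : rapid (fun v => f v ^+ 2 * \sum_(i < 3) \sum_(j < 3) conv (Aker p 0 i j) (d2 i j) v).
  rewrite (_ : (fun v => _) = fun v => \sum_(i < 3) \sum_(j < 3) f v ^+ 2 * conv (Aker p 0 i j) (d2 i j) v).
    by apply: rapid_sum2 => i j; apply: rapidMr => //; exact: conv_slow.
  by apply/funext => v; rewrite mulr_sumr; apply: eq_bigr => i _; rewrite mulr_sumr.
(* The left-hand side does not depend on e, so the error e^(p + 1) can be sent to 0. *)
have main e : 0 < e -> \int[leb3]_v (f v * \sum_(i < 3) \sum_(j < 3) dflux p f d1 d2 i j v)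
   <= - (K * D) + 3 * B + e `^ (p + 1) * (2^-1 * y * Z).
  move=> e0; have e'0 : 0 <= e `^ (p + 1) := powR_ge0 _ _.
  rewrite (int_collision p1 p0 rf rd1 rd2 df dd1).
  have hD : K * D <= \int[leb3]_v (\sum_(i < 3) \sum_(j < 3) conv (Aker p 0 i j) f v * (d1 i v * d1 j v)).
    rewrite /D /diss -intZ; last exact: rapid_diss.
    apply: le_int => //; first by apply: rapidZ; exact: rapid_diss.
    by move=> v; rewrite mulrA; exact: (ell v (d1 ^~ v)).
  have hT : - (\int[leb3]_v (f v ^+ 2 * \sum_(i < 3) \sum_(j < 3) conv (Aker p 0 i j) (d2 i j) v)) <=
      6 * trilinear p f e + e `^ (p + 1) * Z * y.
    have sPc : slow (conv (Pker p e) f) by apply: conv_slow => //; exact: slow_Pker.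
    rewrite -intN// /trilinear /y /L2sq -!intZ//; last exact: rapidMr.
    rewrite -intD; [|by apply: rapidZ; exact: rapidMr|exact: rapidZ].
    apply: le_int; [exact: rapidN|by apply: rapidD; apply: rapidZ => //; exact: rapidMr|].
    move=> v; rewrite -mulrN [leRHS](_ : _ = f v ^+ 2 * (6 * conv (Pker p e) f v + e `^ (p + 1) * Z)); last by ring.
    rewrite ler_wpM2l ?sqr_ge0//.
    have := conv_A_bound p1 p0 rf rd1 rd2 df dd1 e0 v f0.
    suff : - (\sum_(i < 3) \sum_(j < 3) conv (Aker p 0 i j) (d2 i j) v) <=
        - (\sum_(i < 3) \sum_(j < 3) conv (Aker p e i j) (d2 i j) v) + e `^ (p + 1) * Z.
      by rewrite -/(Pker p e); move=> h1 h2; apply: (le_trans h1); rewrite lerD2r.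
    rewrite lerNl opprD opprK lerBlDr /Z mulr_sumr -big_split/=.
    apply: ler_sum => i _; rewrite mulr_sumr -big_split/=; apply: ler_sum => j _.
    have sAe : slow (Aker p e i j) by apply: Aker_slow => //; exact: ltW.
    have rn := rapid_norm (rd2 i j).
    rewrite -intZ// /conv -intD; [|exact: conv_rapid|exact: rapidZ].
    apply: le_int; [exact: conv_rapid|by apply: rapidD; [exact: conv_rapid|exact: rapidZ]|].
    move=> w; rewrite -lerBlDl -mulrBl.
    apply: (le_trans (ler_norm _)); rewrite normrM ler_wpM2r// distrC.
    exact: Aker_diff.
  have hB := trilinear_bound e0 d0 dle1; rewrite -/B in hB.
  move: hD hT hB; lra.
apply/ler_addgt0Pr => eta eta0.
pose c := 2^-1 * y * Z.
have c0 : 0 <= c by rewrite !mulr_ge0.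
(* For [e = x^(1/(p+1))] the error term equals [c x], which is at most [eta]. *)
pose x := (eta / (c + 1)).
have x0 : 0 < x by rewrite divr_gt0// ltr_wpDl.
have := main (x `^ (p + 1)^-1) (powR_gt0 _ x0).
rewrite -powRrM mulVf ?gt_eqF// powRr1 ?(ltW x0)// -/c => h; apply: (le_trans h).
rewrite lerD2l /x mulrAC ler_pdivrMr ?ltr_wpDl// ler_wpM2l ?(ltW eta0)//.
by rewrite lerDl.
Qed.

End collision_bound.

(** * A weighted Nash inequality *)

Section cauchy_schwarz.
Context d (T : measurableType d) (R : realType) (mu : {measure set T -> \bar R}).

Lemma int_cauchy_schwarz (a b : T -> R) :
  measurable_fun [set: T] a -> measurable_fun [set: T] b ->
  mu.-integrable [set: T] (fun x => (a x ^+ 2)%:E) ->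
  mu.-integrable [set: T] (fun x => (b x ^+ 2)%:E) ->
  mu.-integrable [set: T] (fun x => (a x * b x)%:E) /\
  (\int[mu]_x (a x * b x)) ^+ 2 <= \int[mu]_x (a x ^+ 2) * \int[mu]_x (b x ^+ 2).
Proof.
move=> ma mb ia ib.
have iab : mu.-integrable [set: T] (fun x => (a x * b x)%:E).
  have := integrableD measurableT ia ib; apply: le_integrable => //.
    by apply/measurable_EFinP; exact: measurable_funM.
  move=> x _ /=; rewrite lee_fin normrM [leRHS]ger0_norm ?addr_ge0 ?sqr_ge0//.
  have := sqr_ge0 (`|a x| - `|b x|).
  rewrite -(real_normK (num_real (a x))) -(real_normK (num_real (b x))).
  have := mulr_ge0 (normr_ge0 (a x)) (normr_ge0 (b x)); nra.
split => //.
set A := \int[mu]_x (a x ^+ 2); set B := \int[mu]_x (b x ^+ 2).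
set C := \int[mu]_x (a x * b x).
have A0 : 0 <= A by apply: Rintegral_ge0 => x _; exact: sqr_ge0.
have key (s t : R) : 0 <= s ^+ 2 * A - 2 * s * t * C + t ^+ 2 * B.
  have iZ (c : R) (u : T -> R) : mu.-integrable [set: T] (EFin \o u) ->
      mu.-integrable [set: T] (EFin \o (fun x => c * u x)).
    move=> iu; have := integrableZl measurableT c iu.
    by apply: eq_integrable => // x _; rewrite /= EFinM.
  have iB : mu.-integrable [set: T] (EFin \o (fun x => s ^+ 2 * a x ^+ 2 - 2 * s * t * (a x * b x))).
    have := integrableB measurableT (iZ (s ^+ 2) _ ia) (iZ (2 * s * t) _ iab).
    by apply: eq_integrable => // x _; rewrite /= EFinB.
  have : 0 <= \int[mu]_x (s * a x - t * b x) ^+ 2.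
    by apply: Rintegral_ge0 => x _; exact: sqr_ge0.
  rewrite (_ : (fun x => _) = fun x => (s ^+ 2 * a x ^+ 2 - 2 * s * t * (a x * b x)) + t ^+ 2 * b x ^+ 2).
    rewrite RintegralD//; last exact: iZ.
    by rewrite RintegralB ?RintegralZl//; exact: iZ.
  by apply/funext => x; ring.
have [A00|A00] := eqVneq A 0.
  have [->|C0] := eqVneq C 0; first by rewrite expr0n/= A00 mul0r.
  (* For [A = 0] the form is affine in [s]; this choice gives it the value [-1], a contradiction. *)
  have := key ((B + 1) / (2 * C)) 1; rewrite A00.
  have -> : ((B + 1) / (2 * C)) ^+ 2 * 0 - 2 * ((B + 1) / (2 * C)) * 1 * C + 1 ^+ 2 * B = -1.
    by field.
  by rewrite -(opprK 0) lerN2 oppr0 ler10.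
have {A00}A0 : 0 < A by rewrite lt_def A00.
have := key C A; rewrite (_ : _ + _ = A * (A * B - C ^+ 2)); last by ring.
by rewrite pmulr_rge0// subr_ge0.
Qed.

End cauchy_schwarz.

Section line.
Context {R : realType}.

(** The fundamental theorem of calculus on an interval reaching far to the left, where the decay
    makes the boundary value arbitrarily small. *)
Lemma integral_deriv_bound (phi phi' : R -> R) (C x : R) :
  (forall x : R, is_derive x 1 phi (phi' x)) -> continuous phi' ->
  (forall x, `|phi x| <= C * cauchy x) ->
  (`|phi x|%:E <= \int[lebesgue_measure]_x `|phi' x|%:E)%E.
Proof.
move=> dphi cphi' phiC.
have mphi' : measurable_fun [set: R] (fun x => `|phi' x|%:E).
  by apply/measurable_EFinP; apply: measurableT_comp => //; exact: continuous_measurable_fun.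
have step a : a < x -> (`|phi x - phi a|%:E <= \int[lebesgue_measure]_x `|phi' x|%:E)%E.
  move=> ax.
  have cphi : continuous phi.
    by move=> z; apply/differentiable_continuous/derivable1_diffP; exact: ex_derive.
  have := @continuous_FTC2 R phi' phi a x ax (continuous_subspaceT cphi').
  have dd : derivable_oo_LRcontinuous phi a x.
    split; first by move=> z _; exact: ex_derive.
    - exact/cvg_at_right_filter/cphi.
    - exact/cvg_at_left_filter/cphi.
  move=> /(_ dd) h.
  have {}h : (\int[lebesgue_measure]_(z in `[a, x]) (phi' z)%:E = (phi x)%:E - (phi a)%:E)%E.
    by apply: h => z _; rewrite derive1E; exact: derive_val.
  rewrite -[X in (X <= _)%E]/(`|(phi x - phi a)%:E|%E) EFinB -h.
  have mo : measurable_fun `[a, x] (fun z => (phi' z)%:E).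
    apply/measurable_EFinP; apply: measurable_funTS.
    exact: continuous_measurable_fun.
  apply: (le_trans (le_abse_integral lebesgue_measure (measurable_itv _) mo)).
  by apply: ge0_subset_integral.
apply/lee_addgt0Pr => eps eps0.
(* The first bound gives [a < x]; the second gives [1 + a^2 >= |C| / eps], hence a value at [a] of
   modulus at most [eps]. *)
pose a := Num.min (x - 1) (- (`|C| / eps + 1)).
have ax : a < x by rewrite gt_min ltrBlDr ltrDl ltr01.
have a1 : a <= - (`|C| / eps + 1) by rewrite ge_min lexx orbT.
have phia : `|phi a| <= eps.
  apply: (le_trans (phiC a)); apply: (le_trans (ler_norm _)).
  rewrite normrM (ger0_norm (cauchy_ge0 _)) /cauchy ler_pdivrMr; last by rewrite ltr_pwDl// sqr_ge0.
  have Ce : 0 <= `|C| / eps by rewrite divr_ge0// ltW.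
  have h : `|C| / eps <= 1 + a ^+ 2 by nra.
  by move: h; rewrite ler_pdivrMr// mulrC.
apply: (@le_trans _ _ (`|phi x - phi a|%:E + `|phi a|%:E)%E).
  by rewrite -EFinD lee_fin -[X in `|X| <= _](subrK (phi a)) ler_normD.
by apply: leeD; [exact: step|rewrite lee_fin].
Qed.

End line.

Section tonelli3.
Context {R : realType}.
Local Notation mR := (measurableTypeR R).
Local Open Scope ereal_scope.

Definition ins (i : 'I_3) (x : R) (s : R * R) : R3 R :=
  if i == o0 then (x, s.1, s.2) else if i == o1 then (s.1, x, s.2) else (s.1, s.2, x).

Definition proj (i : 'I_3) (v : R3 R) : R * R :=
  if i == o0 then (v.1.2, v.2) else if i == o1 then (v.1.1, v.2) else (v.1.1, v.1.2).

Lemma ins_proj i v : ins i (coord3 v i) (proj i v) = v.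
Proof. by case: v => [[a b] c]; move: i; exact: ord3_ind. Qed.

Lemma insE i x s : ins i x s = (ins i 0 s + x *: basis3 i)%R.
Proof.
move: i; apply: ord3_ind; rewrite /ins/=; congr (_, _, _) => /=;
  by rewrite /GRing.scale/= ?mulr0 ?mulr1 ?addr0 ?add0r.
Qed.

Lemma measurable_ins i : measurable_fun [set: mR * mR * mR] (fun t => ins i t.2 t.1).
Proof.
have m11 : measurable_fun [set: mR * mR * mR] (fun t => t.1.1) := measurable_coord3 o0.
have m12 : measurable_fun [set: mR * mR * mR] (fun t => t.1.2) := measurable_coord3 o1.
have m2 : measurable_fun [set: mR * mR * mR] (fun t => t.2) := measurable_coord3 o2.
by move: i; apply: ord3_ind; rewrite /ins/=; apply: measurable_fun_pair => //;
  exact: measurable_fun_pair.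
Qed.

(** By definition [leb3] integrates the last coordinate innermost. The other two cases exchange it
    with the first or second coordinate while the remaining one is frozen. *)
Lemma tonelli3 i (F : R3 R -> \bar R) : measurable_fun [set: R3 R] F ->
  (forall v, 0 <= F v) ->
  \int[leb3]_v F v = \int[leb2]_s \int[lebesgue_measure]_x F (ins i x s).
Proof.
move=> mF F0.
have mFi j : measurable_fun [set: mR * mR * mR] (fun t => F (ins j t.2 t.1)).
  exact: (measurableT_comp mF (measurable_ins j)).
pose leb := @lebesgue_measure R.
have mI j : measurable_fun [set: mR * mR] (fun s => \int[leb]_x F (ins j x s)).
  exact: (@measurable_fun_fubini_tonelli_F _ _ _ _ R leb (fun t : (mR * mR) * mR => F (ins j t.2 t.1)) (mFi j) (fun=> F0 _)).
have I0 j s : 0 <= \int[leb]_x F (ins j x s) by exact: integral_ge0.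
have E2 : \int[leb3]_v F v = \int[leb2]_s \int[leb]_x F (ins o2 x s).
  rewrite -(@fubini_tonelli1 _ _ _ _ R leb2 leb (fun t : (mR * mR) * mR => F (ins o2 t.2 t.1)) (mFi o2) (fun=> F0 _)).
  by apply: eq_integral => -[[a b] c] _.
have swap13 : forall y, \int[leb]_z \int[leb]_x F (x, y, z) = \int[leb]_x \int[leb]_z F (x, y, z).
  move=> y.
  have mG : measurable_fun [set: mR * mR] (fun s => F (s.1, y, s.2)).
    apply: (measurableT_comp mF); apply: measurable_fun_pair => //.
    by apply: measurable_fun_pair => //; exact: measurable_cst.
  by have := @fubini_tonelli _ _ _ _ R leb leb _ mG (fun=> F0 _) => /= ->.
have swap23 : forall x, \int[leb]_z \int[leb]_y F (x, y, z) = \int[leb]_y \int[leb]_z F (x, y, z).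
  move=> x.
  have mG : measurable_fun [set: mR * mR] (fun s => F (x, s.1, s.2)).
    apply: (measurableT_comp mF); apply: measurable_fun_pair => //.
    by apply: measurable_fun_pair => //; exact: measurable_cst.
  by have := @fubini_tonelli _ _ _ _ R leb leb _ mG (fun=> F0 _) => /= ->.
rewrite E2; move: i; apply: ord3_ind.
- rewrite /leb2 (@fubini_tonelli2 _ _ _ _ R leb leb _ (mI o2) (I0 o2)).
  rewrite (@fubini_tonelli1 _ _ _ _ R leb leb _ (mI o0) (I0 o0)).
  by apply: eq_integral => y _; rewrite /fubini_G /fubini_F/= -swap13.
- rewrite /leb2 (@fubini_tonelli1 _ _ _ _ R leb leb _ (mI o2) (I0 o2)).
  rewrite (@fubini_tonelli1 _ _ _ _ R leb leb _ (mI o1) (I0 o1)).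
  by apply: eq_integral => x _; rewrite /fubini_F/= -swap23.
- reflexivity.
Qed.

End tonelli3.

(** * The Loomis-Whitney inequality *)

Section loomis_whitney.
Context {R : realType}.
Local Notation mR := (measurableTypeR R).
Local Notation leb := (@lebesgue_measure R).

Lemma measurable_sqrt_comp d (T : measurableType d) (g : T -> R) :
  measurable_fun [set: T] g -> measurable_fun [set: T] (fun x => Num.sqrt (g x)).
Proof.
move=> mg; apply: (measurableT_comp (f := @Num.sqrt R)) => //.
by apply: continuous_measurable_fun; exact: sqrt_continuous.
Qed.

Variables (g : 'I_3 -> R * R -> R) (C : R).
Hypotheses (mg : forall i, measurable_fun [set: mR * mR] (g i))
  (g0 : forall i s, 0 <= g i s)
  (gC : forall i s, g i s <= C * (cauchy s.1 * cauchy s.2)).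

Let integrable_cauchyZ (c : R) : leb.-integrable [set: mR] (fun x => (c * cauchy x)%:E).
Proof.
have := integrableZl measurableT c (@integrable_cauchy R).
by apply: eq_integrable => // v _; rewrite EFinM.
Qed.

Lemma integrable_leb2_cauchy (h : R * R -> R) : measurable_fun [set: mR * mR] h ->
  (forall s, 0 <= h s <= C * (cauchy s.1 * cauchy s.2)) ->
  leb2.-integrable [set: mR * mR] (EFin \o h).
Proof.
move=> mh hC.
have := integrable_prodM (@integrable_cauchy R) (@integrable_cauchy R).
move=> /(integrableZl measurableT C); apply: le_integrable => //.
  exact/measurable_EFinP.
move=> s _; rewrite /= lee_fin; have /andP[h0 h1] := hC s.
by rewrite ger0_norm// (le_trans h1)// ler_norm.
Qed.

Let ig i : leb2.-integrable [set: mR * mR] (EFin \o g i).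
Proof. by apply: integrable_leb2_cauchy => // s; rewrite g0 gC. Qed.

Let alpha i (x : R) := \int[leb]_z g i (x, z).

Let mgx i x : measurable_fun [set: mR] (fun z => g i (x, z)).
Proof. exact: (measurable_fun_pair2 x (mg i)). Qed.

Let igx i x : leb.-integrable [set: mR] (EFin \o (fun z => g i (x, z))).
Proof.
apply: (le_integrable measurableT _ _ (integrable_cauchyZ (C * cauchy x))).
  by apply: measurableT_comp => //; exact: mgx.
move=> z _ /=; rewrite lee_fin ger0_norm// (le_trans (gC _ _))//=.
by rewrite mulrA ler_norm.
Qed.

Let alphaE i x : (\int[leb]_z (g i (x, z))%:E)%E = (alpha i x)%:E.
Proof.
by rewrite /alpha /Rintegral fineK//; apply: integrable_fin_num => //; exact: igx.
Qed.

Let alpha_ge0 i x : 0 <= alpha i x. Proof. exact: Rintegral_ge0. Qed.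

Let malpha i : measurable_fun [set: mR] (alpha i).
Proof.
apply/measurable_EFinP.
have mG : measurable_fun [set: mR * mR] (EFin \o g i) by apply/measurable_EFinP.
have := @measurable_fun_fubini_tonelli_F _ _ _ _ R leb _ mG (fun s => g0 i s).
by apply: eq_measurable_fun => x _; rewrite /= -alphaE.
Qed.

Let int_alpha i : (\int[leb]_x (alpha i x)%:E)%E = (\int[leb2]_s g i s)%:E.
Proof.
have mG : measurable_fun [set: mR * mR] (EFin \o g i) by apply/measurable_EFinP.
have := @fubini_tonelli1 _ _ _ _ R leb leb _ mG (fun s => g0 i s).
rewrite /fubini_F/= => h.
rewrite [RHS](_ : _ = \int[leb2]_s (g i s)%:E)%E.
  by rewrite /leb2 h; apply: eq_integral => x _; rewrite alphaE.
by rewrite /Rintegral fineK//; apply: integrable_fin_num => //; exact: ig.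
Qed.

(** [u^(3/2)] is at most the product of the roots of the three [g i]. Cauchy-Schwarz in [z] at fixed
    [(x, y)], where the factor from [g o2] is constant, then Cauchy-Schwarz in [(x, y)]. *)
Lemma loomis_whitney (u : R3 R -> R) : measurable_fun [set: R3 R] u ->
  (forall v, 0 <= u v) -> (forall i v, u v <= g i (proj i v)) ->
  (\int[leb3]_v (u v * Num.sqrt (u v)) ) ^+ 2 <=
  (\int[leb2]_s g o0 s) * (\int[leb2]_s g o1 s) * (\int[leb2]_s g o2 s).
Proof.
move=> mu u0 ug.
pose a i s := Num.sqrt (g i s).
have ma i : measurable_fun [set: mR * mR] (a i) by exact: measurable_sqrt_comp.
have a0 i s : 0 <= a i s by exact: sqrtr_ge0.
have a2 i s : a i s ^+ 2 = g i s by rewrite sqr_sqrtr.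
(* What the inner Cauchy-Schwarz leaves of the factors [g o0 (y, z)] and [g o1 (x, z)]: a product of
   functions of [x] and of [y], so its square integrates to a product. *)
pose b (s : R * R) := Num.sqrt (alpha o1 s.1) * Num.sqrt (alpha o0 s.2).
have mb : measurable_fun [set: mR * mR] b.
  apply: measurable_funM; apply: measurable_sqrt_comp.
  - exact: (measurableT_comp (malpha o1) (@measurable_fst _ _ mR mR)).
  - exact: (measurableT_comp (malpha o0) (@measurable_snd _ _ mR mR)).
have b2 s : b s ^+ 2 = alpha o1 s.1 * alpha o0 s.2.
  by rewrite exprMn !sqr_sqrtr.
have ialpha i : leb.-integrable [set: mR] (EFin \o alpha i).
  apply/integrableP; split; first by apply: measurableT_comp => //; exact: malpha.
  under eq_integral do rewrite /= ger0_norm//.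
  by rewrite int_alpha ltry.
have ib : leb2.-integrable [set: mR * mR] (fun s => (b s ^+ 2)%:E).
  have := integrable_prodM (ialpha o1) (ialpha o0).
  by apply: eq_integrable => // s _; rewrite b2.
have ia : leb2.-integrable [set: mR * mR] (fun s => (a o2 s ^+ 2)%:E).
  by have := ig o2; apply: eq_integrable => // s _; rewrite a2.
have [iab CS] := int_cauchy_schwarz (ma o2) mb ia ib.
have intb : \int[leb2]_s (b s ^+ 2) = (\int[leb2]_s g o0 s) * (\int[leb2]_s g o1 s).
  apply: EFin_inj; rewrite mulrC EFinM -!int_alpha.
  rewrite /Rintegral fineK; last by apply: integrable_fin_num.
  have mB : measurable_fun [set: mR * mR] (fun s => (b s ^+ 2)%:E).
    by apply/measurable_EFinP; exact: measurable_funX.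
  have := @fubini_tonelli1 _ _ _ _ R leb leb _ mB (fun s => sqr_ge0 (b s)).
  rewrite /leb2 => ->; rewrite /fubini_F/=.
  under eq_integral => x _.
    under eq_integral => y _ do rewrite b2/= EFinM.
    rewrite ge0_integralZl//; first over.
    - by apply: measurableT_comp => //; exact: malpha.
    - by move=> y _; rewrite lee_fin.
    - by rewrite lee_fin.
  rewrite ge0_integralZr//.
  - by apply: measurableT_comp => //; exact: malpha.
  - by move=> x _; rewrite lee_fin.
  - by apply: integral_ge0 => y _; rewrite lee_fin.
have ea2 : (fun s => a o2 s ^+ 2) = g o2 by apply/funext => s; exact: a2.
rewrite intb ea2 in CS.
rewrite mulrC; apply: le_trans CS.
have I0 : 0 <= \int[leb3]_v (u v * Num.sqrt (u v)).
  by apply: int_ge0 => v; rewrite mulr_ge0// sqrtr_ge0.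
have J0 : 0 <= \int[leb2]_s (a o2 s * b s).
  by apply: Rintegral_ge0 => s _; rewrite mulr_ge0// mulr_ge0// sqrtr_ge0.
rewrite lerXn2r ?nnegrE//.
pose h (v : R3 R) := a o0 (proj o0 v) * a o1 (proj o1 v) * a o2 (proj o2 v).
have mh : measurable_fun [set: R3 R] h.
  have m11 : measurable_fun [set: R3 R] (fun t => t.1.1) := measurable_coord3 o0.
  have m12 : measurable_fun [set: R3 R] (fun t => t.1.2) := measurable_coord3 o1.
  have m2 : measurable_fun [set: R3 R] (fun t => t.2) := measurable_coord3 o2.
  apply: measurable_funM; first apply: measurable_funM.
  - by apply: (measurableT_comp (ma o0)); exact: measurable_fun_pair.
  - by apply: (measurableT_comp (ma o1)); exact: measurable_fun_pair.
  - by apply: (measurableT_comp (ma o2)); exact: measurable_fun_pair.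
have h0 v : 0 <= h v by rewrite !mulr_ge0.
have uh v : u v * Num.sqrt (u v) <= h v.
  have s0 := sqrtr_ge0 (u v).
  have sle i : Num.sqrt (u v) <= a i (proj i v) by rewrite ler_sqrt.
  rewrite -[X in X * _](sqr_sqrtr (u0 v)) expr2 /h.
  by apply: ler_pM => //; exact: ler_pM.
have muu : measurable_fun [set: R3 R] (fun v => u v * Num.sqrt (u v)).
  by apply: measurable_funM => //; exact: measurable_sqrt_comp.
have key : (\int[leb3]_v (u v * Num.sqrt (u v))%:E <= (\int[leb2]_s (a o2 s * b s))%:E)%E.
  apply: (@le_trans _ _ (\int[leb3]_v (h v)%:E)%E).
    apply: ge0_le_integral => //.
    - by move=> v _; rewrite lee_fin mulr_ge0// sqrtr_ge0.
    - exact/measurable_EFinP.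
    - exact/measurable_EFinP.
    - by move=> v _; rewrite lee_fin.
  have mhE : measurable_fun [set: R3 R] (EFin \o h) by exact/measurable_EFinP.
  rewrite (tonelli3 o2 mhE) => [|v]; last by rewrite /= lee_fin.
  rewrite [leRHS](_ : _ = \int[leb2]_s (a o2 s * b s)%:E)%E; last first.
    by rewrite /Rintegral fineK//; exact: integrable_fin_num.
  have sqg i x : leb.-integrable [set: mR] (fun z => (a i (x, z) ^+ 2)%:E).
    by have := igx i x; apply: eq_integrable => // z _; rewrite a2.
  have max i x : measurable_fun [set: mR] (fun z => a i (x, z)).
    exact: (measurable_fun_pair2 x (ma i)).
  apply: ge0_le_integral => //.
  - by move=> s _; apply: integral_ge0 => z _; rewrite /= lee_fin.
  - have mFi : measurable_fun [set: mR * mR * mR] (fun t => (EFin \o h) (ins o2 t.2 t.1)).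
      exact: (measurableT_comp mhE (measurable_ins o2)).
    by apply: (@measurable_fun_fubini_tonelli_F _ _ _ _ R leb _ mFi) => t; rewrite /= lee_fin.
  - by apply/measurable_EFinP; apply: measurable_funM.
  move=> [x y] _.
  have [iaa CSz] := int_cauchy_schwarz (max o0 y) (max o1 x) (sqg o0 y) (sqg o1 x).
  have ea i t : (fun z => a i (t, z) ^+ 2) = (fun z => g i (t, z)).
    by apply/funext => z; exact: a2.
  rewrite !ea -/(alpha o0 y) -/(alpha o1 x) in CSz.
  have Iab : \int[leb]_z (a o0 (y, z) * a o1 (x, z)) <= b (x, y).
    rewrite -(@ler_pXn2r _ 2)// ?nnegrE.
    - by rewrite b2 mulrC.
    - by apply: Rintegral_ge0 => z _; rewrite mulr_ge0.
    - by rewrite mulr_ge0// sqrtr_ge0.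
  rewrite (_ : (\int[leb]_z _)%E = (a o2 (x, y) * \int[leb]_z (a o0 (y, z) * a o1 (x, z)))%:E).
    by rewrite lee_fin ler_wpM2l.
  rewrite -RintegralZl// /Rintegral fineK; last first.
    apply: integrable_fin_num => //.
    have := integrableZl measurableT (a o2 (x, y)) iaa.
    by apply: eq_integrable => // z _; rewrite /= EFinM.
  by apply: eq_integral => z _; rewrite /h/= mulrC.
have E0 : (0 <= \int[leb3]_v (u v * Num.sqrt (u v))%:E)%E.
  by apply: integral_ge0 => v _; rewrite lee_fin mulr_ge0// sqrtr_ge0.
have fin : (\int[leb3]_v (u v * Num.sqrt (u v))%:E)%E \is a fin_num.
  by rewrite ge0_fin_numE//; apply: (le_lt_trans key); rewrite ltry.
by rewrite -lee_fin; apply: le_trans key; rewrite /Rintegral fineK.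
Qed.

End loomis_whitney.

Lemma weighted_sqrD_le (R : realFieldType) (W a b c : R) :
  0 <= W -> W <= 1 -> a ^+ 2 <= c ->
  W * (2 * a + b) ^+ 2 <= 8 * (W * c) + 2 * b ^+ 2.
Proof.
move=> W0 W1 /(ler_wpM2l W0) h1; have h2 := mulr_ge0 W0 (sqr_ge0 (2 * a - b)).
have h3 := ler_wpM2l (sqr_ge0 b) W1; lra.
Qed.

(* Nash's inequality with weights: Gagliardo's inequality for u = f^2 (1 + |v|^2)^(p/2)
   bounds \int u^(3/2), and f^2 interpolates between u^(3/2) and f (1 + |v|^2)^(-3p/4). *)
Section nash.
Context {R : realType}.
Variables (p : R) (f : R3 R -> R) (d1 : 'I_3 -> R3 R -> R)
  (d2 : 'I_3 -> 'I_3 -> R3 R -> R).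
Hypotheses (p1 : -1 < p) (p0 : p < 0).
Hypotheses (rf : rapid f) (rd1 : forall i, rapid (d1 i)).
Hypotheses (df : forall i, isd i f (d1 i)) (dd1 : forall i j, isd i (d1 j) (d2 i j)).
Hypothesis f0 : forall v, 0 <= f v.
Local Notation mR := (measurableTypeR R).
Local Notation leb := (@lebesgue_measure R).

Let h := p / 2.
Let u v := f v * f v * bra v `^ h.
Let u' i v := (d1 i v * f v + f v * d1 i v) * bra v `^ h +
  f v * f v * (2 * h * coord3 v i * bra v `^ (h - 1)).

Let du i : isd i u (u' i).
Proof. by apply: isdM; [exact: isdM|exact: isd_bra_powR]. Qed.

Let rff : rapid (fun v => f v * f v). Proof. by apply: rapidMl rf; exact: rapid_slow. Qed.

Let ru : rapid u. Proof. by apply: rapidMr => //; exact: slow_bra_powR. Qed.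

Let ru' i : rapid (u' i).
Proof.
apply: rapidD; apply: rapidMr.
- by apply: rapidD; apply: rapidMl => //; exact: rapid_slow.
- exact: slow_bra_powR.
- by [].
- by apply: slowM (slow_bra_powR _); apply: slowM (slow_coord i); exact: slow_cst.
Qed.

(** The fundamental theorem of calculus asks for a continuous derivative along lines; the second
    derivatives of [f] provide it. *)
Let cu' i v : continuous (fun x : R => u' i (v + x *: basis3 i)).
Proof.
have [F dF] : exists F, isd i (u' i) F.
  eexists; apply: isdD; apply: isdM.
  - by apply: isdD; apply: isdM; [exact: (dd1 i i)|exact: df|exact: df|exact: (dd1 i i)].
  - exact: isd_bra_powR.
  - by apply: isdM; exact: df.
  - apply: isdM; last exact: isd_bra_powR.
    by apply: isdM; [exact: isd_cst|exact: isd_coord].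
move=> x; apply/differentiable_continuous/derivable1_diffP.
by have [] := isd_line dF v x.
Qed.

Let env_ins i x s : env (ins i x s) = cauchy x * (cauchy s.1 * cauchy s.2) :> R.
Proof. by move: i; apply: ord3_ind; rewrite /env /ins/=; ring. Qed.

Let g i (s : R * R) := \int[leb]_x `|u' i (ins i x s)|.

Let mu'ins i : measurable_fun [set: mR * mR * mR] (fun t => `|u' i (ins i t.2 t.1)|%:E).
Proof.
apply/measurable_EFinP; apply: measurableT_comp => //.
exact: (measurableT_comp (ru' i).1 (measurable_ins i)).
Qed.

Let bound i : exists2 C : R, 0 <= C & forall x s,
  `|u' i (ins i x s)| <= C * (cauchy s.1 * cauchy s.2) * cauchy x.
Proof.
have [C C0 uC] := rapid_env (ru' i); exists C => // x s.
by apply: (le_trans (uC _)); rewrite env_ins [cauchy x * _]mulrC -[leRHS]mulrA.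
Qed.

Let iline i s : leb.-integrable [set: mR] (EFin \o (fun x => `|u' i (ins i x s)|)).
Proof.
have [C C0 uC] := bound i.
have := integrableZl measurableT (C * (cauchy s.1 * cauchy s.2)) (@integrable_cauchy R).
apply: le_integrable => //; first exact: (measurable_fun_pair2 s (mu'ins i)).
move=> x _; rewrite /= lee_fin normr_id (le_trans (uC x s))// ler_norm//.
Qed.

Let gE i s : (\int[leb]_x `|u' i (ins i x s)|%:E)%E = (g i s)%:E.
Proof. by rewrite /g /Rintegral fineK//; apply: integrable_fin_num => //; exact: iline. Qed.

Let int_g i : \int[leb2]_s g i s = \int[leb3]_v `|u' i v|.
Proof.
have m' : measurable_fun [set: R3 R] (fun v => `|u' i v|%:E).
  by apply/measurable_EFinP; apply: measurableT_comp => //; exact: (ru' i).1.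
rewrite [RHS]/Rintegral (tonelli3 i m')//.
by congr fine; apply: eq_integral => s _; rewrite gE.
Qed.

(** Since [|v_i| / (1 + |v|^2) <= 1/2] and [|2 h| <= 2], differentiating the weight costs at most a
    factor 1, so [|u'| <= f b]; Cauchy-Schwarz separates [f] from [b], whose square is controlled by
    the two densities in [P]. *)
Let e_bound i : (\int[leb3]_v `|u' i v|) ^+ 2 <= L2sq f * (8 * diss p d1 + 2 * L2sq f).
Proof.
have h0 : h < 0 by rewrite /h pmulr_llt0// invr_gt0.
pose b v := (2 * `|d1 i v| + f v) * bra v `^ h.
have rb : rapid b.
  apply: rapidMr; last exact: slow_bra_powR.
  by apply: rapidD => //; apply: rapidZ; exact: rapid_norm.
have [iab CS] := @int_cauchy_schwarz _ _ R leb3 f b rf.1 rb.1 (integrable_rapid (rapid_sqr rf))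
  (integrable_rapid (rapid_sqr rb)).
have rfb : rapid (fun v => f v * b v) by apply: rapidMl => //; exact: rapid_slow.
have ub v : `|u' i v| <= f v * b v.
  have b0 := bra_gt0 v; have W0 : 0 <= bra v `^ h := powR_ge0 _ _.
  rewrite /u' /b powR_pred//.
  have vb : `|coord3 v i / bra v| <= 2^-1.
    rewrite normrM (gtr0_norm (x := _^-1)) ?invr_gt0// ler_pdivrMr//.
    have := coord_sqr_le v i; rewrite -real_normK ?num_real// /bra.
    have := sqr_ge0 (`|coord3 v i| - 1); rewrite sqrrB1 => h1 h2.
    by rewrite -mulr_natr in h1; lra.
  rewrite (_ : _ + _ = (2 * d1 i v + f v * (2 * h * (coord3 v i / bra v))) * (f v * bra v `^ h)); last by ring.
  rewrite normrM [`|f v * _|]ger0_norm ?mulr_ge0// [leRHS]mulrCA [X in _ <= X]mulrC [leRHS]mulrC.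
  rewrite [leRHS](_ : _ = (2 * `|d1 i v| + f v) * (f v * bra v `^ h)); last by ring.
  rewrite ler_wpM2r ?mulr_ge0//.
  apply: (le_trans (ler_normD _ _)); rewrite lerD//; first by rewrite normrM ger0_norm.
  rewrite normrM ger0_norm// ler_piMr// normrM.
  have h2 : `|2 * h| <= 2.
    by rewrite normrM (ger0_norm (x := 2))// ltr0_norm// /h; move: p1; lra.
  apply: (le_trans (ler_pM (normr_ge0 _) (normr_ge0 _) h2 vb)).
  by rewrite divff.
have r' := rapid_norm (ru' i).
have I1 : \int[leb3]_v `|u' i v| <= \int[leb3]_v (f v * b v) by exact: le_int.
have I0 : 0 <= \int[leb3]_v `|u' i v| by exact: int_ge0.
apply: (@le_trans _ _ ((\int[leb3]_v (f v * b v)) ^+ 2)).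
  by rewrite lerXn2r ?nnegrE// (le_trans I0).
apply: (le_trans CS); rewrite -/(L2sq f) ler_wpM2l ?L2sq_ge0//.
have rD := rapid_diss p rd1.
rewrite /diss /L2sq -(intZ 8 rD) -(intZ 2 (rapid_sqr rf)).
have r8 := rapidZ 8 rD; have r2 := rapidZ 2 (rapid_sqr rf).
rewrite -intD//; apply: le_int; [exact: rapid_sqr|exact: rapidD|move=> v].
have W0 : 0 <= bra v `^ p := powR_ge0 _ _.
have W1 : bra v `^ p <= 1 by apply: bra_powR_le1; exact: ltW.
have Wh : (bra v `^ h) ^+ 2 = bra v `^ p.
  by rewrite -powR_mulrn ?powR_ge0// -powRrM; congr (_ `^ _); rewrite /h; field.
rewrite /b exprMn Wh mulrC.
have hd : `|d1 i v| ^+ 2 <= \sum_(i < 3) d1 i v ^+ 2.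
  rewrite real_normK ?num_real// (bigD1 i)//= lerDl sumr_ge0// => k _; exact: sqr_ge0.
exact: weighted_sqrD_le.
Qed.

(** With [E_i] the integral of [|u' i|], the chain is [y^2 <= U M], [U^2 <= E_0 E_1 E_2] and
    [E_i^2 <= y P]; hence [y^8 <= (y P)^3 M^4], and [y^3] cancels. *)
Lemma nash : L2sq f ^+ 5 <=
  (8 * diss p d1 + 2 * L2sq f) ^+ 3 * bra_moment (- (3 * p / 4)) f ^+ 4.
Proof.
set y := L2sq f; set P := 8 * _ + _; set M := bra_moment _ f.
have y0 : 0 <= y := L2sq_ge0 f.
have P0 : 0 <= P by rewrite addr_ge0 ?mulr_ge0 ?diss_ge0.
have M0 : 0 <= M by apply: int_ge0 => v; rewrite mulr_ge0 ?powR_ge0.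
have u0 v : 0 <= u v by rewrite !mulr_ge0 ?powR_ge0.
pose cI := \int[leb]_x cauchy x.
have ieq : (\int[leb]_x (cauchy x)%:E)%E = cI%:E.
  rewrite /cI /Rintegral fineK//; apply: integrable_fin_num => //; exact: integrable_cauchy.
have [C0 C00 uC0] := bound o0; have [C1 C10 uC1] := bound o1; have [C2 C20 uC2] := bound o2.
pose C := C0 + C1 + C2.
have uC i x s : `|u' i (ins i x s)| <= C * (cauchy s.1 * cauchy s.2) * cauchy x.
  have cc : 0 <= cauchy s.1 * cauchy s.2 * cauchy x by rewrite !mulr_ge0 ?cauchy_ge0.
  rewrite -mulrA; move: i; apply: ord3_ind.
  - by apply: (le_trans (uC0 _ _)); rewrite -mulrA ler_wpM2r// /C; lra.
  - by apply: (le_trans (uC1 _ _)); rewrite -mulrA ler_wpM2r// /C; lra.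
  - by apply: (le_trans (uC2 _ _)); rewrite -mulrA ler_wpM2r// /C; lra.
have gC i s : g i s <= C * cI * (cauchy s.1 * cauchy s.2).
  rewrite (_ : C * cI * _ = \int[leb]_x (C * (cauchy s.1 * cauchy s.2) * cauchy x)); last first.
    by rewrite RintegralZl//; [rewrite mulrAC|exact: integrable_cauchy].
  apply: le_Rintegral => //.
  have := integrableZl measurableT (C * (cauchy s.1 * cauchy s.2)) (@integrable_cauchy R).
  by apply: eq_integrable => // x _; rewrite /= EFinM.
have g0 i s : 0 <= g i s by apply: Rintegral_ge0.
have mg i : measurable_fun [set: mR * mR] (g i).
  apply/measurable_EFinP.
  have := @measurable_fun_fubini_tonelli_F _ _ _ _ R leb _ (mu'ins i) (fun=> normr_ge0 _).
  by apply: eq_measurable_fun => s _; rewrite /fubini_F/= gE.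
have ug i v : u v <= g i (proj i v).
  pose s := proj i v.
  have dphi (x : R) : is_derive x 1 (fun x => u (ins i x s)) (u' i (ins i x s)).
    have := isd_line (du i) (ins i 0 s) x; rewrite -insE.
    by rewrite (_ : (fun x => _) = fun x => u (ins i x s))//; apply/funext => z; rewrite -insE.
  have cphi : continuous (fun x => u' i (ins i x s)).
    have := @cu' i (ins i 0 s).
    by rewrite (_ : (fun x => _) = fun x => u' i (ins i x s))//; apply/funext => z; rewrite -insE.
  have [B B0 uB] := rapid_env ru.
  have phiC x : `|u (ins i x s)| <= B * (cauchy s.1 * cauchy s.2) * cauchy x.
    by apply: (le_trans (uB _)); rewrite env_ins [cauchy x * _]mulrC -[leRHS]mulrA.
  have := integral_deriv_bound (coord3 v i) dphi cphi phiC.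
  by rewrite gE lee_fin /s ins_proj ger0_norm.
pose U := \int[leb3]_v (u v * Num.sqrt (u v)).
have LW : U ^+ 2 <= (\int[leb3]_v `|u' o0 v|) * (\int[leb3]_v `|u' o1 v|) *
    (\int[leb3]_v `|u' o2 v|).
  by rewrite -!int_g; exact: (loomis_whitney mg g0 gC ru.1 u0 ug).
have su v : Num.sqrt (u v) = f v * bra v `^ (p / 4).
  rewrite /u (_ : bra v `^ h = bra v `^ (p / 4) ^+ 2); last first.
    by rewrite -powR_mulrn ?powR_ge0// -powRrM; congr (_ `^ _); rewrite /h; field.
  by rewrite -expr2 -exprMn sqrtr_sqr ger0_norm// mulr_ge0 ?powR_ge0.
(* [u^(3/2) = f^3 bra^(3p/4)], so multiplying it by the integrand of [M] cancels the weights and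
   gives [f^4], the square of [f^2]. *)
have yUM : y ^+ 2 <= U * M.
  pose a v := Num.sqrt (u v * Num.sqrt (u v)).
  pose b v := Num.sqrt (bra v `^ (- (3 * p / 4)) * f v).
  have ruu : rapid (fun v => u v * Num.sqrt (u v)).
    rewrite (_ : (fun v => _) = fun v => u v * (f v * bra v `^ (p / 4))).
      by apply: rapidMr ru _; apply: slowM; [exact: rapid_slow|exact: slow_bra_powR].
    by apply/funext => v; rewrite su.
  have rM : rapid (fun v => bra v `^ (- (3 * p / 4)) * f v).
    by apply: rapidMl => //; exact: slow_bra_powR.
  have ma : measurable_fun [set: R3 R] a by apply: measurable_sqrt_comp; exact: ruu.1.
  have mb : measurable_fun [set: R3 R] b by apply: measurable_sqrt_comp; exact: rM.1.
  have ea : (fun v => a v ^+ 2) = (fun v => u v * Num.sqrt (u v)).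
    by apply/funext => v; rewrite /a sqr_sqrtr// mulr_ge0// sqrtr_ge0.
  have eb : (fun v => b v ^+ 2) = (fun v => bra v `^ (- (3 * p / 4)) * f v).
    by apply/funext => v; rewrite /b sqr_sqrtr// mulr_ge0// powR_ge0.
  have ia : leb3.-integrable [set: R3 R] (fun v => (a v ^+ 2)%:E).
    have := integrable_rapid ruu; apply: eq_integrable => // v _ /=.
    by rewrite -[RHS]/(((fun v => a v ^+ 2) v)%:E) ea.
  have ib : leb3.-integrable [set: R3 R] (fun v => (b v ^+ 2)%:E).
    have := integrable_rapid rM; apply: eq_integrable => // v _ /=.
    by rewrite -[RHS]/(((fun v => b v ^+ 2) v)%:E) eb.
  have [_ CS] := @int_cauchy_schwarz _ _ R leb3 a b ma mb ia ib.
  rewrite ea eb -/U -/(bra_moment _ f) -/M in CS.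
  apply: le_trans CS; rewrite le_eqVlt; apply/orP; left; apply/eqP; congr (_ ^+ 2).
  apply: eq_Rintegral => v _; rewrite /a /b -sqrtrM; last by rewrite mulr_ge0// sqrtr_ge0.
  have b0 := bra_gt0 v.
  rewrite su (_ : u v * (f v * bra v `^ (p / 4)) * (bra v `^ (- (3 * p / 4)) * f v) = (f v ^+ 2) ^+ 2).
    by rewrite sqrtr_sqr ger0_norm ?sqr_ge0.
  have E : bra v `^ h * bra v `^ (p / 4) * bra v `^ (- (3 * p / 4)) = 1.
    rewrite -!powRD ?(gt_eqF b0) ?implybT// (_ : _ + _ + _ = 0) ?powRr0//.
    by rewrite /h; field.
  rewrite /u [LHS](_ : _ = f v ^+ 4 * (bra v `^ h * bra v `^ (p / 4) * bra v `^ (- (3 * p / 4)))); last by ring.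
  by rewrite E mulr1 -exprM.
have U0 : 0 <= U by apply: int_ge0 => v; rewrite mulr_ge0// sqrtr_ge0.
have e0 i : 0 <= \int[leb3]_v `|u' i v| by exact: int_ge0.
have := e_bound o0; have := e_bound o1; have := e_bound o2; rewrite -/y -/P.
move: LW (e0 o0) (e0 o1) (e0 o2).
set E0 := Rintegral _ _ _; set E1 := Rintegral _ _ _; set E2 := Rintegral _ _ _.
move=> LW E00 E10 E20 h2 h1 h0'.
have [->|yn0] := eqVneq y 0; first by rewrite expr0n/= mulr_ge0 ?exprn_ge0.
have {yn0}yp : 0 < y by rewrite lt_def yn0.
have yP0 : 0 <= y * P by exact: mulr_ge0.
have H1 : y ^+ 8 <= (U * M) ^+ 4.
  by rewrite -[8%N]/(2 * 4)%N exprM lerXn2r ?nnegrE ?sqr_ge0 ?mulr_ge0.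
have H2 : U ^+ 4 <= (y * P) ^+ 3.
  rewrite -[4%N]/(2 * 2)%N exprM.
  apply: (@le_trans _ _ ((E0 * E1 * E2) ^+ 2)).
    by rewrite lerXn2r ?nnegrE ?sqr_ge0 ?mulr_ge0.
  rewrite !exprMn [leRHS](_ : _ = y * P * (y * P) * (y * P)); last by rewrite !exprS expr0; ring.
  by apply: ler_pM; rewrite ?mulr_ge0 ?sqr_ge0//; apply: ler_pM; rewrite ?sqr_ge0.
have H3 : y ^+ 8 <= (y * P) ^+ 3 * M ^+ 4.
  by apply: (le_trans H1); rewrite exprMn ler_wpM2r ?exprn_ge0.
rewrite -(@ler_pM2l _ (y ^+ 3)) ?exprn_gt0//.
by rewrite -exprD mulrA -exprMn.
Qed.

End nash.

(** * Moment interpolation and the differential inequality *)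

Section static.
Context {R : realType}.
Implicit Types (f : R3 R -> R) (p : R).

Lemma bra_moment_interpolation (f : R3 R -> R) (nu s m c N : R) : rapid f -> (forall v, 0 <= f v) ->
  0 < nu -> 0 <= s -> s <= nu -> 1 <= N -> \int[leb3]_v f v = m ->
  bra_moment nu f <= c * N -> bra_moment s f <= (m + c) * N `^ (s / nu).
Proof.
move=> rf f0 nu0 s0 snu N1 mf Mc.
have N0 : 0 < N by exact: lt_le_trans N1.
(* Balances the contributions of bra v <= L and bra v > L. *)
pose L := N `^ nu^-1; have L0 : 0 < L by exact: powR_gt0.
have Ls : L `^ s = N `^ (s / nu) by rewrite /L -powRrM mulrC.
have Lsn : L `^ (s - nu) = N `^ (s / nu) * N^-1.
  rewrite /L -powRrM mulrBr mulVf ?gt_eqF// -(powR_inv1 (ltW N0)) -powRD ?(gt_eqF N0) ?implybT//.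
  by rewrite mulrC.
have pw (v : R3 R) : bra v `^ s <= L `^ s + L `^ (s - nu) * bra v `^ nu.
  have b0 := bra_gt0 v.
  have [bL|bL] := leP (bra v) L.
    by rewrite ler_wpDr ?mulr_ge0 ?powR_ge0// powR_nondecr// ltW.
  rewrite ler_wpDl ?powR_ge0// [X in X <= _](_ : _ = bra v `^ (s - nu) * bra v `^ nu).
    by rewrite ler_wpM2r ?powR_ge0// powR_nonincr ?subr_le0// ltW.
  by rewrite -powRD ?subrK// (gt_eqF b0) implybT.
have rM (r : R) : rapid (fun v => bra v `^ r * f v).
  by apply: rapidMl => //; exact: slow_bra_powR.
apply: (@le_trans _ _ (\int[leb3]_v (L `^ s * f v + L `^ (s - nu) * (bra v `^ nu * f v)))).
  apply: le_int => //; first by apply: rapidD; exact: rapidZ.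
  by move=> v; rewrite mulrA -mulrDl ler_wpM2r.
rewrite intD; [|exact: rapidZ|exact: rapidZ].
rewrite !intZ// mf Ls Lsn -/(bra_moment nu f).
have h0 : 0 <= N `^ (s / nu) * N^-1 by rewrite mulr_ge0 ?powR_ge0// invr_ge0 ltW.
have := ler_wpM2l h0 Mc.
rewrite [X in _ <= X](_ : _ = N `^ (s / nu) * c); last by field; rewrite gt_eqF.
by lra.
Qed.

(** If the right-hand side were below [y], both summands would be. The cube of the first times the
    square of the second would then be less than [y^5], against the hypothesis; the exponent [- 3/2]
    makes the powers of [eta] cancel in that product. *)
Lemma nash_young (y P M eta : R) : 0 <= P -> 0 <= M -> 0 < eta ->
  y ^+ 5 <= P ^+ 3 * M ^+ 4 -> y <= eta * P + eta `^ (- (3 / 2)) * M ^+ 2.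
Proof.
move=> P0 M0 eta0 H; rewrite leNgt; apply/negP => h.
set th := eta `^ _ in h.
have th0 : 0 < th by exact: powR_gt0.
have thE : th ^+ 2 * eta ^+ 3 = 1.
  rewrite /th -!powR_mulrn ?powR_ge0 ?(ltW eta0)// -powRrM.
  rewrite -powRD ?(gt_eqF eta0) ?implybT// (_ : _ + _ = 0) ?powRr0//.
  by field.
have a0 : 0 <= eta * P by rewrite mulr_ge0// ltW.
have b0 : 0 <= th * M ^+ 2 by rewrite mulr_ge0 ?sqr_ge0// ltW.
have ay : eta * P < y by apply: le_lt_trans h; rewrite lerDl.
have bY : th * M ^+ 2 < y by apply: le_lt_trans h; rewrite lerDr.
have y0 : 0 < y by exact: le_lt_trans ay.
have : (eta * P) ^+ 3 * (th * M ^+ 2) ^+ 2 < y ^+ 3 * y ^+ 2.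
  apply: (@le_lt_trans _ _ ((eta * P) ^+ 3 * y ^+ 2)).
    by rewrite ler_wpM2l ?exprn_ge0// lerXn2r ?nnegrE ?(ltW y0) ?(ltW bY).
  by rewrite ltr_pM2r ?exprn_gt0// ltrXn2r.
rewrite -exprD (_ : _ * _ = (th ^+ 2 * eta ^+ 3) * (P ^+ 3 * M ^+ 4)); last by ring.
by rewrite thE mul1r => /lt_le_trans/(_ H); rewrite ltxx.
Qed.

(** The estimate at one fixed time, with [N] in the role of [1 + t]; [C] is chosen before [N] and
    [f]. The moment exponent is [mu / 2], as [bra] is a square. *)
Lemma static_bound (p m0 e0 H0 c : R) : -1 < p -> p < 0 -> 0 < m0 ->
  exists2 C : R, 0 <= C & forall (N : R) (f : R3 R -> R) (d1 : 'I_3 -> R3 R -> R)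
    (d2 : 'I_3 -> 'I_3 -> R3 R -> R), 1 <= N ->
  rapid f -> (forall i, rapid (d1 i)) -> (forall i j, rapid (d2 i j)) ->
  (forall i, isd i f (d1 i)) -> (forall i j, isd i (d1 j) (d2 i j)) ->
  (forall v, 0 <= f v) ->
  \int[leb3]_v f v = m0 -> \int[leb3]_v (f v * nsq v) = 2 * e0 ->
  \int[leb3]_v (f v * ln (f v)) <= H0 ->
  bra_moment (- (2 * p * (3 - 2 * p)) / (3 * (1 + p))) f <= c * N ->
  \int[leb3]_v (f v * \sum_(i < 3) \sum_(j < 3) dflux p f d1 d2 i j v) <= C * N.
Proof.
move=> p1 p0 m00; have [K K0 ell] := ellipticity e0 H0 p1 p0 m00.
have pp : 0 < 1 + p by move: p1; lra.
set nu := - (2 * p * (3 - 2 * p)) / (3 * (1 + p)).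
have nu0 : 0 < nu.
  by rewrite divr_gt0// ?mulr_gt0// oppr_gt0 pmulr_llt0 ?pmulr_rlt0//; move: p0; lra.
pose sg := p ^+ 2 / (p + 1); pose tau := - (3 * p / 4).
have pp' : 0 < p + 1 by rewrite addrC.
have sg0 : 0 <= sg by rewrite divr_ge0 ?sqr_ge0// ltW.
have tau0 : 0 <= tau by rewrite /tau; move: p0; lra.
(* Clearing positive denominators leaves [p^2 - 6 p >= 0] here and [- p (15 - 25 p) >= 0] in the
   next claim; both follow from [p < 0]. *)
have sgnu : sg <= nu.
  rewrite /sg /nu (addrC p) ler_pdivrMr// mulrAC ler_pdivlMr ?mulr_gt0//.
  have : 0 <= p ^+ 2 - 6 * p by have := sqr_ge0 p; move: p0; lra.
  by move=> h; have := mulr_ge0 (ltW pp) h; lra.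
have taunu : tau <= nu.
  rewrite /tau /nu ler_pdivlMr ?mulr_gt0//.
  have : 0 <= - p * (15 - 25 * p) by rewrite mulr_ge0//; move: p0; lra.
  by lra.
pose c1 := m0 + `|c|.
have c10 : 0 < c1 by rewrite ltr_pwDl.
pose a := sg / nu; pose b := tau / nu.
have a0 : 0 <= a by rewrite divr_ge0// ltW.
(* The choice of the moment makes this exponent smaller than 1. *)
have abE : 5 / 2 * a + 2 * b = 3 / 4.
  rewrite /a /b /sg /tau /nu; field.
  by rewrite ?(gt_eqF pp) ?(gt_eqF pp') ?(lt_eqF p0)//=; rewrite gt_eqF//; move: p0; lra.
(* Makes [96 delta m0] at most [K / 2]: half of the dissipation survives, and the price is
   [(K / 2) y]. *)
pose delta := Num.min 1 (K / (192 * m0)).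
have delta0 : 0 < delta by rewrite lt_min ltr01 divr_gt0// mulr_gt0.
have delta1 : delta <= 1 by rewrite ge_min lexx.
have deltaK : 192 * m0 * delta <= K.
  have : delta <= K / (192 * m0) by rewrite ge_min lexx orbT.
  by rewrite ler_pdivlMr ?mulr_gt0// mulrC.
pose cd := delta `^ (p / (p + 1)).
have cd0 : 0 <= cd := powR_ge0 _ _.
(* Since [1 <= N^a], all remaining terms in [y] together are at most [A N^a y]. *)
pose A := K / 2 + 3 * cd * c1.
have A0 : 0 < A by rewrite ltr_pwDl ?divr_gt0// !mulr_ge0// ltW.
(* [kap <= 1/4] lets the [y] inside [P] be absorbed on the left; the other bound gives
   [16 A kap <= K / 2], so the surviving dissipation absorbs [A N^a y]. *)
pose kap := Num.min (1 / 4) (K / (32 * A)).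
have kap0 : 0 < kap by rewrite lt_min !divr_gt0// mulr_gt0.
have kap4 : kap <= 1 / 4 by rewrite ge_min lexx.
have kapK : 32 * A * kap <= K.
  have : kap <= K / (32 * A) by rewrite ge_min lexx orbT.
  by rewrite ler_pdivlMr ?mulr_gt0// mulrC.
pose C := 2 * A * kap `^ (- (3 / 2)) * c1 ^+ 2.
have C0 : 0 <= C by rewrite !mulr_ge0 ?powR_ge0// ltW.
exists C => // N f d1 d2 N1 rf rd1 rd2 df dd1 f0 mf ef Hf Mc.
have N0 : 0 < N by exact: lt_le_trans N1.
have Mc' : bra_moment nu f <= `|c| * N.
  by apply: (le_trans Mc); rewrite ler_wpM2r ?ler_norm// ltW.
have Msg := bra_moment_interpolation rf f0 nu0 sg0 sgnu N1 mf Mc'.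
have Mtau := bra_moment_interpolation rf f0 nu0 tau0 taunu N1 mf Mc'.
rewrite -/c1 -/a in Msg; rewrite -/c1 -/b in Mtau.
have coll := collision_bound p1 p0 rf rd1 rd2 df dd1 f0 delta0 delta1 (ell f rf f0 mf ef Hf).
rewrite mf -/sg -/cd in coll.
set D := diss p d1 in coll; set y := L2sq f in coll.
have D0 : 0 <= D := diss_ge0 p d1.
have y0 : 0 <= y := L2sq_ge0 f.
have Ny := nash p1 p0 rf rd1 df dd1 f0.
rewrite -/D -/y -/tau in Ny.
have Mtau0 : 0 <= bra_moment tau f by apply: int_ge0 => v; rewrite mulr_ge0 ?powR_ge0.
have P0 : 0 <= 8 * D + 2 * y by rewrite addr_ge0 ?mulr_ge0.
have Na1 : 1 <= N `^ a by rewrite -(powRr0 N) ler_powR.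
pose eta := kap * N `^ (- a).
have eta0 : 0 < eta by rewrite mulr_gt0// powR_gt0.
have eta4 : eta <= 1 / 4.
  apply: le_trans kap4; rewrite /eta ler_piMr ?(ltW kap0)//.
  by rewrite -(powRr0 N) ler_powR// oppr_le0.
have yle := nash_young P0 Mtau0 eta0 Ny.
set T := _ * bra_moment tau f ^+ 2 in yle.
have yle2 : y <= 16 * eta * D + 2 * T.
  have := ler_wpM2r y0 eta4; move: yle; clear; lra.
have NaE : N `^ a * eta = kap.
  by rewrite /eta mulrCA -powRD ?(gt_eqF N0) ?implybT// subrr powRr0 mulr1.
(* The exponents are [a], then [3a/2] from [eta^(-3/2)], then [2b] from the squared moment; their
   sum [3/4] is rounded up to 1. *)
have TN : N `^ a * T <= kap `^ (- (3 / 2)) * c1 ^+ 2 * N.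
  have cN : 0 <= c1 * N `^ b by rewrite mulr_ge0 ?powR_ge0// ltW.
  have M2 : bra_moment tau f ^+ 2 <= (c1 * N `^ b) ^+ 2 by rewrite lerXn2r ?nnegrE.
  have h1 : T <= eta `^ (- (3 / 2)) * (c1 * N `^ b) ^+ 2.
    by rewrite /T ler_wpM2l ?powR_ge0.
  apply: (le_trans (ler_wpM2l (powR_ge0 _ _) h1)).
  rewrite /eta powRM ?powR_ge0 ?(ltW kap0)// exprMn.
  rewrite [leLHS](_ : _ = kap `^ (- (3 / 2)) * c1 ^+ 2 * (N `^ a * (N `^ (- a)) `^ (- (3 / 2)) * N `^ b ^+ 2)); last by ring.
  rewrite ler_wpM2l ?(mulr_ge0 (powR_ge0 _ _) (sqr_ge0 _))//.
  rewrite -powR_mulrn ?powR_ge0// -!powRrM -!powRD ?(gt_eqF N0) ?implybT//.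
  rewrite -[leRHS]powRr1 ?(ltW N0)//; apply: ler_powR => //.
  by clear -abE; lra.
have h1 : N `^ a * y <= 16 * kap * D + 2 * (kap `^ (- (3 / 2)) * c1 ^+ 2 * N).
  have Nage0 : 0 <= N `^ a := powR_ge0 _ _.
  have := ler_wpM2l Nage0 yle2.
  have -> : N `^ a * (16 * eta * D + 2 * T) = 16 * (N `^ a * eta) * D + 2 * (N `^ a * T).
    by ring.
  by rewrite NaE => h; apply: (le_trans h); rewrite lerD2l ler_wpM2l.
have h2 : 3 * (cd * y * bra_moment sg f) <= 3 * (cd * c1) * (N `^ a * y).
  have := ler_wpM2l (mulr_ge0 cd0 y0) Msg; clear; lra.
have h3 : K / 2 * y <= K / 2 * (N `^ a * y).
  by rewrite ler_wpM2l ?divr_ge0 ?(ltW K0)// ler_peMl.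
have h4 := ler_wpM2l (ltW A0) h1.
have h5 := ler_wpM2r D0 deltaK; have h6 := ler_wpM2r y0 deltaK.
have h7 := ler_wpM2r D0 kapK.
apply: (le_trans coll); rewrite /C.
move: h2 h3 h4 h5 h6 h7; rewrite /A.
clear; move=> *; lra.
Qed.

End static.

(** * Evolution of the L2 norm *)

Section time.
Context {R : realType}.
Implicit Types (f : R -> R3 R -> R) (t u : R).

Lemma schwartz_quotient_cvg (q : R -> R3 R -> R) (n : nat) t (A : set R) :
  seminorm n [::] (q u) @[u --> within A (nbhs t)] --> 0%E ->
  forall eps : R, 0 < eps -> exists2 d : R, 0 < d &
    forall u v, A u -> `|u - t| < d -> japanese v ^+ n * `|q u v| <= eps.
Proof.
move=> qcvg eps eps0.
have nb : nbhs (0%E : \bar R) [set x | (x < eps%:E)%E].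
  by apply: open_nbhs_nbhs; split; [exact: open_ereal_lt_ereal|rewrite /= lte_fin].
have /nbhs_ballP[d /= d0 dP] := qcvg _ nb.
exists d => // u v Au ut; rewrite -lee_fin.
have /= := dP u; rewrite /ball/= distrC => /(_ ut Au) h.
by apply: le_trans (ltW h); apply: ereal_sup_ubound; exists v.
Qed.

Lemma time_quotient f : C1_schwartz f -> exists f' : R -> R3 R -> R,
  [/\ forall t, 0 <= t -> schwartz (f t), forall t, 0 <= t -> schwartz (f' t) &
   forall t, 0 <= t -> forall eps : R, 0 < eps -> exists2 d : R, 0 < d &
    forall u v, 0 <= u -> u != t -> `|u - t| < d ->
      `|(f u v - f t v) / (u - t) - f' t v| * bra v ^+ 3 <= eps].
Proof.
move=> [f' [sf sf' qf _]]; exists f'; split => // t t0 eps eps0.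
(* Order six in the Japanese bracket is order three in [bra], just enough for domination by
   [env]. *)
have [d d0 dP] := schwartz_quotient_cvg (qf t 6%N [::] t0) eps0.
exists d => // u v u0 ut utd; have := dP u v (conj u0 ut) utd.
by rewrite -[6%N]/(2 * 3)%N exprM japanese_sqr mulrC.
Qed.

Lemma env_le1 (v : R3 R) : env v <= 1.
Proof.
have c1 (x : R) : cauchy x <= 1 by rewrite invf_le1 ?ltr_pwDl ?sqr_ge0// lerDl sqr_ge0.
by rewrite !mulr_ile1 ?mulr_ge0 ?cauchy_ge0.
Qed.

(** With [rho] the remainder of the difference quotient, the error is the integral of
    [2 rho g + (u - t) (g' + rho)^2], where [|rho| <= eta env] and [|u - t| < eta]; [A] bounds this
    integral divided by [eta]. *)
Lemma L2sq_quotient f (f' : R -> R3 R -> R) t :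
  (forall t, 0 <= t -> schwartz (f t)) -> (forall t, 0 <= t -> schwartz (f' t)) ->
  (forall eps : R, 0 < eps -> exists2 d : R, 0 < d &
    forall u v, 0 <= u -> u != t -> `|u - t| < d ->
      `|(f u v - f t v) / (u - t) - f' t v| * bra v ^+ 3 <= eps) ->
  0 <= t -> forall eps : R, 0 < eps -> exists2 d : R, 0 < d &
    forall u, 0 <= u -> u != t -> `|u - t| < d ->
    `|(L2sq (f u) - L2sq (f t)) / (u - t) - 2 * \int[leb3]_v (f t v * f' t v)| <= eps.
Proof.
move=> sf sf' qf t0 eps eps0.
have rf s : 0 <= s -> rapid (f s) by move=> s0; exact: (schwartz_rapid [::] (sf s s0)).
have rf' : rapid (f' t) := schwartz_rapid [::] (sf' t t0).
set g := f t; set g' := f' t in rf' *.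
have rg : rapid g := rf t t0.
pose cE := \int[leb3]_v (env v : R).
pose A := 2 * \int[leb3]_v `|g v| + 2 * \int[leb3]_v (g' v ^+ 2) + 2 * cE.
have A0 : 0 <= A.
  rewrite !addr_ge0 ?mulr_ge0 ?int_ge0// => v; first exact: sqr_ge0.
  exact: env_ge0.
pose eta := Num.min 1 (eps / (A + 1)).
have A1 : 0 < A + 1 by rewrite ltr_wpDl.
have eta0 : 0 < eta by rewrite lt_min ltr01 divr_gt0.
have eta1 : eta <= 1 by rewrite ge_min lexx.
have etaA : eta * A <= eps.
  have : eta <= eps / (A + 1) by rewrite ge_min lexx orbT.
  rewrite ler_pdivlMr// => h; apply: le_trans h.
  by rewrite ler_pM2l// lerDl.
have [d d0 dP] := qf _ eta0.
exists (Num.min d eta); first by rewrite lt_min d0.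
move=> u u0 ut; rewrite lt_min => /andP[utd uteta].
have ru := rf u u0.
have ut0 : u - t != 0 by rewrite subr_eq0.
pose rho v := (f u v - g v) / (u - t) - g' v.
have rrho : rapid rho.
  apply: rapidB => //; apply: rapidMr; last exact: slow_cst.
  exact: rapidB.
have rhole v : `|rho v| <= eta * env v.
  have := dP u v u0 ut utd; rewrite -/(rho v) => h.
  apply: le_trans (ler_wpM2r (env_ge0 v) h).
  by rewrite -mulrA [_ ^+ 3 * _]mulrC ler_peMr// bra_env.
have rho1 v : `|rho v| <= eta.
  by apply: (le_trans (rhole v)); rewrite ler_piMr ?env_le1// ltW.
have fu v : f u v = g v + (u - t) * (g' v + rho v).
  by rewrite /rho; field.
pose S v := 2 * (rho v * g v) + (u - t) * (g' v + rho v) ^+ 2.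
have r1 : rapid (fun v => rho v * g v) by apply: rapidMl => //; exact: rapid_slow.
have r2 : rapid (fun v => (g' v + rho v) ^+ 2) by apply: rapid_sqr; exact: rapidD.
have rS : rapid S by apply: rapidD; exact: rapidZ.
have E : (L2sq (f u) - L2sq g) / (u - t) - 2 * \int[leb3]_v (g v * g' v) = \int[leb3]_v S v.
  have r3 : rapid (fun v => g v * g' v) by apply: rapidMl => //; exact: rapid_slow.
  rewrite /L2sq -intB; [|exact: rapid_sqr|exact: rapid_sqr].
  rewrite (_ : (fun v => f u v ^+ 2 - g v ^+ 2) = fun v => (u - t) * (S v + 2 * (g v * g' v))).
    rewrite intZ; last by apply: rapidD => //; exact: rapidZ.
    rewrite intD//; last exact: rapidZ.
    by rewrite intZ//; field.
  by apply/funext => v; rewrite fu /S; ring.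
rewrite E; apply: (le_trans (le_normr_Rintegral _ (integrable_rapid rS))) => //.
apply: le_trans etaA.
have rA : rapid (fun v => 2 * `|g v| + 2 * g' v ^+ 2).
  by apply: rapidD; apply: rapidZ; [exact: rapid_norm|exact: rapid_sqr].
have iE : leb3.-integrable [set: R3 R] (EFin \o (fun v => 2 * env v : R)) := integrable_envZ 2.
rewrite (_ : eta * A = \int[leb3]_v (eta * ((2 * `|g v| + 2 * g' v ^+ 2) + 2 * env v))); last first.
  have iA := integrable_rapid rA.
  rewrite RintegralZl//; last first.
    have := integrableD measurableT iA iE.
    by apply: eq_integrable => // v _; rewrite /= -EFinD.
  rewrite RintegralD// intD; [|by apply: rapidZ; exact: rapid_norm|by apply: rapidZ; exact: rapid_sqr].
  rewrite (intZ 2 (rapid_norm rg)) (intZ 2 (rapid_sqr rf')).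
  by rewrite RintegralZl//; exact: integrable_env.
apply: le_Rintegral => //.
- exact: (integrable_rapid (rapid_norm rS)).
- have := integrableZl measurableT eta (integrableD measurableT (integrable_rapid rA) iE).
  by apply: eq_integrable => // v _; rewrite /= -EFinD -EFinM.
move=> v _; apply: (le_trans (ler_normD _ _)).
rewrite mulrDr mulrDr -addrA; apply: lerD.
  by rewrite !normrM (ger0_norm (x := 2))// [leRHS]mulrCA ler_wpM2l// ler_wpM2r.
rewrite -mulrDr normrM (ger0_norm (x := _ ^+ 2)) ?sqr_ge0//.
apply: ler_pM; rewrite ?sqr_ge0//; first exact: ltW.
have h1 : rho v ^+ 2 <= env v.
  rewrite -real_normK ?num_real// expr2.
  apply: (@le_trans _ _ (eta * (eta * env v))).
    by apply: ler_pM.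
  by rewrite mulrA ler_piMl ?env_ge0// mulr_ile1// ltW.
have := sqr_ge0 (g' v - rho v); move: h1; lra.
Qed.

End time.

(** * From the equation to quadratic growth *)

Section solution.
Context {R : realType}.
Implicit Types (f : R -> R3 R -> R) (t u : R) (i j : 'I_3).

Lemma landau_fluxE (gamma : R) (g : R3 R -> R) i j : -2 < gamma -> gamma < 0 ->
  schwartz g ->
  landau_flux gamma g i j = flux (gamma / 2) g (fun k => iter_partial [:: k] g) i j.
Proof.
move=> g2 g0 sg; apply/funext => v.
have p1 : -1 < gamma / 2 by lra.
have p0 : gamma / 2 < 0 by lra.
have sK : slow (Aker (gamma / 2) 0 i j) by exact: Aker_slow.
have r0 : rapid g := schwartz_rapid [::] sg.
have r1 : rapid (iter_partial [:: j] g) := schwartz_rapid [:: j] sg.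
have c0 := conv_rapid v sK r0; have c1 := conv_rapid v sK r1.
rewrite /flux /conv [X in X - _]mulrC -(intZ _ c0) -(intZ _ c1) -intB; [|exact: rapidZ|exact: rapidZ].
apply: eq_Rintegral => w _; rewrite (landau_kernelE i j (v - w) g2 g0) /=; ring.
Qed.

Lemma landau_operatorE (gamma : R) (g : R3 R -> R) v : -2 < gamma -> gamma < 0 ->
  schwartz g ->
  landau_operator gamma g v = \sum_(i < 3) \sum_(j < 3)
    dflux (gamma / 2) g (fun k => iter_partial [:: k] g)
      (fun k l => iter_partial [:: k; l] g) i j v.
Proof.
move=> g2 g0 sg; apply: eq_bigr => i _; apply: eq_bigr => j _.
have p1 : -1 < gamma / 2 by lra.
have p0 : gamma / 2 < 0 by lra.
rewrite landau_fluxE//.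
have := @isd_flux R (gamma / 2) g (fun k => iter_partial [:: k] g)
  (fun k l => iter_partial [:: k; l] g) p1 p0 (schwartz_rapid [::] sg)
  (fun k => schwartz_rapid [:: k] sg) (fun k l => schwartz_rapid [:: k; l] sg)
  (fun k => schwartz_isd [::] k sg) (fun k l => schwartz_isd [:: l] k sg) i j v.
by move=> ?; exact: derive_val.
Qed.

Lemma Lnorm2_sqr (g : R3 R -> R) : rapid g ->
  ('N[leb3]_2%:E[EFin \o g] ^+ 2 = (L2sq g)%:E)%E.
Proof.
move=> rg; rewrite unlock /=.
have -> : (\int[leb3]_x (`|(g x)%:E| `^ 2) = (L2sq g)%:E)%E.
  rewrite -eint_rapid; last exact: rapid_sqr.
  apply: eq_integral => v _; rewrite poweR_EFin powR_mulrn//.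
  by rewrite real_normK ?num_real.
by rewrite poweR_EFin powR12_sqrt ?L2sq_ge0// -EFinM -expr2 sqr_sqrtr// L2sq_ge0.
Qed.

(** The mean value theorem for [L2sq (f t) - C (1 + t)^2], whose derivative is nonpositive for
    positive times; at time 0 only one-sided continuity enters, obtained from boundedness of the
    quotients. *)
Lemma L2sq_growth f (f' : R -> R3 R -> R) (C : R) :
  (forall t, 0 <= t -> forall eps : R, 0 < eps -> exists2 d : R, 0 < d &
    forall u, 0 <= u -> u != t -> `|u - t| < d ->
    `|(L2sq (f u) - L2sq (f t)) / (u - t) - 2 * \int[leb3]_v (f t v * f' t v)| <= eps) ->
  (forall t, 0 < t -> \int[leb3]_v (f t v * f' t v) <= C * (1 + t)) ->
  forall t, 0 <= t -> L2sq (f t) <= L2sq (f 0) + C * ((1 + t) ^+ 2 - 1).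
Proof.
move=> q bnd T T0.
pose Y t := L2sq (f t).
pose z t := Y t - C * (1 + t) ^+ 2.
pose L t := 2 * \int[leb3]_v (f t v * f' t v).
have dY t : 0 < t -> is_derive t 1 Y (L t).
  move=> t0; apply/is_derive_cvgP; apply/cvgrPdist_le => eps eps0.
  have [d d0 dP] := q t (ltW t0) eps eps0.
  (* Increments below [t] keep [h + t] in the time domain, where the quotient estimate holds. *)
  have m0 : 0 < Num.min d t by rewrite lt_min d0.
  near=> h.
  have h0 : h != 0 by near: h; exact: nbhs_dnbhs_neq.
  have hd : `|h| < Num.min d t.
    near: h; apply: dnbhs0_lt => //.
  move: hd; rewrite lt_min => /andP[hd ht].
  rewrite [h *: 1]mulr1 distrC.
  have := dP (h + t); rewrite addrK => /(_ _ _ hd) H.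
  rewrite -[h^-1 *: _]/(h^-1 * _) mulrC; apply: H.
    by move: ht; rewrite ltr_norml => /andP[+ _]; lra.
  by rewrite -subr_eq0 addrK.
have cY t : 0 <= t -> forall eps : R, 0 < eps -> exists2 d : R, 0 < d &
    forall u, 0 <= u -> `|u - t| < d -> `|Y t - Y u| <= eps.
  move=> t0 eps eps0; have [d d0 dP] := q t t0 1 ltr01.
  pose B := 1 + `|L t|; have B0 : 0 < B by rewrite ltr_pwDl.
  exists (Num.min d (eps / B)); first by rewrite lt_min d0 divr_gt0.
  move=> u u0; rewrite lt_min => /andP[ud ue].
  have [->|ut] := eqVneq u t; first by rewrite subrr normr0 ltW.
  have ut0 : u - t != 0 by rewrite subr_eq0.
  have := dP u u0 ut ud; rewrite -/(Y u) -/(Y t) -/(L t) => h.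
  have h2 : `|(Y u - Y t) / (u - t)| <= B.
    rewrite -[X in `|X|](subrK (L t)); apply: (le_trans (ler_normD _ _)).
    by rewrite lerD2r.
  rewrite distrC -[X in `|X|](divfK ut0) normrM.
  apply: (le_trans (ler_pM (normr_ge0 _) (normr_ge0 _) h2 (ltW ue))).
  by rewrite mulrC divfK// gt_eqF.
move: T0; rewrite le_eqVlt => /predU1P[<-|T0].
  by rewrite addr0 expr1n subrr mulr0 addr0.
have dz t : 0 < t -> is_derive t 1 z (L t - C * (2 * (1 + t))).
  move=> t0; have := dY t t0 => dYt.
  apply: is_derive_eq.
  by rewrite /GRing.scale/=; ring.
have cz : {within `[0, T], continuous z}.
  apply/subspace_continuousP => x; rewrite /= in_itv/= => /andP[x0 xT].
  apply: cvgB; last first.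
    have dC : is_derive x 1 (fun u : R => C * (1 + u) ^+ 2) (C * (2 * (1 + x))).
      by apply: is_derive_eq; rewrite /GRing.scale/=; ring.
    have cC : {for x, continuous (fun u : R => C * (1 + u) ^+ 2)}.
      by apply/differentiable_continuous/derivable1_diffP; exact: ex_derive.
    by apply: cvg_within_filter; exact: cC.
  apply/cvgrPdist_le => eps eps0; have [d d0 dP] := cY x x0 eps eps0.
  rewrite near_withinE; apply/nbhs_ballP; exists d => //= u xu.
  by rewrite in_itv/= => /andP[u0 _]; apply: dP; rewrite // distrC.
have [c cT E] : exists2 c, c \in `]0, T[%R & z T - z 0 = (L c - C * (2 * (1 + c))) * (T - 0).
  by apply: MVT => // x; rewrite in_itv/= => /andP[x0 _]; exact: dz.
move: cT; rewrite in_itv/= => /andP[c0 _].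
have : z T - z 0 <= 0.
  rewrite E subr0 mulr_le0_ge0 ?(ltW T0)//.
  have := bnd c c0; rewrite /L; lra.
rewrite /z addr0 expr1n /Y; lra.
Unshelve. all: by end_near. Qed.

End solution.

Theorem proposition1p2 (R : realType) (gamma m0 e0 H0 c_mu l2 : R)
    (gamma_gt : -2 < gamma) (gamma_lt : gamma < 0) :
  let mu : R := (- 4 * gamma * (3 - gamma)) / (3 * (2 + gamma)) in
  exists C : R,
  forall (f0 : R3 R -> R) (f : R -> R3 R -> R),
  (forall v, 0 <= f0 v) ->
  L1space 2 f0 -> LlogL f0 -> f0 \in Lfun leb3 2%:E ->
  mass f0 = m0%:E -> energy f0 = e0%:E -> entropy f0 = H0%:E ->
  ('N[leb3]_2%:E[EFin \o f0])%E = l2%:E ->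
  landau_solution gamma f0 f ->
  (forall t : R, 0 <= t -> (moment mu (f t) <= (c_mu * (1 + t))%:E)%E) ->
  forall t : R, 0 <= t ->
    ('N[leb3]_2%:E[EFin \o f t] ^+ 2 <= (C * (1 + t) ^+ 2)%:E)%E.
Proof.
move=> mu.
have p1 : -1 < gamma / 2 by lra.
have p0 : gamma / 2 < 0 by lra.
set p := gamma / 2 in p1 p0.
have massE (g : R3 R -> R) : rapid g -> mass g = m0%:E -> \int[leb3]_v g v = m0.
  by move=> rg; rewrite /mass eint_rapid// => -[].
(* Ellipticity requires positive mass. Otherwise the integral of [f^2] is at most a bound of [f]
   times a nonpositive mass, so [C = 0] works. *)
have [m00|m00] := leP m0 0.
  exists 0 => f0 f _ _ _ _ mf0 _ _ _ sol _ t t0.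
  have [f' [sf _ _]] := time_quotient (solution_regular sol).
  have rf : rapid (f t) := schwartz_rapid [::] (sf t t0).
  have ft0 v : 0 <= f t v := solution_ge0 sol v t0.
  rewrite Lnorm2_sqr// lee_fin mul0r.
  have [B B0 fB] := rapid_bound 0 rf.
  apply: (@le_trans _ _ (\int[leb3]_v (B * f t v))).
    apply: le_int => [||v]; [exact: rapid_sqr|exact: rapidZ|].
    rewrite expr2 ler_wpM2r//; have := fB v; rewrite expr0 mulr1.
    exact: le_trans (ler_norm _).
  rewrite intZ// (massE _ rf); last by rewrite (solution_mass sol t0).
  by rewrite mulr_ge0_le0.
have [C C0 HC] := static_bound e0 H0 c_mu p1 p0 m00.
exists (l2 ^+ 2 + C) => f0 f f00 _ _ _ mf0 ef0 Hf0 Nf0 sol Mc t t0.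
have [f' [sf sf' qf]] := time_quotient (solution_regular sol).
have rf s : 0 <= s -> rapid (f s) by move=> s0; exact: (schwartz_rapid [::] (sf s s0)).
have fs0 s v : 0 <= s -> 0 <= f s v by move=> s0; exact: (solution_ge0 sol v s0).
have f0E : f 0 = f0 by apply/funext => v; exact: (solution_initial sol).
have quot s s0 := L2sq_quotient sf sf' (qf s s0) s0.
rewrite Lnorm2_sqr; last exact: rf.
have y0 : L2sq (f 0) = l2 ^+ 2.
  have := Lnorm2_sqr (rf 0 (lexx 0)); rewrite f0E Nf0 -f0E.
  by rewrite -EFin_expe => -[].
have N1 : 1 <= (1 + t) ^+ 2 by rewrite exprn_ege1// lerDl.
suff bnd s : 0 < s -> \int[leb3]_v (f s v * f' s v) <= C * (1 + s).
  rewrite lee_fin; apply: (le_trans (L2sq_growth quot bnd t0)); rewrite y0 mulrBr mulrDl mulr1.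
  have := ler_wpM2l (sqr_ge0 l2) N1; rewrite mulr1; move: C0; lra.
move=> s0.
have s0' := ltW s0.
(* The derivative in the Schwartz topology is also the pointwise time derivative, so the equation
   identifies it with the collision operator. *)
have f'E v : f' s v = landau_operator gamma (f s) v.
  rewrite -(solution_equation sol v s0).
  apply/esym; apply: derive_val; apply/is_derive_cvgP; apply/cvgrPdist_le => eps eps0.
  have [d d0 dP] := qf s s0' eps eps0.
  have m0' : 0 < Num.min d s by rewrite lt_min d0.
  near=> h.
  have h0 : h != 0 by near: h; exact: nbhs_dnbhs_neq.
  have hd : `|h| < Num.min d s by near: h; exact: dnbhs0_lt.
  move: hd; rewrite lt_min => /andP[hd hs].
  rewrite [h *: 1]mulr1 distrC.
  have := dP (h + s) v; rewrite addrK => /(_ _ _ hd) H.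
  rewrite -[h^-1 *: _]/(h^-1 * _) mulrC.
  apply: le_trans (H _ _); first by rewrite ler_peMr// bra_expr_ge1.
    by move: hs; rewrite ltr_norml => /andP[+ _]; lra.
  by rewrite -subr_eq0 addrK.
have -> : (fun v => f s v * f' s v) = fun v => f s v * \sum_(i < 3) \sum_(j < 3)
    dflux p (f s) (fun k => iter_partial [:: k] (f s)) (fun k l => iter_partial [:: k; l] (f s)) i j v.
  by apply/funext => v; rewrite f'E landau_operatorE//; exact: sf.
have sfs := sf s s0'; have rfs := rf s s0'.
have rfn : rapid (fun v => f s v * nsq v) by apply: rapidMr => //; exact: slow_nsq.
apply: HC.
- by rewrite lerDl.
- by [].
- by move=> i; exact: schwartz_rapid.
- by move=> i j; exact: schwartz_rapid.
- by move=> i; exact: (schwartz_isd [::]).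
- by move=> i j; exact: (schwartz_isd [:: j]).
- by move=> v; exact: fs0.
- by apply: massE => //; rewrite (solution_mass sol s0').
- have := solution_energy sol s0'; rewrite ef0 /energy.
  under eq_integral do rewrite enorm_sq mulrA.
  rewrite eint_rapid; last by apply: rapidMr => //; exact: slow_cst.
  by rewrite RintegralZr//; [case=> <-; field|exact: integrable_rapid].
- have := solution_entropy sol s0; rewrite Hf0 /entropy -lee_fin.
  rewrite [in X in _ -> X]/Rintegral fineK//.
  by apply: integrable_fin_num => //; apply: integrable_entropy => // v; exact: fs0.
- have := Mc s s0'; rewrite /moment.
  under eq_integral do rewrite japanese_powR mulrC.
  rewrite eint_rapid; last by apply: rapidMl => //; exact: slow_bra_powR.
  rewrite lee_fin /bra_moment (_ : mu / 2 = - (2 * p * (3 - 2 * p)) / (3 * (1 + p)))//.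
  rewrite /mu /p; field.
  by rewrite ?gt_eqF//=; lra.
Unshelve. all: by end_near. Qed.
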